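(* (a) Let $f\in\mathbb{R}[x,y,z]$ be a psd quartic form with $f(0,0,1)=0$, and write $f=f_2(x,y)z^2+f_3(x,y)z+f_4(x,y)$ with $f_i\in\mathbb{R}[x,y]$ homogeneous of degree $i$. Assume $\mathrm{disc}_2(f_2)\neq 0$, $f_2\nmid f_3$, and $\mathrm{disc}_6(4f_2f_4-f_3^2)\neq0$. Then $f$ has precisely $4$ orthogonal equivalence classes of representations as a sum of three squares of quadratic forms. (b) Let $f=z^4+f_2z^2+f_3z+f_4\in\mathbb{R}[x,y,z]$ with $f_i\in\mathbb{R}[x,y]$ homogeneous of degree $i$ ($i=2,3,4$), such that $f$ is strictly positive definite and $f-z^4$ is psd. Assume that none of the following conditions $(E_1)$–$(E_{11})$ holds: $(E_1)$ $\mathrm{disc}_2(f_2)=0$; $(E_2)$ $f_2\mid f_3$; $(E_3)$ $\mathrm{disc}_6(4f_2f_4-f_3^2)=0$; $(E_4)$ $\mathrm{disc}_3(f_3)=0$; $(E_5)$ $\gcd(f_3,f_4)\ne1$; $(E_6)$ $\gcd(g_{23},g_{24})\neq1$; $(E_7)$ $\gcd(g_{24},g_{34})\ne1$; $(E_8)$ $\Phi_{3,4}(f_3,f_2^2,f_4)=0$; $(E_9)$ $\mathrm{disc}_8(g_{23}g_{34}-g_{24}^2)=0$; $(E_{10})$ $\Phi_{8,18}(P,Q,R^2)=0$; $(E_{11})$ $\gcd(f_3,4f_4-f_2^2)\ne 1$. Then $f$ has precisely $8$ orthogonal equivalence classes of representations as a sum of three squares of quadratic forms.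
   Context: A real form is psd if it takes only nonnegative values, strictly positive definite if it takes positive values at all nonzero real points. Two representations $f=\sum_{i=1}^3p_i^2=\sum_{i=1}^3p_i'^2$ with quadratic forms $p_i,p_i'\in\mathbb{R}[x,y,z]$ are (orthogonally) equivalent if there is $S=(s_{ij})\in O_3(\mathbb{R})$ with $p'_j=\sum_i s_{ij}p_i$ for $j=1,2,3$. For a univariate polynomial $F=a_0x^n+\dots+a_n$ over a field, $\mathrm{disc}_n(F)=a_0^{2n-2}\prod_{i<j}(\alpha_i-\alpha_j)^2$ ($\alpha_i$ the roots of $F$ in an algebraic closure) when $a_0\neq 0$; this is an integral polynomial in $a_0,\dots,a_n$, and $\mathrm{disc}_n(F)$ denotes this polynomial evaluated at the coefficients in general. For a binary form $F(x,y)$ of degree $n$, $\mathrm{disc}_n(F):=\mathrm{disc}_n(F(x,1))$. Divisibility and gcd conditions in $(E_2),(E_5),(E_{11})$ are for binary forms in $\mathbb{R}[x,y]$. For $(E_6)$–$(E_{10})$ and $(E_8)$, dehomogenize by setting $y=1$, so $f_2,f_3,f_4\in\mathbb{R}[x]$, and let $'$ denote $d/dx$. Put $g_{ij}:=if_if_j'-jf_jf_i'$ for $i,j\in\{2,3,4\}$, and $P:=g_{23}g_{34}-g_{24}^2$, $Q:=f_4^2g_{23}(2f_4g_{23}-f_3g_{24})$, $R:=(8f_2f_4-3f_3^2)g_{23}+2f_2f_3g_{24}$. For $m,n\ge2$ and $F=\sum_{i=0}^m a_ix^{m-i}$, $G,H$ of degree $\le n$, $\Phi_{m,n}(F,G,H)$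 is the integral polynomial in the coefficients of $F,G,H$ which, when $a_0\neq0$ and $\alpha_1,\dots,\alpha_m$ are the roots of $F$, equals $a_0^{(m-1)(n-1)}\prod_{1\le i<j\le m}\frac{G(\alpha_i)H(\alpha_j)-G(\alpha_j)H(\alpha_i)}{\alpha_i-\alpha_j}$ (this expression is such a polynomial). In $(E_8)$, $F=f_3$ is viewed with $m=3$ and $G=f_2^2,H=f_4$ with $n=4$; in $(E_{10})$, $P$ is viewed with $m=8$ and $Q,R^2$ with $n=18$. *)

(* Defs.v *)
(* R : realType (mathcomp-reals) is the field of real numbers;
   R[i] (mathcomp-real-closed) is its algebraic closure, the complex numbers.
   Polynomials in several variables: multinomials' {mpoly R[n]}.
   Variables of {mpoly R[3]}: 'X_0 = x, 'X_1 = y, 'X_2 = z;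
   of {mpoly R[2]}: 'X_0 = x, 'X_1 = y.  *)
From HB Require Import structures.
From mathcomp Require Import all_boot all_order all_algebra.
From mathcomp Require Import reals.
From mathcomp Require Import complex.
From mathcomp Require Import mpoly.

Set Implicit Arguments.
Unset Strict Implicit.
Unset Printing Implicit Defensive.

Import Order.TTheory GRing.Theory Num.Theory.
Local Open Scope ring_scope.

Section Defs.
Variable R : realType.

Definition zvar : {mpoly R[3]} := 'X_(@ord_max 2).

Definition pt3 (a b c : R) : 'I_3 -> R := fun i => nth 0 [:: a; b; c] i.

Definition emb2 (F : {mpoly R[2]}) : {mpoly R[3]} := mwiden F.

Definition psd (f : {mpoly R[3]}) : Prop := forall v : 'I_3 -> R, 0 <= f.@[v].
Definition spd (f : {mpoly R[3]}) : Prop :=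
  forall v : 'I_3 -> R, (exists i, v i != 0) -> 0 < f.@[v].

Definition sos3_rep (f : {mpoly R[3]}) (p : 'I_3 -> {mpoly R[3]}) : Prop :=
  (forall i, p i \is 2.-homog) /\ f = \sum_(i < 3) p i ^+ 2.

Definition orth_equiv (p p' : 'I_3 -> {mpoly R[3]}) : Prop :=
  exists S : 'M[R]_3, S^T *m S = 1%:M /\
    forall j : 'I_3, p' j = \sum_(i < 3) S i j *: p i.

Definition num_sos3_classes (f : {mpoly R[3]}) (N : nat) : Prop :=
  exists r : 'I_N -> ('I_3 -> {mpoly R[3]}),
    (forall k, sos3_rep f (r k)) /\
    (forall k l, k != l -> ~ orth_equiv (r k) (r l)) /\
    (forall p, sos3_rep f p -> exists k, orth_equiv (r k) p).

Definition mdvd (F G : {mpoly R[2]}) : Prop := exists Q, G = F * Q.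
Definition mcoprime (F G : {mpoly R[2]}) : Prop :=
  forall H, mdvd H F -> mdvd H G -> exists c : R, c != 0 /\ H = c%:MP.

Definition dehom (F : {mpoly R[2]}) : {poly R} :=
  mmap (@polyC R) (fun j : 'I_2 => if j == ord0 then 'X else 1) F.

Definition toC (r : R) : R[i] := Complex r 0.

Definition croots (p : {poly R}) : seq R[i] :=
  sval (closed_field_poly_normal (map_poly toC p)).

Definition trunc (n : nat) (p : {poly R}) : {poly R} := \poly_(k < n.+1) p`_k.

Definition setlead (n : nat) (p : {poly R}) (t : R) : {poly R} :=
  trunc n p + (t - p`_n) *: 'X^n.

(* Value at t = 0 of the polynomial of degree <= D interpolating g at
   the nodes t = 1, ..., D+1 (Lagrange interpolation). *)
Definition interp0 (D : nat) (g : R -> R) : R :=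
  \sum_(k < D.+1) g k.+1%:R *
    \prod_(l < D.+1 | l != k) ((0 - l.+1%:R) / (k.+1%:R - l.+1%:R)).

(* If Psi(a_0,...) is a polynomial of degree <= D in a_0 and g t is its value
   for a_0 = t, t <> 0, then polyext D g a_0 is its value at any a_0. *)
Definition polyext (D : nat) (g : R -> R) (a0 : R) : R :=
  if a0 != 0 then g a0 else interp0 D g.

Definition disc_root (n : nat) (p : {poly R}) (t : R) : R :=
  let s := croots (setlead n p t) in
  @complex.Re R (toC t ^+ (2 * n - 2) *
      \prod_(i < n) \prod_(j < n | (i < j)%N) (s`_i - s`_j) ^+ 2).

(* disc_n(F) for F = a_0 x^n + ... + a_n (a_i = coefficient of x^(n-i)),
   the discriminant polynomial evaluated at (a_0,...,a_n); it is
   homogeneous of degree 2n-2 in the a_i. *)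
Definition disc (n : nat) (p : {poly R}) : R :=
  polyext (2 * n - 2) (disc_root n p) p`_n.

Definition bdisc (n : nat) (F : {mpoly R[2]}) : R := disc n (dehom F).

(* (G(u)H(v) - G(v)H(u))/(u - v) as a polynomial function of (u,v):
   on the diagonal u = v its value is (G'H - GH')(u). *)
Definition bez (G H : {poly R}) (u v : R[i]) : R[i] :=
  let G' := map_poly toC G in let H' := map_poly toC H in
  if u != v then (G'.[u] * H'.[v] - G'.[v] * H'.[u]) / (u - v)
  else (G'^`().[u] * H'.[u] - G'.[u] * H'^`().[u]).

Definition Phi_root (m n : nat) (F G H : {poly R}) (t : R) : R :=
  let s := croots (setlead m F t) in
  @complex.Re R (toC t ^+ ((m - 1) * (n - 1)) *
      \prod_(i < m) \prod_(j < m | (i < j)%N)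
         bez (trunc n G) (trunc n H) s`_i s`_j).

(* Phi_{m,n}(F,G,H), F viewed with degree m, G,H with degree n; it is
   homogeneous of degree (m-1)(n-1) in the coefficients of F. *)
Definition Phi (m n : nat) (F G H : {poly R}) : R :=
  polyext ((m - 1) * (n - 1)) (Phi_root m n F G H) F`_m.

Definition gij (i j : nat) (fi fj : {poly R}) : {poly R} :=
  fi * fj^`() *+ i - fj * fi^`() *+ j.

End Defs.

(* Main.v *)
(* Put y = 1 and embed the problem in the pencil f_t = t^2 z^4 + p2 z^2 + p3 z + p4, whose
   ends t = 0 and t = 1 are the two cases. Up to O(3), a representation of f_t is
   (t z^2 + g, b1 z + c1, b2 z + c2); then h = p2 - 2 t g = |b|^2 is nonnegative,
   k = p4 - g^2 = |c|^2, and 4 h k - p3^2 is the square of w = 2 (b1 c2 - b2 c1). Conversely h, k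
   and p3 + i w determine b1 + i b2 and c1 + i c2 up to a unit factor, so the classes correspond
   to the real solutions g of 4 h k - p3^2 = w^2 with h >= 0 (up to g -> - g when t = 0).

   At t = 0 this reads w^2 + 4 p2 g^2 = D := 4 p2 p4 - p3^2, with D separable, of degree 6 and
   positive. For each choice of signs, the conditions w = +- sqrt (- 4 p2) g at three nonconjugate
   roots of D leave one line in the space of pairs (g, w): this gives 8 solutions g, that is 4 up
   to sign. From t = 0 to t = 1 the solutions stay bounded, and they can neither merge nor leave
   the condition h >= 0: a degenerate solution would give f_t a singular point, which is excluded at
   real points by positivity and at nonreal ones by the conditions (E). Hence 8 solutions at t = 1. *)
Require Import Defs.
From HB Require Import structures.
From mathcomp Require Import all_boot all_order all_fingroup all_algebra.
From mathcomp Require Import zify ring lra.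
From mathcomp Require boolp classical_sets functions interval_inference topology normedtype sequences.
From mathcomp Require Import reals.
From mathcomp Require Import complex.
Import Order.TTheory GRing.Theory Num.Theory.
Local Open Scope ring_scope.
Set Implicit Arguments.
Unset Strict Implicit.
Unset Printing Implicit Defensive.

(** Three difficulties shape the proof. Zeros of the forms may lie on [y = 0], so a statement at
    finite points usually has a companion about top coefficients, which are the values at infinity.

    A degeneracy at a nonreal point [a] forces either [p2^2 = 4 t^2 p4] and [p3 = 0] at [a], or
    [R^2 = 128 t^2 Q] and [P = 0] at [a]. As [t] is real, the same ratio occurs at the conjugate of
    [a], and [Phi] detects exactly such a coincidence at two distinct roots. This is where the two
    forms [Phi] come from.

    The discriminants and [Phi] are given by roots when the leading coefficient is nonzero and by
    interpolation when it vanishes. To make them vanish in every degenerate case one needs their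
    polynomiality in the coefficients. It is obtained by averaging over permutations of the roots
    and expanding the resulting permanents with Ryser's formula, each term of which is a product of
    values of one polynomial at all roots. *)

Module Continuation.
Import boolp classical_sets functions interval_inference topology normedtype sequences.
Import Order.TTheory GRing.Theory Num.Theory numFieldNormedType.Exports.
Local Open Scope classical_set_scope.
Local Open Scope ring_scope.

(** * Continuation of nondegenerate zeros along a parameter *)

HB.instance Definition _ (R : realType) m n :=
  Complete.copy (matrix R m n) (matrix R m n).

Lemma ultra_fmap (T U : Type) (f : T -> U) (G : set_system T) :
  UltraFilter G -> UltraFilter (fmap f G).
Proof.
move=> UG; split; first exact: fmap_proper_filter.
move=> H PH sH; apply/seteqP; split=> // A HA.
have [//|GnA] := in_ultra_setVsetC (f @^-1` A) UG.
have nA : H (~` A) by exact: sH.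
by have [x [/(_ _)]] := filter_ex (filterI nA HA).
Qed.

(* [M t X Y] is a difference quotient of [F t], so that the zeros of [F t] deform
   uniquely near a zero where [M t X X] is invertible. *)
Section Continuation.
Variables (R : realType) (n : nat).
Local Notation V := 'rV[R]_n.
Variables (F : R -> V -> V) (M : R -> V -> V -> 'M[R]_n).
Variables (C : R -> V -> Prop) (s : V -> V).

Hypothesis F_M : forall t X Y, F t X - F t Y = (X - Y) *m M t X Y.
Hypothesis F_cont : forall t X j, {for (t, X), continuous (fun p : R * V => F p.1 p.2 0 j)}.
Hypothesis M_cont : forall t X i j,
  {for ((t, X), X), continuous (fun p : R * V * V => M p.1.1 p.1.2 p.2 i j)}.

Lemma rv_coord_le (Y : V) j : `|Y 0 j| <= `|Y|.
Proof.
rewrite [leRHS]/Num.norm /= mx_normrE.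
by apply/bigmax_geP; right => /=; exists (0, j).
Qed.

Lemma rv_norm_le (Y : V) e : 0 <= e -> (forall j, `|Y 0 j| <= e) -> `|Y| <= e.
Proof.
move=> e0 He; rewrite [leLHS]/Num.norm /= mx_normrE.
by apply/bigmax_leP; split=> //= -[i j] _ /=; rewrite (ord1 i).
Qed.

(** Dividing by [n.+1] rather than [n] keeps the entrywise bound positive when [n = 0]. *)
Lemma mulmx_small (Y : V) (N : 'M[R]_n) e : 0 <= e ->
  (forall i j, `|N i j| <= e / n.+1%:R) -> `|Y *m N| <= e * `|Y|.
Proof.
move=> e0 HN; apply: rv_norm_le => [|j]; first by rewrite mulr_ge0.
rewrite mxE (le_trans (ler_norm_sum _ _ _)) //.
have -> : e * `|Y| = \sum_(i < n.+1) (`|Y| * (e / n.+1%:R)).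
  rewrite sumr_const card_ord -[RHS]mulr_natr -mulrA divfK ?pnatr_eq0 //.
  by rewrite mulrC.
rewrite big_ord_recr /= -[X in X <= _]addr0 lerD //; last first.
  by rewrite !mulr_ge0 ?invr_ge0 ?ler0n.
by apply: ler_sum => i _; rewrite normrM ler_pM // rv_coord_le.
Qed.

Lemma cont_sum (T : topologicalType) (I : finType) (f : I -> T -> R) x :
  (forall i, {for x, continuous (f i)}) ->
  {for x, continuous (fun y => \sum_i f i y)}.
Proof.
move=> H; rewrite /prop_for.
by apply: cvg_big => // [|i _]; [exact: add_continuous | exact: H].
Qed.

(** The matrix [1 - M * M0^-1] vanishes at the base point, so by continuity its entries are small
    nearby. Uniqueness and existence of nearby zeros both rest on this estimate. *)
Lemma M_near t0 X0 : M t0 X0 X0 \in unitmx ->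
  \forall p \near ((t0, X0), X0), forall Y : V,
    `|Y - Y *m M p.1.1 p.1.2 p.2 *m invmx (M t0 X0 X0)| <= 2^-1 * `|Y|.
Proof.
move=> uM; set M0 := M t0 X0 X0.
have c0 : (0 : R) < 2^-1 / n.+1%:R by rewrite divr_gt0 ?invr_gt0 ?ltr0n.
pose N (p : R * V * V) := 1%:M - M p.1.1 p.1.2 p.2 *m invmx M0.
have HN i j : \forall p \near ((t0, X0), X0), `|N p i j| <= 2^-1 / n.+1%:R.
  have Nc : {for ((t0, X0), X0), continuous (fun p => N p i j)}.
    rewrite (_ : (fun p => N p i j) = fun p : R * V * V =>
      (1%:M : 'M[R]_n) i j - \sum_k M p.1.1 p.1.2 p.2 i k * invmx M0 k j);
      last by apply/funext => p; rewrite !mxE.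
    apply: cvgB; first exact: cvg_cst.
    apply: cont_sum => k; apply: cvgM; [exact: M_cont | exact: cvg_cst].
  have N0 : N (t0, X0, X0) i j = 0 by rewrite /N /= mulmxV // subrr mxE.
  move/cvgrPdist_le : Nc => /(_ _ c0); apply: filterS => p /=.
  by rewrite N0 sub0r normrN.
have : \forall p \near ((t0, X0), X0), forall i j, `|N p i j| <= 2^-1 / n.+1%:R.
  by apply: (filter_forall (F := nbhs (t0, X0, X0))) => i; apply: (filter_forall (F := nbhs (t0, X0, X0))) => j; exact: HN.
apply: filterS => p Hp Y.
have -> : Y - Y *m M p.1.1 p.1.2 p.2 *m invmx M0 = Y *m N p.
  by rewrite /N mulmxBr mulmx1 mulmxA.
by apply: mulmx_small => //; rewrite invr_ge0.
Qed.

(** Two zeros satisfy [(X - Y) *m M t X Y = 0], and the estimate gives [|X - Y| <= |X - Y| / 2]. *)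
Lemma zero_unique t0 X0 : M t0 X0 X0 \in unitmx ->
  \forall p \near ((t0, X0), X0), F p.1.1 p.1.2 = 0 -> F p.1.1 p.2 = 0 -> p.1.2 = p.2.
Proof.
move=> uM; apply: filterS (M_near uM) => -[[t X] Y] /= H FX FY.
have E : (X - Y) *m M t X Y = 0 by rewrite -F_M FX FY subrr.
move: (H (X - Y)); rewrite E mul0mx subr0 => le; apply/eqP.
by rewrite -subr_eq0 -normr_eq0 eq_le normr_ge0 andbT; lra.
Qed.

Lemma zero_exists t0 X0 (U : set V) : M t0 X0 X0 \in unitmx -> F t0 X0 = 0 ->
  nbhs X0 U -> \forall t \near t0, exists2 X, U X & F t X = 0.
Proof.
move=> uM FX0 UX0; set M0 := M t0 X0 X0.
have [[A B] [/= A0 B0] ABH] := M_near uM.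
case: A0 => -[A1 A2] /= [A10 A20] A12.
have : nbhs X0 (U `&` (A2 `&` B)) by do 2! apply: filterI => //.
move/nbhs_closedballP => [e]; set r := e%:num => sub.
have r0 : 0 < r by rewrite /r.
have HT : \forall t \near t0, `|F t X0 *m invmx M0| <= r / 2.
  have c0 : (0 : R) < r / 2 by rewrite divr_gt0.
  have : \forall t \near t0, forall j, `|(F t X0 *m invmx M0) 0 j| <= r / 2.
    apply: (filter_forall (F := nbhs t0)) => j.
    have Gc : {for t0, continuous (fun t => (F t X0 *m invmx M0) 0 j)}.
      rewrite (_ : (fun t => _) = fun t => \sum_k F t X0 0 k * invmx M0 k j);
        last by apply/funext => p; rewrite !mxE.
      apply: (@cont_sum R _ (fun k t => F t X0 0 k * invmx M0 k j)) => k.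
      apply: cvgM; last exact: cvg_cst.
      have H : (fun t => (t, X0)) @ t0 --> (t0, X0).
        move=> W [[W1 W2] [/= W10 W20] sW]; apply: (filterS _ W10) => t W1t /=.
        by apply: sW; split => //=; exact: nbhs_singleton.
      exact: (cvg_comp _ _ H (@F_cont t0 X0 k)).
    move/cvgrPdist_le : Gc => /(_ _ c0); apply: filterS => t /=.
    by rewrite FX0 mul0mx mxE sub0r normrN.
  by apply: filterS => t Ht; apply: rv_norm_le => //; exact: ltW.
have : \forall t \near t0, A1 t by [].
move: HT; apply: filterS2 => t Ht A1t.
(* Newton's map with the derivative frozen at the base point. It contracts by 1/2 and moves the
   centre by at most [r / 2], so it preserves the closed ball and has a fixed point there, which is
   a zero. *)
pose T X := X - F t X *m invmx M0.
have bX X : closed_ball X0 r X -> [/\ U X, A2 X & B X] by move/sub => [? []].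
have TT X Y : closed_ball X0 r X -> closed_ball X0 r Y ->
    `|T X - T Y| <= 2^-1 * `|X - Y|.
  move=> /bX[_ a _] /bX[_ _ b].
  have := ABH (t, X, Y) (conj (A12 (t, X) (conj A1t a)) b) (X - Y).
  rewrite /= -F_M mulmxBl.
  suff -> : T X - T Y = X - Y - (F t X *m invmx M0 - F t Y *m invmx M0) by [].
  by rewrite /T [in RHS]opprD opprD !opprK addrACA.
have tri (a b c : V) : a - c = (a - b) - (c - b) by rewrite opprB addrA subrK.
have X0in : closed_ball X0 r X0 by apply: closed_ballxx.
have TU : set_fun (closed_ball X0 r) (closed_ball X0 r) T.
  move=> X HX; have := TT _ _ HX X0in.
  move: HX; rewrite !closed_ballE // /closed_ball_ /= => HX le.
  rewrite (tri X0 (T X0) (T X)).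
  rewrite (le_trans (ler_normB _ _)) //.
  have -> : X0 - T X0 = F t X0 *m invmx M0 by rewrite /T subKr.
  move: HX le Ht; rewrite (distrC X X0) => *; lra.
pose f : {fun closed_ball X0 r >-> closed_ball X0 r} := mkfun_fun TU.
have ctr : is_contraction f.
  have h0 : (0:R) <= 2^-1 by rewrite invr_ge0.
  exists (NngNum h0); split => /=; first by lra.
  by move=> [X Y] /= [HX HY]; exact: TT.
have clU : closed (closed_ball X0 r) by exact: closed_ball_closed.
have [|X HX /= EX] := banach_fixed_point ctr clU; first by exists X0.
exists X; first by case: (bX _ HX).
have E : F t X *m invmx M0 = 0.
  have EX' : X = X - F t X *m invmx M0 := EX.
  by rewrite -[LHS](subKr X) -EX' subrr.
by rewrite -[F t X]mulmx1 -(mulVmx uM) mulmxA E mul0mx.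
Qed.


Local Notation I := (fun t : R => 0 <= t <= 1).
Local Notation sol t X := (C t X /\ F t X = 0).

Hypothesis M_unit : forall t X, I t -> sol t X -> M t X X \in unitmx.
Hypothesis sol_bounded : exists B, forall t X, I t -> sol t X -> `|X| <= B.
Hypothesis C_closed : closed [set p : R * V | C p.1 p.2].
Hypothesis C_open : forall t X, I t -> sol t X ->
  \forall p \near (t, X), I p.1 -> F p.1 p.2 = 0 -> C p.1 p.2.
Hypothesis s_cont : continuous s.
Hypothesis s_sol : forall t X, sol t X -> sol t (s X).

(** Zeros are separated modulo [s], which will be the sign change of [w]; what is counted is then
    the number of polynomials [g]. *)
Definition solutions N t := exists Y : 'I_N -> V,
  (forall i, sol t (Y i)) /\ (forall i j, i != j -> Y i <> Y j /\ Y i <> s (Y j)).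

Lemma neq_near (f : V -> V) (a b : V) : continuous f -> a <> f b ->
  \forall e \near 0^'+, forall X Y : V, ball a e X -> ball b e Y -> X <> f Y.
Proof.
move=> fc ab.
have d0 : 0 < `|a - f b| by rewrite normr_gt0 subr_eq0; apply/eqP.
have h : 0 < `|a - f b| / 2 by rewrite divr_gt0.
have /nbhs_ballP [d /= dgt0 Hd] : nbhs b (f @^-1` (ball (f b) (`|a - f b| / 2))).
  by apply: fc; exact: nbhsx_ballx.
near=> e => X Y aX bY E.
have /= : (f @^-1` (ball (f b) (`|a - f b| / 2))) Y.
  by apply: Hd; apply: le_ball bY; near: e; apply: nbhs_right_le.
have : ball a (`|a - f b| / 2) X.
  by apply: le_ball aX; near: e; apply: nbhs_right_le.
rewrite -!ball_normE /ball_ /= E => h1 h2.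
have := ler_distD (f Y) a (f b); rewrite (distrC (f Y) (f b)); lra.
Unshelve. all: by end_near. Qed.

(** Each zero persists in a small ball around it, and balls small enough keep the zeros apart modulo
    [s]. *)
Lemma solutions_open N t0 : I t0 -> solutions N t0 ->
  \forall t \near t0, I t -> solutions N t.
Proof.
move=> It0 [Y [solY dY]].
have : \forall e \near (0 : R)^'+, forall i j, i != j -> forall X X' : V,
    ball (Y i) e X -> ball (Y j) e X' -> X <> X' /\ X <> s X'.
  apply: (filter_forall (F := (0 : R)^'+)) => i; apply: (filter_forall (F := (0 : R)^'+)) => j.
  have [->|ij] := eqVneq i j; first by near=> e.
  have [d1 d2] := dY _ _ ij.
  have n1 := @neq_near id _ _ (fun x => cvg_id) d1.
  move: n1 (neq_near s_cont d2); apply: filterS2 => e h1 h2 _ X X' b1 b2.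
  by split; [exact: h1 | exact: h2].
move=> He; have [e [He' e0]] := filter_ex (filterI He (nbhs_right_gt 0)).
have : \forall t \near t0, forall i, I t -> exists2 X, ball (Y i) e X & sol t X.
  apply: (filter_forall (F := nbhs t0)) => i.
  have [[A1 A2] [/= A10 A20] sA] := C_open It0 (solY i).
  have U0 : nbhs (Y i) (A2 `&` ball (Y i) e) by apply: filterI => //; exact: nbhsx_ballx.
  have uM := M_unit It0 (solY i).
  have A10' : \forall t \near t0, A1 t by [].
  move: A10' (zero_exists uM (solY i).2 U0).
  apply: filterS2 => t A1t [X [A2X bX] FX It]; exists X => //; split => //.
  by apply: (sA (t, X)).
apply: filterS => t Ht It.
have /choice [Z HZ] : forall i, exists X, ball (Y i) e X /\ sol t X.
  by move=> i; have [X ? ?] := Ht i It; exists X.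
exists Z; split=> [i|i j ij]; first by case: (HZ i).
by apply: (He' _ _ ij); [case: (HZ i) | case: (HZ j)].
Unshelve. all: by end_near. Qed.

(** By compactness, [N] zeros for parameters accumulating at [t0] have limits, which are zeros at
    [t0]. The limits remain distinct modulo [s], because near a nondegenerate zero there is only one
    zero for each parameter. *)
Lemma solutions_closed N t0 : I t0 -> ~ solutions N t0 ->
  \forall t \near t0, I t -> ~ solutions N t.
Proof.
move=> It0 nsol; apply: contrapT => nn.
pose A := [set t | I t /\ solutions N t].
have PF : ProperFilter (within A (nbhs t0)).
  apply: Build_ProperFilter_ex => P; rewrite /within /= => HP.
  apply: contrapT => nP; apply: nn; move: HP; apply: filterS => t HP It St.
  by apply: nP; exists t; apply: HP.
(* An ultrafilter finer than the parameters with [N] solutions takes the place of a convergent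
   subsequence: every bounded family has a limit along it. *)
have [G [UG sG]] := ultraFilterLemma PF.
have GA : G A by apply: sG; apply: withinT.
have Gt0 : G --> t0 by move=> W W0; apply: sG; apply: (filterS _ W0) => t Wt _.
have /choice [Y HY] : forall t, exists Y : 'I_N -> V, A t ->
    (forall i, sol t (Y i)) /\ (forall i j, i != j -> Y i <> Y j /\ Y i <> s (Y j)).
  move=> t; have [[_ [Y HY]]|nA] := pselect (A t); first by exists Y.
  by exists (fun=> 0) => At; case: (nA At).
have [B HB] := sol_bounded.
have cB : compact [set X : V | `|X| <= B].
  apply: bounded_closed_compact.
    by exists B; split; [exact: num_real | move=> x Bx X /= /le_trans; apply; exact: ltW].
  rewrite (_ : [set X : V | _] = closed_ball_ Num.norm 0 B).
    exact: closed_closed_ball_.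
  by apply/seteqP; split=> X; rewrite /closed_ball_ /= sub0r normrN.
have HZ0 (i : 'I_N) : exists Z : V, (fun t => Y t i) @ G --> Z.
  move: cB; rewrite compact_ultra => /(_ ((fun t => Y t i) @ G)).
  case.
  - exact: ultra_fmap.
  - suff : G [set t | `|Y t i| <= B] by [].
    apply: (filterS _ GA) => t At /=; have [It _] : I t /\ solutions N t := At.
    by apply: (HB t) => //; exact: (HY t At).1.
  - by move=> Z [_ HZ]; exists Z.
have [Z HZ] := choice HZ0.
have cvgp (f : R -> V) (z : V) : f @ G --> z -> (fun t => (t, f t)) @ G --> (t0, z).
  move=> fz W [[W1 W2] [/= W10 W20] sW].
  have G1 : G W1 by exact: (Gt0 W1 W10).
  have G2 : G (f @^-1` W2) by exact: (fz W2 W20).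
  suff : G [set t | W (t, f t)] by [].
  by apply: filterS (filterI G1 G2) => t [? ?]; apply: (sW (t, f t)).
have solZ i : sol t0 (Z i).
  split.
    apply: contrapT => nC.
    have nb : nbhs (t0, Z i) (~` [set p : R * V | C p.1 p.2]).
      by apply: open_nbhs_nbhs; split=> //; exact: closed_openC.
    have Gn : G [set t | ~ C t (Y t i)] by exact: (cvgp _ _ (HZ i) _ nb).
    have [t [nCt At]] := filter_ex (filterI Gn GA).
    by apply: nCt; case: ((HY t At).1 i).
  apply/rowP => j; rewrite mxE.
  have c1 : (fun t => F t (Y t i) 0 j) @ G --> F t0 (Z i) 0 j.
    exact: (cvg_comp _ _ (cvgp _ _ (HZ i)) (@F_cont t0 (Z i) j)).
  have c2 : (fun t => F t (Y t i) 0 j) @ G --> (0 : R).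
    apply: cvg_near_cst; apply: filterS GA => t At.
    by case: ((HY t At).1 i) => _ ->; rewrite mxE.
  by apply: (cvg_unique _ c1 c2).
(* Two families of zeros with a common limit agree at some parameter. It is applied to [Y i], [Y j]
   and to [Y i], [s (Y j)]. *)
have key (f g : R -> V) z : f @ G --> z -> g @ G --> z -> sol t0 z ->
    (forall t, A t -> sol t (f t)) -> (forall t, A t -> sol t (g t)) ->
    exists2 t, A t & f t = g t.
  move=> fz gz sz sf sg.
  have [[W1 W2] [/= W10 W20] sW] := zero_unique (M_unit It0 sz).
  have G1 : G ((fun t => (t, f t)) @^-1` W1) by exact: (cvgp _ _ fz W1 W10).
  have G2 : G (g @^-1` W2) by exact: (gz W2 W20).
  have [t [[? ?] At]] := filter_ex (filterI (filterI G1 G2) GA).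
  exists t => //; apply: (sW ((t, f t), g t)) => //=; [exact: (sf t At).2 | exact: (sg t At).2].
apply: nsol; exists Z; split=> // i j ij; split=> E.
  have [|||t At Et] := key (fun t => Y t i) (fun t => Y t j) (Z i) (HZ i) _ (solZ i).
  - by rewrite E; exact: HZ.
  - by move=> t At; exact: (HY t At).1.
  - by move=> t At; exact: (HY t At).1.
  by case: ((HY t At).2 i j ij).
have [|||t At Et] := key (fun t => Y t i) (fun t => s (Y t j)) (Z i) (HZ i) _ (solZ i).
- by rewrite E; exact: (cvg_comp _ _ (HZ j) (@s_cont _)).
- by move=> t At; exact: (HY t At).1.
- by move=> t At; apply: s_sol; exact: (HY t At).1.
by case: ((HY t At).2 i j ij).
Qed.

(** The truth value of [solutions N] is locally constant on the connected interval [0, 1]. *)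
Lemma solutions01 N : solutions N 0 <-> solutions N 1.
Proof.
pose A := [set t : R | I t].
have cA : connected A.
  rewrite (_ : A = `[0, 1]%classic); first exact: segment_connected.
  by apply/seteqP; split=> t /=; rewrite in_itv.
pose B := A `&` [set t | solutions N t <-> solutions N 0].
have loc t0 : A t0 -> \forall t \near t0, A t -> (solutions N t <-> solutions N t0).
  move=> At0; have [S|nS] := pselect (solutions N t0).
    by move: (solutions_open At0 S); apply: filterS => t H At; split=> // _; exact: H.
  by move: (solutions_closed At0 nS); apply: filterS => t H At; split=> // /(H At).
have opn (P : set R) : (forall t0 t, A t0 -> A t -> (solutions N t <-> solutions N t0) -> P t0 -> P t) ->
    exists2 O, open O & A `&` P = A `&` O.
  move=> HP; exists ([set t | A t -> P t]°); first exact: open_interior.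
  apply/seteqP; split=> t [At Pt]; split=> //; last by apply: (interior_subset Pt).
  by move: (loc _ At); apply: filterS => t1 H At1; exact: HP (H At1) Pt.
have A0 : A 0 by rewrite /A /= lexx ler01.
have A1 : A 1 by rewrite /A /= lexx ler01.
have BA : B = A.
  apply: cA; first by exists 0.
    by apply: opn => t0 t _ _ H /= <-.
  have [|O oO EO] := opn (~` [set t | solutions N t <-> solutions N 0]).
    by move=> t0 t _ _ H /= nH; rewrite H.
  exists (~` O); first exact: open_closedC.
  apply/seteqP; split=> t [At Bt]; split=> //.
    by move=> Ot; have [_ /(_ Bt)] : (A `&` ~` [set t | solutions N t <-> solutions N 0]) t by rewrite EO.
  apply: contrapT => nB; apply: Bt.
  by have [] : (A `&` O) t by rewrite -EO.
have [_ /= H] : B 1 by rewrite BA.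
exact: iff_sym H.
Qed.

End Continuation.
End Continuation.

Lemma poly0_horner (K : numDomainType) (p : {poly K}) : (forall t, p.[t] = 0) -> p = 0.
Proof.
move=> H; apply: (@roots_geq_poly_eq0 _ _ [seq k%:R : K | k <- iota 0 (size p)]).
- by apply/allP => x _; rewrite rootE H.
- by rewrite map_inj_uniq ?iota_uniq // => a b /eqP; rewrite eqr_nat => /eqP.
- by rewrite size_map size_iota.
Qed.

(** * Real polynomials at complex points *)

Section ComplexEvaluation.
Variable R : rcfType.
Local Notation C := R[i].
Local Notation cx := (map_poly (real_complex R)).

Definition evC (p : {poly R}) (a : C) : C := (cx p).[a].

Lemma evCD p q a : evC (p + q) a = evC p a + evC q a.
Proof. by rewrite /evC rmorphD hornerD. Qed.
Lemma evCN p a : evC (- p) a = - evC p a.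
Proof. by rewrite /evC rmorphN hornerN. Qed.
Lemma evCM p q a : evC (p * q) a = evC p a * evC q a.
Proof. by rewrite /evC rmorphM hornerM. Qed.
Lemma evCX p n a : evC (p ^+ n) a = evC p a ^+ n.
Proof. by rewrite /evC rmorphXn horner_exp. Qed.
Lemma evCZ c p a : evC (c *: p) a = c%:C%C * evC p a.
Proof. by rewrite /evC map_polyZ hornerZ. Qed.
Lemma evCMn p n a : evC (p *+ n) a = evC p a *+ n.
Proof. by rewrite /evC rmorphMn hornerMn. Qed.
Lemma evC0 a : evC 0 a = 0.
Proof. by rewrite /evC rmorph0 horner0. Qed.
Lemma evC1 a : evC 1 a = 1.
Proof. by rewrite /evC rmorph1 hornerC. Qed.
Definition evCE := (evCD, evCN, evCM, evCX, evCZ, evCMn, evC0, evC1).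

Lemma evC_real p (x : R) : evC p x%:C%C = (p.[x])%:C%C.
Proof. by rewrite /evC -horner_map. Qed.

Lemma evC_conj p a : evC p a^*%C = ((evC p a)^*)%C.
Proof.
have cK : conjc \o real_complex R =1 real_complex R.
  by move=> x; rewrite /= /real_complex_def /= oppr0.
rewrite /evC -horner_map -map_poly_comp; congr (_.[_]).
by apply/polyP => k; rewrite !coef_map /= oppr0.
Qed.

Lemma evC_conj0 p a : evC p a = 0 -> evC p a^*%C = 0.
Proof. by rewrite evC_conj => ->; rewrite rmorph0. Qed.

Lemma real_or_nonreal (a : C) : (exists x : R, a = x%:C%C) \/ a != a^*%C.
Proof.
case: a => x y; have [->|y0] := eqVneq y 0; [by left; exists x|right].
rewrite eq_complex /= negb_and; apply/orP; right.
by apply: contra y0 => /eqP E; apply/eqP; lra.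
Qed.

Lemma evC_root p (x : R) : evC p x%:C%C = 0 -> p.[x] = 0.
Proof. by rewrite evC_real => -[]. Qed.

Lemma factorC p a : evC p a = 0 -> exists q : {poly C}, cx p = ('X - a%:P) * q.
Proof. by move=> H; have /factor_theorem [q ->] : root (cx p) a; [exact/rootP | exists q; rewrite mulrC]. Qed.

Lemma factorR (p : {poly R}) x : p.[x] = 0 -> exists q : {poly R}, p = ('X - x%:P) * q.
Proof. by move=> H; have /factor_theorem [q ->] : root p x; [exact/rootP | exists q; rewrite mulrC]. Qed.

Lemma coprime_evC p q : (forall a, ~ (evC p a = 0 /\ evC q a = 0)) -> coprimep p q.
Proof.
move=> H; rewrite -(coprimep_map (real_complex R)) coprimep_def.
have [//|s1] := eqVneq.
have [r Hr] : exists r, root (gcdp (cx p) (cx q)) r by exact/closed_rootP.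
by case: (H r); rewrite root_gcd in Hr; case/andP: Hr => /rootP ? /rootP.
Qed.

(** At a simple zero the polynomial would change sign. *)
Lemma nneg_double_root (p : {poly R}) x : (forall y, 0 <= p.[y]) -> p.[x] = 0 ->
  exists q : {poly R}, p = ('X - x%:P) ^+ 2 * q.
Proof.
move=> pge /factorR [q Eq]; suff q0 : q.[x] = 0.
  by have [r Er] := factorR q0; exists r; rewrite Eq Er expr2 mulrA.
have ev y : p.[y] = (y - x) * q.[y] by rewrite Eq hornerM hornerXsubC.
have [r Er] : exists r, q = (q.[x])%:P + ('X - x%:P) * r.
  have /factorR [r Er] : (q - (q.[x])%:P).[x] = 0 by rewrite hornerD hornerN hornerC subrr.
  by exists r; rewrite -Er addrC subrK.
have evq y : q.[y] = q.[x] + (y - x) * r.[y].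
  by rewrite {1}Er hornerD hornerC hornerM hornerXsubC.
have [B HB] := poly_itv_bound r (x - 1) (x + 1).
have B0 : 0 <= B by apply: le_trans (normr_ge0 _) (HB x _); apply/andP; split; lra.
apply/eqP; apply: contraT => qx; exfalso.
(* At distance [e <= 1] from [x] the error [e * B] stays below [|q(x)|], so [q] keeps its sign while
   the factor [X - x] can be given either sign. *)
pose e := Num.min 1 (`|q.[x]| / (2 * (B + 1))).
have q0 : 0 < `|q.[x]| by rewrite normr_gt0.
have e0 : 0 < e by rewrite lt_min ltr01 divr_gt0 // mulr_gt0 //; lra.
have e1 : e <= 1 by rewrite ge_min lexx.
have eB : e * B < `|q.[x]|.
  have : e <= `|q.[x]| / (2 * (B + 1)) by rewrite ge_min lexx orbT.
  rewrite ler_pdivlMr; last by lra.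
  nra.
case: (ltrgt0P q.[x]) => qs; last by rewrite qs eqxx in qx.
- have := pge (x - e); rewrite ev evq.
  have : `|r.[x - e]| <= B by apply: HB; apply/andP; split; lra.
  rewrite ler_norml => /andP[]; rewrite ger0_norm in eB; last by lra.
  nra.
- have := pge (x + e); rewrite ev evq.
  have : `|r.[x + e]| <= B by apply: HB; apply/andP; split; lra.
  rewrite ler_norml => /andP[]; rewrite ltr0_norm // in eB.
  nra.
Qed.

Lemma evC_nonreal_linear (p : {poly R}) (a : C) : a != a^*%C -> (size p <= 2)%N -> evC p a = 0 -> p = 0.
Proof.
case: a => u v na sp.
have v0 : v != 0.
  by apply: contra na => /eqP ->; rewrite eq_complex /= oppr0 !eqxx.
rewrite /evC (horner_coef_wide _ (_ : size (cx p) <= 2)%N) ?size_map_poly //.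
rewrite !big_ord_recl big_ord0 /= !coef_map /= expr0 expr1 mulr1 addr0.
move=> E; have := congr1 (@complex.Im R) E; have := congr1 (@complex.Re R) E; rewrite /=.
rewrite !mul0r !addr0 !subr0 !add0r => E0 /eqP; rewrite mulf_eq0 (negPf v0) orbF => /eqP p1.
move: E0; rewrite p1 mul0r addr0 => p0.
by apply/polyP => -[|[|k]]; rewrite coef0 // nth_default // (leq_trans sp).
Qed.

End ComplexEvaluation.

(* At a singular point [z] of the quartic, [2 * t^2 * z^4 = 2 * p4 + p3 * z]; this
   eliminates [z] and gives [128 * t^2 * Q = R^2]. *)
Lemma singular_QR (F : comNzRingType) (t h z G p2 p3 p4 : F) :
  p2 = h + 2 * t * (- t * z ^+ 2) -> p3 = - 2 * h * z -> p4 = h * z ^+ 2 + (- t * z ^+ 2) ^+ 2 ->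
  128 * t ^+ 2 * (p4 ^+ 2 * G * (p4 * G *+ 2 - p3 * (- z * G))) -
  ((p2 * p4 *+ 8 - p3 ^+ 2 *+ 3) * G + p2 * p3 * (- z * G) *+ 2) ^+ 2 = 0.
Proof.
move=> E2 E3 E4.
have EQ : p4 * G *+ 2 - p3 * (- z * G) = 2 * t ^+ 2 * z ^+ 4 * G by rewrite E3 E4; ring.
have ER : (p2 * p4 *+ 8 - p3 ^+ 2 *+ 3) * G + p2 * p3 * (- z * G) *+ 2 =
    - 16 * t ^+ 2 * z ^+ 2 * p4 * G by rewrite E2 E3 E4; ring.
rewrite EQ ER; ring.
Qed.

(** If [p^2 = 4 h k], then [h Z^2 + p Z + k = h (Z - z)^2], and [t k + h g = 0] becomes
    [t z^2 + g = 0]. Hence [z] is a double root of [(t Z^2 + g)^2 + h Z^2 + p Z + k], the quartic of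
    the pencil: a degenerate solution yields a singular point. *)
Lemma singular_param (F : fieldType) (h k g p t : F) : (2 : F) != 0 -> h != 0 ->
  4 * (h * k) = p ^+ 2 -> t * k + h * g = 0 ->
  exists z, [/\ p = - 2 * h * z, k = h * z ^+ 2 & g = - t * z ^+ 2].
Proof.
move=> n2 h0 E A; have h20 : 2 * h != 0 by rewrite mulf_neq0.
pose z := - p / (2 * h); have Ep : p = - 2 * h * z by rewrite /z; field; rewrite h0.
have n4 : (4 : F) != 0 by rewrite (_ : 4 = 2 * 2) ?mulf_neq0 //; ring.
have Ek : k = h * z ^+ 2.
  apply: (mulfI (mulf_neq0 n4 h0)); rewrite -mulrA E {1}Ep; ring.
exists z; split=> //; apply: (mulfI h0); apply: (addrI (t * k)).
by rewrite A Ek; ring.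
Qed.

(** Multiplicativity of the value at the point at infinity, for forms of degrees [m] and [n]. *)
Lemma coefM_top (R : nzRingType) (p q : {poly R}) m n : (size p <= m.+1)%N -> (size q <= n.+1)%N ->
  (p * q)`_(m + n)%N = p`_m * q`_n.
Proof.
move=> sp sq; rewrite coefM (bigD1 (inord m)) //= big1 ?addr0 => [|i].
  by rewrite inordK ?ltnS ?leq_addr // addKn.
rewrite -val_eqE /= inordK ?ltnS ?leq_addr // neq_ltn => /orP[im|mi].
  by rewrite [q`__]nth_default ?mulr0 // (leq_trans sq) //; lia.
by rewrite [p`__]nth_default ?mul0r // (leq_trans sp).
Qed.

(** * The pencil and the exclusion of degenerate solutions *)

Section Pencil.
Variable R : realType.
Local Notation C := R[i].
Local Notation cx := (map_poly (real_complex R)).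

Record cone_generic (p2 p3 p4 : {poly R}) : Prop := ConeGeneric {
  size_p2 : (size p2 <= 3)%N;
  size_p3 : (size p3 <= 4)%N;
  size_p4 : (size p4 <= 5)%N;
  p2_gt0 : forall x, 0 < p2.[x];
  p2_lead : 0 < p2`_2;
  cone_disc_ge0 : forall x, 0 <= (4 *: (p2 * p4) - p3 ^+ 2).[x];
  cone_disc_lead : (4 *: (p2 * p4) - p3 ^+ 2)`_6 != 0;
  cone_disc_sep : forall a F, cx (4 *: (p2 * p4) - p3 ^+ 2) <> ('X - a%:P) ^+ 2 * F;
  p2_p3_coprime : forall a, evC p2 a = 0 -> evC p3 a = 0 -> False }.

(** The conditions in the form in which they are used. The last two say that [p2^2 : p4] and
    [Q : R^2] take different values at two conjugate nonreal zeros of [p3], respectively of [P]. The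
    bound in [p3_size] excludes a double zero of [p3] at infinity. *)
Record pencil_generic (p2 p3 p4 : {poly R}) : Prop := PencilGeneric {
  pencil_cone : cone_generic p2 p3 p4;
  pencil_gt0 : forall t x z, 0 < t <= 1 ->
    0 < t ^+ 2 * z ^+ 4 + p2.[x] * z ^+ 2 + p3.[x] * z + p4.[x];
  pencil_infty_gt0 : forall t z, 0 < t <= 1 ->
    0 < t ^+ 2 * z ^+ 4 + p2`_2 * z ^+ 2 + p3`_3 * z + p4`_4;
  p3_sep : forall a F, cx p3 <> ('X - a%:P) ^+ 2 * F;
  p3_size : (2 < size p3)%N;
  p3_p4_coprime : forall a, evC p3 a = 0 -> evC p4 a = 0 -> False;
  g23_g24_coprime : forall a, evC (gij 2 3 p2 p3) a = 0 -> evC (gij 2 4 p2 p4) a = 0 -> False;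
  pencil_Phi34 : forall a : C, a != a^*%C -> evC p3 a = 0 ->
    evC (p2 ^+ 2) a * evC p4 a^*%C <> evC (p2 ^+ 2) a^*%C * evC p4 a;
  pencil_Phi818 : forall a : C, a != a^*%C ->
    let g23 := gij 2 3 p2 p3 in let g24 := gij 2 4 p2 p4 in let g34 := gij 3 4 p3 p4 in
    let Q := p4 ^+ 2 * g23 * (p4 * g23 *+ 2 - p3 * g24) in
    let Rp := (p2 * p4 *+ 8 - p3 ^+ 2 *+ 3) * g23 + p2 * p3 * g24 *+ 2 in
    evC (g23 * g34 - g24 ^+ 2) a = 0 ->
    evC Q a * evC (Rp ^+ 2) a^*%C <> evC Q a^*%C * evC (Rp ^+ 2) a }.

Variables p2 p3 p4 : {poly R}.

Definition hpol (t : R) (g : {poly R}) := p2 - (t *+ 2) *: g.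
Definition kpol (g : {poly R}) := p4 - g ^+ 2.
Definition eqpol (t : R) (g w : {poly R}) := 4 *: (hpol t g * kpol g) - p3 ^+ 2 - w ^+ 2.
(* The differential of [eqpol t] at [(g, w)] is [(u, v) |-> - (8 * u * apol t g + 2 * v * w)]. *)
Definition apol (t : R) (g : {poly R}) := t *: kpol g + hpol t g * g.

Record solution (t : R) (g w : {poly R}) : Prop := Solution {
  size_g : (size g <= 3)%N;
  size_w : (size w <= 4)%N;
  hpol_ge0 : forall x, 0 <= (hpol t g).[x];
  sol_eq : eqpol t g w = 0 }.

Section Generic.
Variables (t : R) (g w : {poly R}).
Hypothesis sol : solution t g w.
Local Notation h := (hpol t g).
Local Notation k := (kpol g).

Lemma solE : 4 *: (h * k) = p3 ^+ 2 + w ^+ 2.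
Proof. by have := sol_eq sol; rewrite /eqpol => /eqP; rewrite -addrA -opprD subr_eq0 => /eqP. Qed.

Lemma size_hpol : (size p2 <= 3)%N -> (size h <= 3)%N.
Proof.
move=> s2; rewrite /hpol (leq_trans (size_polyD _ _)) // geq_max s2 size_polyN.
by rewrite (leq_trans (size_scale_leq _ _)) // (size_g sol).
Qed.

Lemma size_kpol : (size p4 <= 5)%N -> (size k <= 5)%N.
Proof.
move=> s4; rewrite /kpol (leq_trans (size_polyD _ _)) // geq_max s4 size_polyN expr2.
rewrite (leq_trans (size_polyMleq _ _)) //; have := size_g sol.
by case: (size g) => [|[|[|[|n]]]].
Qed.

Lemma solE_real x : 4 * (h.[x] * k.[x]) = p3.[x] ^+ 2 + w.[x] ^+ 2.
Proof. by have := congr1 (fun p => p.[x]) solE; rewrite hornerZ hornerM [(_ ^+ 2 + _).[_]]hornerD !horner_exp. Qed.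

Lemma solE_evC a : 4 * (evC h a * evC k a) = evC p3 a ^+ 2 + evC w a ^+ 2.
Proof.
have := congr1 (fun p => evC p a) solE; rewrite !evCE => <-; congr (_ * _).
by rewrite rmorphMn rmorph1.
Qed.

Section Degenerate.
Hypothesis s3 : (size p3 <= 4)%N.
Hypothesis s2 : (size p2 <= 3)%N.
Hypothesis s4 : (size p4 <= 5)%N.
Hypothesis sep3 : forall a F, cx p3 <> ('X - a%:P) ^+ 2 * F.
Hypothesis size3 : (2 < size p3)%N.

(** A real zero of [h >= 0] is double and forces [p3] and [w] to vanish. Cancelling [(X - x)^2] in
    [4 h k = p3^2 + w^2] leaves [4 c k = u^2 + v^2] with a constant [c >= 0], where [u(x)] is
    nonzero since [p3] has no double root. *)
Lemma hpol_root_kpol x : h.[x] = 0 -> 0 < k.[x].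
Proof.
move=> hx; have [q Eh] := nneg_double_root (hpol_ge0 sol) hx.
have := solE_real x; rewrite hx mul0r mulr0 => /esym/eqP.
rewrite paddr_eq0 ?sqr_ge0 // !sqrf_eq0 => /andP[/eqP p3x /eqP wx].
have [u Eu] := factorR p3x; have [v Ev] := factorR wx.
have sq : (size q <= 1)%N.
  have [->|q0] := eqVneq q 0; first by rewrite size_poly0.
  have := size_hpol s2; rewrite Eh size_mul ?expf_neq0 ?polyXsubC_eq0 //.
  by rewrite size_exp_XsubC.
have [c Eq] : exists c, q = c%:P by exists q`_0; apply: size1_polyC.
have E : 4 *: (q * k) = u ^+ 2 + v ^+ 2.
  have X0 : ('X - x%:P) ^+ 2 != 0 by rewrite expf_neq0 ?polyXsubC_eq0.
  apply: (mulfI X0); have := solE; rewrite Eh Eu Ev => E.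
  by rewrite -scalerAr mulrA E !exprMn -mulrDr.
have ux : u.[x] != 0.
  apply/negP => /eqP /factorR [r Er]; apply: (@sep3 x%:C%C (cx r)).
  by rewrite Eu Er !rmorphM /= !rmorphB /= map_polyX map_polyC expr2 mulrA.
have := congr1 (fun p => p.[x]) E; rewrite hornerZ hornerM [(_ ^+ 2 + _).[_]]hornerD !horner_exp Eq hornerC => Ex.
have c0 : 0 <= c.
  have := hpol_ge0 sol (x + 1); rewrite Eh Eq hornerM horner_exp hornerXsubC hornerC.
  by rewrite addrAC subrr add0r expr1n mul1r.
have u2 : 0 < u.[x] ^+ 2 by rewrite exprn_even_gt0.
have v2 := sqr_ge0 v.[x].
rewrite ltNge; apply/negP => kx.
have : c * k.[x] <= 0 by rewrite mulr_ge0_le0.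
lra.
Qed.

(** The same argument at infinity: [h] is constant, [p3] and [w] have degree at most 2, and the
    coefficient of degree 2 of [p3] is nonzero because [p3] has at most a simple zero there. *)
Lemma hpol_infty_kpol : h`_2 = 0 -> 0 < k`_4 /\ 0 < h`_0.
Proof.
move=> h2.
have ev x : h.[x] = h`_0 + h`_1 * x.
  rewrite (horner_coef_wide _ (size_hpol s2)) !big_ord_recl big_ord0 /= h2.
  by rewrite expr0 expr1; ring.
have h1 : h`_1 = 0.
  apply/eqP; apply: contraT => h1; have := hpol_ge0 sol (- (h`_0 + 1) / h`_1).
  by rewrite ev mulrCA divff // mulr1; lra.
have Eh : h = (h`_0)%:P.
  apply/polyP => -[|[|[|j]]]; rewrite coefC //= nth_default // (leq_trans (size_hpol s2)) //.
have E : h`_0 *: (4 *: k) = p3 ^+ 2 + w ^+ 2.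
  by rewrite -solE {2}Eh mul_polyC scalerA mulrC -scalerA.
have E6 : p3`_3 ^+ 2 + w`_3 ^+ 2 = 0.
  have E' := congr1 (fun p : {poly R} => p`_(3 + 3)%N) E; move: E'.
  rewrite (coefD (p3 ^+ 2)) [p3 ^+ 2]expr2 [w ^+ 2]expr2 (coefM_top s3 s3) (coefM_top (size_w sol) (size_w sol)) -!expr2 => <-.
  by rewrite !coefZ [k`_(3 + 3)%N]nth_default ?mulr0 // (leq_trans (size_kpol s4)).
move/eqP: E6; rewrite paddr_eq0 ?sqr_ge0 // !sqrf_eq0 => /andP[/eqP p33 /eqP w3].
have sz (p : {poly R}) : (size p <= 4)%N -> p`_3 = 0 -> (size p <= 3)%N.
  move=> sp p0; apply/leq_sizeP => j; rewrite leq_eqVlt => /orP[/eqP <-//|j4].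
  by rewrite nth_default // (leq_trans sp).
have s33 := sz _ s3 p33; have sw3 := sz _ (size_w sol) w3.
have E4 : 4 * (h`_0 * k`_4) = p3`_2 ^+ 2 + w`_2 ^+ 2.
  have := congr1 (fun p : {poly R} => p`_(2 + 2)%N) E.
  rewrite (coefD (p3 ^+ 2)) [p3 ^+ 2]expr2 [w ^+ 2]expr2 (coefM_top s33 s33) (coefM_top sw3 sw3) -!expr2 => <-.
  by rewrite !coefZ; ring.
have p32 : p3`_2 != 0.
  have -> : p3`_2 = lead_coef p3 by rewrite lead_coefE; congr (_`_ _); lia.
  by rewrite lead_coef_eq0 -size_poly_gt0 (leq_trans _ size3).
have h00 : 0 <= h`_0 by have := hpol_ge0 sol 0; rewrite ev mulr0 addr0.
have u2 : 0 < p3`_2 ^+ 2 by rewrite exprn_even_gt0.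
have v2 := sqr_ge0 w`_2.
have hp : 0 < h`_0 by rewrite lt_def h00 andbT; apply/negP => /eqP z; rewrite z mul0r mulr0 in E4; lra.
split=> //; rewrite ltNge; apply/negP => kx.
have : h`_0 * k`_4 <= 0 by rewrite mulr_ge0_le0.
lra.
Qed.

End Degenerate.
End Generic.

(** Coprimality of binary forms of degrees 4 and 3; the second clause concerns the point at
    infinity. *)
Definition no_common_zero (a w : {poly R}) :=
  (forall x, evC a x = 0 -> evC w x = 0 -> False) /\ (a`_4 = 0 -> w`_3 = 0 -> False).

(** Here [apol] is [p2 g] and [D = w^2 + 4 p2 g^2]. A common zero of [p2] and [w] is a zero of [p3];
    a common zero of [g] and [w] is a double zero of [D], or at infinity makes the degree of [D]
    drop. *)
Lemma no_common_zero0 g w : cone_generic p2 p3 p4 -> solution 0 g w ->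
  no_common_zero (apol 0 g) w.
Proof.
move=> gen sol.
have Eh : hpol 0 g = p2 by rewrite /hpol mul0rn scale0r subr0.
have EA : apol 0 g = p2 * g by rewrite /apol scale0r add0r Eh.
have ED : 4 *: (p2 * p4) - p3 ^+ 2 = w ^+ 2 + 4 *: (p2 * g ^+ 2).
  have := solE sol; rewrite Eh /kpol mulrBr scalerBr => /eqP.
  by rewrite subr_eq => /eqP ->; rewrite addrAC [p3 ^+ 2 + _]addrC addrK.
rewrite EA; split=> [a|].
  rewrite evCM => /eqP; rewrite mulf_eq0 => /orP[] /eqP p20 w0.
    have := congr1 (fun p => evC p a) ED; rewrite !evCE p20 w0 !(mul0r, mulr0) ?expr0n /= ?add0r ?addr0 ?sub0r.
    move/eqP; rewrite oppr_eq0 sqrf_eq0 => /eqP; exact: (p2_p3_coprime gen p20).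
  have [u Eu] := factorC p20; have [v Ev] := factorC w0.
  apply: (@cone_disc_sep _ _ _ gen a (v ^+ 2 + (real_complex R 4) *: (cx p2 * u ^+ 2))).
  rewrite ED rmorphD rmorphXn /= Ev map_polyZ /= rmorphM rmorphXn /= Eu !exprMn mulrDr -scalerAr.
  by congr (_ + _ *: _); rewrite mulrCA.
rewrite -[4%N]/(2 + 2)%N (coefM_top (size_p2 gen) (size_g sol)) => /eqP.
rewrite mulf_eq0 gt_eqF ?(p2_lead gen) //= => /eqP g2 w3.
have := cone_disc_lead gen; rewrite ED -[6%N]/(3 + 3)%N coefD expr2.
rewrite (coefM_top (size_w sol) (size_w sol)) w3 mul0r add0r.
have sg : (size g <= 2)%N.
  apply/leq_sizeP => j; rewrite leq_eqVlt => /orP[/eqP <-//|j3].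
  by rewrite nth_default // (leq_trans (size_g sol)).
have sp : (size (p2 * g ^+ 2)%R <= 5)%N.
  rewrite (leq_trans (size_polyMleq _ _)) // expr2.
  have s2 := size_p2 gen; have := size_polyMleq g g.
  move: (size (g * g)%R) (size p2) (size g) s2 sg => b c d; lia.
by rewrite coefZ nth_default ?mulr0 ?eqxx // (leq_trans sp).
Qed.

Let pos_neq0 (e : R) : e = 0 -> 0 < e -> False.
Proof. by move=> ->; rewrite ltxx. Qed.

Section Generic.
Hypothesis gen : pencil_generic p2 p3 p4.
Let gc := pencil_cone gen.

(** If [h(x) = 0], then [apol] takes the positive value [t k(x)]. Otherwise the quartic of the
    pencil has a real zero [z] above [x], against its positivity. *)
Lemma no_common_zero_real t g w x : 0 < t <= 1 -> solution t g w ->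
  (apol t g).[x] = 0 -> w.[x] = 0 -> False.
Proof.
move=> t01 sol; have t0 : 0 < t by case/andP: t01.
have EA : (apol t g).[x] = t * (kpol g).[x] + (hpol t g).[x] * g.[x].
  by rewrite /apol [LHS]hornerD hornerZ [(_ * g).[_]]hornerM.
rewrite EA => A0 w0; have [h0|h0] := eqVneq (hpol t g).[x] 0.
  have := hpol_root_kpol sol (size_p2 gc) (@p3_sep _ _ _ gen) h0.
  move: A0; rewrite h0 mul0r addr0 => /eqP; rewrite mulf_eq0 gt_eqF //= => /eqP ->.
  by rewrite ltxx.
have := solE_real sol x; rewrite w0 expr0n addr0 => E.
have n2 : (2 : R) != 0 by rewrite pnatr_eq0.
have [z [Ep Ek Eg]] := singular_param n2 h0 E A0.
have := @pencil_gt0 _ _ _ gen t x z t01.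
have Ep2 : p2.[x] = (hpol t g).[x] + 2 * t * g.[x].
  by rewrite /hpol hornerD hornerN hornerZ -[t *+ 2]mulr_natl subrK.
have Ep4 : p4.[x] = (kpol g).[x] + g.[x] ^+ 2.
  by rewrite /kpol hornerD hornerN horner_exp subrK.
rewrite Ep2 Ep4 Ep Ek Eg; set h := (hpol t g).[x].
by apply: pos_neq0; ring.
Qed.

(** The real case again, on the line [y = 0], with top coefficients as values. *)
Lemma no_common_zero_infty t g w : 0 < t <= 1 -> solution t g w ->
  (apol t g)`_4 = 0 -> w`_3 = 0 -> False.
Proof.
move=> t01 sol; have t0 : 0 < t by case/andP: t01.
have sh := size_hpol sol (size_p2 gc); have sk := size_kpol sol (size_p4 gc).
have EA : (apol t g)`_4 = t * (kpol g)`_4 + (hpol t g)`_2 * g`_2.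
  rewrite /apol (coefD (t *: kpol g)) coefZ -(coefM_top sh (size_g sol)) //.
rewrite EA => A0 w0; have [h0|h0] := eqVneq (hpol t g)`_2 0.
  have [] := hpol_infty_kpol sol (size_p3 gc) (size_p2 gc) (size_p4 gc) (p3_size gen) h0.
  move: A0; rewrite h0 mul0r addr0 => /eqP; rewrite mulf_eq0 gt_eqF //= => /eqP ->.
  by rewrite ltxx.
have E : 4 * ((hpol t g)`_2 * (kpol g)`_4) = p3`_3 ^+ 2.
  have E' := congr1 (fun p : {poly R} => p`_(3 + 3)%N) (solE sol); move: E'.
  rewrite (coefD (p3 ^+ 2)) [p3 ^+ 2]expr2 [w ^+ 2]expr2 (coefM_top (size_p3 gc) (size_p3 gc)) (coefM_top (size_w sol) (size_w sol)).
  by rewrite w0 mul0r addr0 -expr2 => <-; rewrite coefZ -(coefM_top sh sk).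
have n2 : (2 : R) != 0 by rewrite pnatr_eq0.
have [z [Ep Ek Eg]] := singular_param n2 h0 E A0.
have := @pencil_infty_gt0 _ _ _ gen t z t01.
have Ep2 : p2`_2 = (hpol t g)`_2 + 2 * t * g`_2.
  by rewrite /hpol coefD coefN coefZ -[t *+ 2]mulr_natl subrK.
have Ep4 : p4`_4 = (kpol g)`_4 + g`_2 ^+ 2.
  have Eg2 : (g ^+ 2)`_4 = g`_2 ^+ 2.
    by rewrite -[4%N]/(2 + 2)%N [g ^+ 2]expr2 (coefM_top (size_g sol) (size_g sol)) -expr2.
  by rewrite /kpol coefD coefN Eg2 subrK.
rewrite Ep2 Ep4 Ep Ek Eg; set h := (hpol t g)`_2.
by apply: pos_neq0; ring.
Qed.

Lemma evC_natr (n : nat) p (a : C) : evC (n%:R *: p) a = n%:R * evC p a.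
Proof. by rewrite evCZ rmorph_nat. Qed.

(** Positivity says nothing at a nonreal point. Instead the degeneracy expresses [t^2] through a
    ratio of real polynomials at [a]; since [t] is real the conjugate of [a] gives the same ratio,
    which the conditions on [Phi] forbid. *)
Lemma no_common_zero_nonreal t g w (a : C) : 0 < t <= 1 -> solution t g w -> a != a^*%C ->
  evC (apol t g) a = 0 -> evC w a = 0 -> False.
Proof.
move=> t01 sol na; have t0 : 0 < t by case/andP: t01.
have tC0 : t%:C%C != 0 :> C by apply: contraTneq t0 => -[->]; rewrite ltxx.
have EA : evC (apol t g) a = t%:C%C * evC (kpol g) a + evC (hpol t g) a * evC g a.
  by rewrite /apol evCD evCZ evCM.
have Ep2 : evC p2 a = evC (hpol t g) a + 2 * t%:C%C * evC g a.
  by rewrite /hpol evCD evCN evCZ rmorphMn /= -[t%:C%C *+ 2]mulr_natl subrK.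
have Ep4 : evC p4 a = evC (kpol g) a + evC g a ^+ 2.
  by rewrite /kpol evCD evCN evCX subrK.
have Ed2 : evC p2^`() a = evC (hpol t g)^`() a + 2 * t%:C%C * evC g^`() a.
  by rewrite /hpol derivB derivZ evCD evCN evCZ rmorphMn /= -[t%:C%C *+ 2]mulr_natl subrK.
have Ed4 : evC p4^`() a = evC (kpol g)^`() a + 2 * evC g a * evC g^`() a.
  by rewrite /kpol derivB deriv_exp /= expr1 evCD evCN evCMn evCM; ring.
have Ed : 4 * (evC (hpol t g)^`() a * evC (kpol g) a + evC (hpol t g) a * evC (kpol g)^`() a) =
    2 * evC p3 a * evC p3^`() a + 2 * evC w a * evC w^`() a.
  have := congr1 (fun p : {poly R} => evC p^`() a) (solE sol).
  rewrite derivD derivZ derivM !deriv_exp /= !expr1 evC_natr [evC (_ + _) _]evCD [evC (_^`() * _) _]evCM [evC (_ * _^`()) _]evCM.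
  by move->; rewrite evCD !evCMn !evCM; ring.
rewrite EA => A0 w0.
have := solE_evC sol a; rewrite w0 expr0n addr0 => E.
move: Ed; rewrite w0 mulr0 mul0r addr0 => Ed.
have [h0|h0] := eqVneq (evC (hpol t g) a) 0.
  have k0 : evC (kpol g) a = 0.
    by move: A0; rewrite h0 mul0r addr0 => /eqP; rewrite mulf_eq0 (negbTE tC0) => /eqP.
  have p30 : evC p3 a = 0.
    by move/eqP: E; rewrite h0 mul0r mulr0 eq_sym sqrf_eq0 => /eqP.
  (* With [h = k = 0] one has [p2 = 2 t g] and [p4 = g^2]. This polynomial has real coefficients, so
     it vanishes at the conjugate too. *)
  have U0 : evC (p2 ^+ 2 - (4 * t ^+ 2) *: p4) a = 0.
    rewrite evCD evCN evCX evCZ Ep2 Ep4 h0 k0 rmorphM rmorphXn rmorph_nat; ring.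
  have V0 := evC_conj0 U0.
  have EU b : evC (p2 ^+ 2 - (4 * t ^+ 2) *: p4) b = 0 ->
      evC (p2 ^+ 2) b = (4 * t ^+ 2)%:C%C * evC p4 b.
    by rewrite evCD evCN evCZ => /eqP; rewrite subr_eq0 => /eqP.
  apply: (pencil_Phi34 gen na p30); rewrite (EU _ U0) (EU _ V0); ring.
have n2 : (2 : C) != 0 by rewrite pnatr_eq0.
have [z [Ep3 Ek Eg]] := singular_param n2 h0 E A0.
set h := evC (hpol t g) a in h0 E A0 Ep2 Ep3 Ek Ed2 Ed.
set tc := t%:C%C in tC0 A0 Ep2 Ep4 Ed2 Eg.
(* Otherwise [p3] and [p4] would both vanish at [a]. *)
have z0 : z != 0.
  apply: contraTneq isT => z0; exfalso; apply: (@p3_p4_coprime _ _ _ gen a).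
    by rewrite Ep3 z0 mulr0.
  by rewrite Ep4 Ek Eg z0 expr0n /= !mulr0 expr0n addr0.
(* The derivative of the quartic in [x] at the point [(a, z)]. It vanishes because [w(a) = 0] makes
   [(w^2)'] vanish at [a]. *)
have D0 : evC p2^`() a * z ^+ 2 + evC p3^`() a * z + evC p4^`() a = 0.
  apply: (mulfI h0); rewrite mulr0.
  have n4 : (4 : C) != 0 by rewrite pnatr_eq0.
  apply: (mulfI n4); rewrite mulr0 Ed2 Ed4 Eg.
  rewrite Ep3 Ek in Ed.
  have -> : 4 * (h * ((evC (hpol t g)^`() a + 2 * tc * evC g^`() a) * z ^+ 2 + evC p3^`() a * z +
      (evC (kpol g)^`() a + 2 * (- tc * z ^+ 2) * evC g^`() a))) =
      4 * (evC (hpol t g)^`() a * (h * z ^+ 2) + h * evC (kpol g)^`() a) +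
      4 * h * z * evC p3^`() a by ring.
  by rewrite Ed; ring.
(* Four times the quartic minus [z] times its derivative in [z], which removes [t]. *)
have Fz : 2 * evC p2 a * z ^+ 2 + 3 * evC p3 a * z + 4 * evC p4 a = 0.
  by rewrite Ep2 Ep3 Ep4 Ek Eg; ring.
have gE i j (fi fj : {poly R}) : evC (gij i j fi fj) a =
    i%:R * (evC fi a * evC fj^`() a) - j%:R * (evC fj a * evC fi^`() a).
  by rewrite /gij evCD evCN !evCMn !evCM !mulr_natl.
set d2 := evC p2^`() a in D0; set d3 := evC p3^`() a in D0; set d4 := evC p4^`() a in D0.
(* Eliminating between the two preceding equations gives [g24 = - z g23] and [g34 = - z g24]; hence
   [P = g23 g34 - g24^2] vanishes at [a]. *)
have G1 : evC (gij 2 4 p2 p4) a = - z * evC (gij 2 3 p2 p3) a.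
  apply/eqP; rewrite -subr_eq0; apply/eqP; rewrite !gE -/d2 -/d3 -/d4.
  transitivity (2 * evC p2 a * (d2 * z ^+ 2 + d3 * z + d4)
    - d2 * (2 * evC p2 a * z ^+ 2 + 3 * evC p3 a * z + 4 * evC p4 a)); first by ring.
  by rewrite D0 Fz; ring.
have G2 : evC (gij 3 4 p3 p4) a = - z * evC (gij 2 4 p2 p4) a.
  apply: (mulfI z0); apply/eqP; rewrite -subr_eq0; apply/eqP; rewrite !gE -/d2 -/d3 -/d4.
  transitivity (d4 * (2 * evC p2 a * z ^+ 2 + 3 * evC p3 a * z + 4 * evC p4 a)
    - 4 * evC p4 a * (d2 * z ^+ 2 + d3 * z + d4)); first by ring.
  by rewrite D0 Fz; ring.
(* [T] is [128 t^2 Q - R^2]. Its coefficients are real, so its vanishing at [a] passes to the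
   conjugate, and [128 t^2] cancels between the two equations. *)
pose T : {poly R} := (128 * t ^+ 2) *: (p4 ^+ 2 * gij 2 3 p2 p3 * (p4 * gij 2 3 p2 p3 *+ 2 - p3 * gij 2 4 p2 p4))
  - ((p2 * p4 *+ 8 - p3 ^+ 2 *+ 3) * gij 2 3 p2 p3 + p2 * p3 * gij 2 4 p2 p4 *+ 2) ^+ 2.
have T0 : evC T a = 0.
  rewrite /T; move: (gij 2 3 p2 p3) (gij 2 4 p2 p4) G1 => G23 G24 G1.
  rewrite !evCE G1 rmorphM rmorphXn rmorph_nat -/tc.
  by apply: (singular_QR (h := h)); rewrite ?Ep2 ?Ep3 ?Ep4 ?Ek ?Eg.
apply: (@pencil_Phi818 _ _ _ gen a na).
  by rewrite evCD evCN evCM evCX G2 G1; ring.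
have ET b : evC T b = 0 ->
  evC (((p2 * p4 *+ 8 - p3 ^+ 2 *+ 3) * gij 2 3 p2 p3 + p2 * p3 * gij 2 4 p2 p4 *+ 2) ^+ 2) b =
  (128 * t ^+ 2)%:C%C * evC (p4 ^+ 2 * gij 2 3 p2 p3 * (p4 * gij 2 3 p2 p3 *+ 2 - p3 * gij 2 4 p2 p4)) b.
  by rewrite /T evCD evCN evCZ => /eqP; rewrite subr_eq0 => /eqP ->.
rewrite (ET _ T0) (ET _ (evC_conj0 T0)); ring.
Qed.

Lemma no_common_zeroP t g w : 0 <= t <= 1 -> solution t g w -> no_common_zero (apol t g) w.
Proof.
move=> /andP[]; rewrite le_eqVlt => /orP[/eqP <- _ sol|t0 t1 sol].
  exact: no_common_zero0 (pencil_cone gen) sol.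
have t01 : 0 < t <= 1 by rewrite t0.
split=> [a A0 w0|]; last exact: no_common_zero_infty.
case: (real_or_nonreal a) => [[x Ex]|na]; last exact: (no_common_zero_nonreal t01 sol na).
by rewrite Ex in A0 w0; apply: (no_common_zero_real t01 sol (evC_root A0) (evC_root w0)).
Qed.

End Generic.

(** Sylvester's argument: by coprimality [w] divides [u] and [a] divides [v]. Without a common zero
    at infinity, [w] has degree 3 and exceeds [u], or [a] has degree 4 and exceeds [v]. *)
Lemma no_common_zero_inj (a w u v : {poly R}) : no_common_zero a w ->
  (size a <= 5)%N -> (size w <= 4)%N -> (size u <= 3)%N -> (size v <= 4)%N ->
  u * a + v * w = 0 -> u = 0 /\ v = 0.
Proof.
move=> [fin inf] sa sw su sv E.
have cop : coprimep a w by apply: coprime_evC => x [] /fin h /h.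
have cop' : coprimep w a by rewrite coprimep_sym.
have wu : (w %| u)%R.
  by rewrite -(Gauss_dvdpl u cop') -[u * a](addrK (v * w)) E sub0r dvdpNr dvdp_mull.
have av : (a %| v)%R.
  by rewrite -(Gauss_dvdpl v cop) -[v * w](addKr (u * a)) E addr0 dvdpNr dvdp_mull.
have [w4|w4] := eqVneq (size w) 4%N.
  have u0 : u = 0.
    by apply/eqP; apply: contraT => u0; have := leq_trans (dvdp_leq u0 wu) su; rewrite w4.
  split=> //; move: E; rewrite u0 mul0r add0r => /eqP; rewrite mulf_eq0.
  by rewrite -[w == 0]size_poly_eq0 w4 orbF => /eqP.
have w3 : w`_3 = 0 by rewrite nth_default // -ltnS ltn_neqAle w4.
have a4 : size a = 5%N.
  have : a`_4 != 0 by apply/negP => /eqP /inf; apply.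
  by move=> h; apply/eqP; rewrite eqn_leq sa ltnNge; apply: contra h => h; rewrite nth_default.
have v0 : v = 0.
  by apply/eqP; apply: contraT => v0; have := leq_trans (dvdp_leq v0 av) sv; rewrite a4.
split=> //; move: E; rewrite v0 mul0r addr0 => /eqP; rewrite mulf_eq0.
by rewrite -[a == 0]size_poly_eq0 a4 orbF => /eqP.
Qed.

End Pencil.

Lemma size_polyM_le (R : nzSemiRingType) (p q : {poly R}) m n :
  (size p <= m.+1)%N -> (size q <= n.+1)%N -> (size (p * q)%R <= (m + n).+1)%N.
Proof.
move=> sp sq; rewrite (leq_trans (size_polyMleq _ _)) // -subn1 leq_subLR add1n.
by rewrite (leq_trans (leq_add sp sq)) // addSn addnS.
Qed.

Lemma size_polyD_le (R : nzSemiRingType) (p q : {poly R}) m :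
  (size p <= m)%N -> (size q <= m)%N -> (size (p + q)%R <= m)%N.
Proof. by move=> sp sq; rewrite (leq_trans (size_polyD _ _)) // geq_max sp. Qed.

(** * Signs of real quadratics *)

Section QuadraticForms.
Variable R : realFieldType.

Lemma quad_lead_ge0 (a b c : R) : (forall x, 0 <= a * x ^+ 2 + b * x + c) -> 0 <= a.
Proof.
move=> H; rewrite leNgt; apply/negP => a0.
have n0 : 0 < - a by rewrite oppr_gt0.
(* For this [x >= 1], [- a x^2 = x (- a + |b| + |c|)] exceeds [|b| x + |c|]. *)
pose x := 1 + (`|b| + `|c|) / - a.
have q0 : 0 <= (`|b| + `|c|) / - a by rewrite divr_ge0 ?addr_ge0 // ltW.
have Ex : - a * x = - a + (`|b| + `|c|) by rewrite /x mulrDr mulr1 mulrCA divff ?mulr1 // gt_eqF.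
have x1 : 1 <= x by rewrite /x lerDl.
have := H x; have := ler_norm b; have := ler_norm c; have := normr_ge0 c; nra.
Qed.

Lemma quad_disc (a b c : R) : 0 < a -> (forall x, 0 <= a * x ^+ 2 + b * x + c) -> b ^+ 2 <= 4 * a * c.
Proof.
move=> a0 /(_ (- b / (2 * a))) H.
have a2 : 2 * a != 0 by lra.
have : 0 <= 4 * a * (a * (- b / (2 * a)) ^+ 2 + b * (- b / (2 * a)) + c).
  by rewrite mulr_ge0 // mulr_ge0 // ltW.
by rewrite (_ : 4 * a * _ = 4 * a * c - b ^+ 2) ?subr_ge0 //; field; lra.
Qed.

Lemma quad_ge0 (a b c : R) : 0 <= a -> 0 <= c -> 0 < a + c -> b ^+ 2 <= 4 * a * c ->
  forall x, 0 <= a * x ^+ 2 + b * x + c.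
Proof.
move=> a0 c0 ac H x; case: (ltrP 0 a) => a1.
  rewrite -(pmulr_rge0 _ a1).
  have : 0 <= (2 * a * x + b) ^+ 2 by apply: sqr_ge0.
  nra.
have E : a = 0 by lra.
have b0 : b = 0 by apply/eqP; rewrite -sqrf_eq0; have := sqr_ge0 b; move: H; rewrite E mulr0 mul0r; lra.
by rewrite E b0 !mul0r !add0r.
Qed.

End QuadraticForms.

(** * Deformation of the solutions from [t = 0] to [t = 1] *)

Module Deformation.
Import boolp classical_sets functions interval_inference topology normedtype sequences.
Import Order.TTheory GRing.Theory Num.Theory numFieldNormedType.Exports.
Import Continuation.
Local Open Scope classical_set_scope.
Local Open Scope ring_scope.

Section PolynomialContinuity.
Variables (R : realType) (T : topologicalType) (x : T).

Definition coef_continuous (P : T -> {poly R}) :=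
  forall i, {for x, continuous (fun y => (P y)`_i)}.

Lemma coef_continuous_cst p : coef_continuous (fun=> p).
Proof. by move=> i; exact: cvg_cst. Qed.

Lemma coef_continuousD P Q : coef_continuous P -> coef_continuous Q ->
  coef_continuous (fun y => P y + Q y).
Proof.
move=> HP HQ i; rewrite (_ : (fun y => _) = fun y => (P y)`_i + (Q y)`_i).
  by apply: cvgD; [exact: HP | exact: HQ].
by apply/funext => y; rewrite coefD.
Qed.

Lemma coef_continuousN P : coef_continuous P -> coef_continuous (fun y => - P y).
Proof.
move=> HP i; rewrite (_ : (fun y => _) = fun y => - (P y)`_i).
  by apply: cvgN; exact: HP.
by apply/funext => y; rewrite coefN.
Qed.

Lemma coef_continuousM P Q : coef_continuous P -> coef_continuous Q ->
  coef_continuous (fun y => P y * Q y).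
Proof.
move=> HP HQ i.
rewrite (_ : (fun y => _) = fun y => \sum_(j < i.+1) (P y)`_j * (Q y)`_(i - j)).
  by apply: cont_sum => j; apply: cvgM; [exact: HP | exact: HQ].
by apply/funext => y; rewrite coefM.
Qed.

Lemma coef_continuousZ (c : T -> R) P : {for x, continuous c} -> coef_continuous P ->
  coef_continuous (fun y => c y *: P y).
Proof.
move=> Hc HP i; rewrite (_ : (fun y => _) = fun y => c y * (P y)`_i).
  by apply: cvgM; [exact: Hc | exact: HP].
by apply/funext => y; rewrite coefZ.
Qed.

Lemma exp_continuous (c : T -> R) k : {for x, continuous c} ->
  {for x, continuous (fun y => c y ^+ k)}.
Proof.
move=> Hc; elim: k => [|k IH]; first by rewrite (_ : (fun y => _) = fun=> 1) //; exact: cvg_cst.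
rewrite (_ : (fun y => _) = fun y => c y * c y ^+ k); last by apply/funext => y; rewrite exprS.
exact: (cvgM Hc IH).
Qed.

Lemma horner_continuous n (P : T -> {poly R}) (c : T -> R) : (forall y, (size (P y) <= n)%N) -> coef_continuous P ->
  {for x, continuous c} -> {for x, continuous (fun y => (P y).[c y])}.
Proof.
move=> sP HP Hc; rewrite (_ : (fun y => _) = fun y => \sum_(j < n) (P y)`_j * c y ^+ j).
  apply: cont_sum => j; apply: cvgM; first exact: HP.
  exact: exp_continuous.
by apply/funext => y; rewrite (horner_coef_wide _ (sP y)).
Qed.

End PolynomialContinuity.

Section Coordinates.
Variable R : realType.
Local Notation V := 'rV[R]_7.

(** The three coefficients of [g] and the four of [w] make 7 unknowns, as many as the sextic [eqpol]
    has coefficients; the system is square. *)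
Definition gof (X : V) : {poly R} := \poly_(i < 3) X 0 (inord i).
Definition wof (X : V) : {poly R} := \poly_(i < 4) X 0 (inord (3 + i)).
Definition mk (g w : {poly R}) : V := \row_j (if (j < 3)%N then g`_j else w`_(j - 3)).

Lemma size_gof X : (size (gof X) <= 3)%N. Proof. exact: size_poly. Qed.
Lemma size_wof X : (size (wof X) <= 4)%N. Proof. exact: size_poly. Qed.

Lemma gof_mk (g w : {poly R}) : (size g <= 3)%N -> gof (mk g w) = g.
Proof.
move=> sg; apply/polyP => i; rewrite coef_poly; case: ltnP => i3.
  by rewrite mxE inordK ?i3 // (leq_trans i3).
by rewrite nth_default // (leq_trans sg).
Qed.

Lemma wof_mk (g w : {poly R}) : (size w <= 4)%N -> wof (mk g w) = w.
Proof.
move=> sw; apply/polyP => i; rewrite coef_poly; case: ltnP => i4.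
  have E : nat_of_ord (inord (3 + i) : 'I_7) = (3 + i)%N by rewrite inordK //; lia.
  by rewrite mxE E ltnNge leq_addr /= addKn.
by rewrite nth_default // (leq_trans sw).
Qed.

Lemma mk_gof_wof X : mk (gof X) (wof X) = X.
Proof.
apply/rowP => j; rewrite mxE !coef_poly; case: ltnP => j3.
  by congr (X 0 _); apply: val_inj; rewrite /= inordK.
have j7 := ltn_ord j; rewrite (_ : (j - 3 < 4)%N); last by lia.
by congr (X 0 _); apply: val_inj; rewrite /= inordK; lia.
Qed.

Lemma gof_lin c X Y : gof (c *: X + Y) = c *: gof X + gof Y.
Proof.
apply/polyP => i; rewrite coefD coefZ !coef_poly; case: ifP => _; rewrite ?mxE //.
by rewrite mulr0 addr0.
Qed.

Lemma wof_lin c X Y : wof (c *: X + Y) = c *: wof X + wof Y.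
Proof.
apply/polyP => i; rewrite coefD coefZ !coef_poly; case: ifP => _; rewrite ?mxE //.
by rewrite mulr0 addr0.
Qed.

Lemma gofB X Y : gof (X - Y) = gof X - gof Y.
Proof. by rewrite addrC -scaleN1r gof_lin scaleN1r addrC. Qed.

Lemma wofB X Y : wof (X - Y) = wof X - wof Y.
Proof. by rewrite addrC -scaleN1r wof_lin scaleN1r addrC. Qed.

Lemma coord_cont (T : topologicalType) (f : T -> V) (x : T) (j : 'I_7) : {for x, continuous f} ->
  {for x, continuous (fun y => f y 0 j)}.
Proof. by move=> fc; exact: (cvg_comp _ _ fc (@coord_continuous R 1 7 0 j (f x))). Qed.

Lemma gof_continuous (T : topologicalType) (f : T -> V) x : {for x, continuous f} ->
  coef_continuous x (fun y => gof (f y)).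
Proof.
move=> fc i; have [i3|i3] := boolP (i < 3)%N.
  rewrite (_ : (fun y => _) = fun y => f y 0 (inord i)); first exact: coord_cont.
  by apply/funext => y; rewrite coef_poly i3.
rewrite (_ : (fun y => _) = fun=> 0); first exact: cvg_cst.
by apply/funext => y; rewrite coef_poly (negbTE i3).
Qed.

Lemma wof_continuous (T : topologicalType) (f : T -> V) x : {for x, continuous f} ->
  coef_continuous x (fun y => wof (f y)).
Proof.
move=> fc i; have [i3|i3] := boolP (i < 4)%N.
  rewrite (_ : (fun y => _) = fun y => f y 0 (inord (3 + i))); first exact: coord_cont.
  by apply/funext => y; rewrite coef_poly i3.
rewrite (_ : (fun y => _) = fun=> 0); first exact: cvg_cst.
by apply/funext => y; rewrite coef_poly (negbTE i3).
Qed.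

Lemma row_continuous (T : topologicalType) (f : T -> V) x :
  (forall j, {for x, continuous (fun y => f y 0 j)}) -> {for x, continuous f}.
Proof.
move=> H W [P HP sP].
have : \forall y \near x, forall j, P 0 j (f y 0 j).
  apply: (filter_forall (F := nbhs x)) => j; exact: (H j _ (HP 0 j)).
by apply: filterS => y Hy; apply: sP => i j; rewrite (ord1 i).
Qed.

Definition flip (X : V) := mk (gof X) (- wof X).

Lemma flip_continuous : continuous flip.
Proof.
move=> X; apply: row_continuous => j.
have idc : {for X, continuous (fun Y : V => Y)} by exact: cvg_id.
have [j3|j3] := boolP (j < 3)%N.
  rewrite (_ : (fun y => _) = fun y => (gof y)`_j); first exact: gof_continuous.
  by apply/funext => y; rewrite mxE j3.
rewrite (_ : (fun y => _) = fun y => (- wof y)`_(j - 3)).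
  exact: (coef_continuousN (wof_continuous idc)).
by apply/funext => y; rewrite mxE (negbTE j3).
Qed.

End Coordinates.

Section Equations.
Variables (R : realType) (p2 p3 p4 : {poly R}).
Local Notation V := 'rV[R]_7.
Hypothesis gen : pencil_generic p2 p3 p4.
Let gc := pencil_cone gen.
Local Notation hh := (hpol p2).
Local Notation kk := (kpol p4).
Local Notation sol := (solution p2 p3 p4).

Definition sysF (t : R) (X : V) : V := \row_j (eqpol p2 p3 p4 t (gof X) (wof X))`_j.

(** The difference quotient of [eqpol], obtained by splitting the difference of the products [h k]
    as [(h(X) - h(Y)) k(X) + h(Y) (k(X) - k(Y))]. At [X = Y] it is [- (8 u a + 2 v w)] with [a] the
    polynomial [apol]. *)
Definition dpol (t : R) (X Y : V) (u v : {poly R}) : {poly R} :=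
  - (u * (t *: (8 *: kk (gof X)) + 4 *: (hh t (gof Y) * (gof X + gof Y))) +
     v * (wof X + wof Y)).

Definition sysM (t : R) (X Y : V) : 'M[R]_7 :=
  \matrix_(i, j) (dpol t X Y (gof (delta_mx 0 i)) (wof (delta_mx 0 i)))`_j.

Lemma dpol_lin t X Y c u v u' v' :
  dpol t X Y (c *: u + u') (c *: v + v') = c *: dpol t X Y u v + dpol t X Y u' v'.
Proof. by rewrite /dpol !mulrDl -!scalerAl scalerN scalerDr; ring. Qed.

Lemma gof0 : gof (0 : V) = 0.
Proof. by apply/polyP => i; rewrite coef_poly coef0 mxE; case: ifP. Qed.
Lemma wof0 : wof (0 : V) = 0.
Proof. by apply/polyP => i; rewrite coef_poly coef0 mxE; case: ifP. Qed.

Lemma mulmx_sysM t X Y (Z : V) j : (Z *m sysM t X Y) 0 j = (dpol t X Y (gof Z) (wof Z))`_j.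
Proof.
rewrite mxE {2 3}[Z]row_sum_delta; under eq_bigr => i _ do rewrite mxE.
elim/big_rec2: _ => [|i u U _ IH].
  by rewrite gof0 wof0 /dpol !mul0r addr0 oppr0 coef0.
by rewrite gof_lin wof_lin dpol_lin coefD coefZ IH.
Qed.

Lemma sysF_M t X Y : sysF t X - sysF t Y = (X - Y) *m sysM t X Y.
Proof.
apply/rowP => j; rewrite mulmx_sysM !mxE -coefB.
suff -> : eqpol p2 p3 p4 t (gof X) (wof X) - eqpol p2 p3 p4 t (gof Y) (wof Y) =
  dpol t X Y (gof (X - Y)) (wof (X - Y)) by [].
rewrite gofB wofB /eqpol /dpol /hpol /kpol -!mul_polyC !rmorphMn /= polyC1; ring.
Qed.

Lemma size_hh t X : (size (hh t (gof X)) <= 3)%N.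
Proof.
apply: size_polyD_le; first exact: size_p2 gc.
by rewrite size_polyN (leq_trans (size_scale_leq _ _)) // size_gof.
Qed.

Lemma size_kk X : (size (kk (gof X)) <= 5)%N.
Proof.
apply: size_polyD_le; first exact: size_p4 gc.
by rewrite size_polyN expr2 (@size_polyM_le _ _ _ 2 2) // size_gof.
Qed.

Lemma size_eqpol t X : (size (eqpol p2 p3 p4 t (gof X) (wof X)) <= 7)%N.
Proof.
have sh := size_hh t X; have sk := size_kk X.
apply: size_polyD_le; last by rewrite size_polyN expr2 (@size_polyM_le _ _ _ 3 3) // size_wof.
apply: size_polyD_le; last by rewrite size_polyN expr2 (@size_polyM_le _ _ _ 3 3) // (size_p3 gc).
by rewrite (leq_trans (size_scale_leq _ _)) // (@size_polyM_le _ _ _ 2 4).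
Qed.

Lemma sysF_eq0 t X : sysF t X = 0 <-> eqpol p2 p3 p4 t (gof X) (wof X) = 0.
Proof.
split=> [/rowP H|H]; last by apply/rowP => j; rewrite !mxE H coef0.
apply/polyP => i; rewrite coef0; case: (ltnP i 7) => i7.
  by have := H (Ordinal i7); rewrite !mxE.
by rewrite nth_default // (leq_trans (size_eqpol t X)).
Qed.

Definition psd_cond (t : R) (X : V) := forall x, 0 <= (hh t (gof X)).[x].

Lemma solE_sys t X : (psd_cond t X /\ sysF t X = 0) <-> sol t (gof X) (wof X).
Proof.
rewrite sysF_eq0; split=> [[H1 H2]|H]; last by split; [exact: hpol_ge0 H | exact: sol_eq H].
by split=> //; [exact: size_gof | exact: size_wof].
Qed.

Section Cont.
Variables (T : topologicalType) (x : T) (t : T -> R) (X Y : T -> V).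
Hypotheses (tc : {for x, continuous t}) (Xc : {for x, continuous X}) (Yc : {for x, continuous Y}).

Lemma hpol_continuous : coef_continuous x (fun y => hh (t y) (gof (X y))).
Proof.
apply: coef_continuousD; first exact: coef_continuous_cst.
apply: coef_continuousN; apply: coef_continuousZ; last exact: gof_continuous.
by apply: (@cvgMn _ _ _ _ _ t 2 (t x)).
Qed.

Lemma kpol_continuous : coef_continuous x (fun y => kk (gof (X y))).
Proof.
apply: coef_continuousD; first exact: coef_continuous_cst.
apply: coef_continuousN; apply: (@coef_continuousM _ _ x (fun y => gof (X y)) (fun y => gof (X y))); exact: gof_continuous.
Qed.

Lemma eqpol_continuous : coef_continuous x (fun y => eqpol p2 p3 p4 (t y) (gof (X y)) (wof (X y))).
Proof.
apply: coef_continuousD.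
  apply: coef_continuousD; last exact: coef_continuous_cst.
  apply: coef_continuousZ; first exact: cvg_cst.
  by apply: coef_continuousM; [exact: hpol_continuous | exact: kpol_continuous].
apply: coef_continuousN; apply: (@coef_continuousM _ _ x (fun y => wof (X y)) (fun y => wof (X y))); exact: wof_continuous.
Qed.

End Cont.

Lemma dpol_continuous (T : topologicalType) (x : T) (t : T -> R) (X Y : T -> V) u v :
  {for x, continuous t} -> {for x, continuous X} -> {for x, continuous Y} ->
  coef_continuous x (fun y => dpol (t y) (X y) (Y y) u v).
Proof.
move=> tc Xc Yc; apply: coef_continuousN; apply: coef_continuousD.
  apply: coef_continuousM; first exact: coef_continuous_cst.
  apply: coef_continuousD.
    apply: coef_continuousZ => //; apply: coef_continuousZ; first exact: cvg_cst.
    exact: kpol_continuous.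
  apply: coef_continuousZ; first exact: cvg_cst.
  apply: coef_continuousM; first exact: hpol_continuous.
  by apply: coef_continuousD; exact: gof_continuous.
apply: coef_continuousM; first exact: coef_continuous_cst.
by apply: coef_continuousD; exact: wof_continuous.
Qed.

Lemma sysF_cont t X j : {for (t, X), continuous (fun p : R * V => sysF p.1 p.2 0 j)}.
Proof.
rewrite (_ : (fun p => _) = fun p : R * V => (eqpol p2 p3 p4 p.1 (gof p.2) (wof p.2))`_j).
  by apply: eqpol_continuous; [exact: cvg_fst | exact: cvg_snd].
by apply/funext => p; rewrite mxE.
Qed.

Lemma sysM_cont t X i j :
  {for ((t, X), X), continuous (fun p : R * V * V => sysM p.1.1 p.1.2 p.2 i j)}.
Proof.
rewrite (_ : (fun p => _) = fun p : R * V * V =>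
  (dpol p.1.1 p.1.2 p.2 (gof (delta_mx 0 i)) (wof (delta_mx 0 i)))`_j).
  apply: dpol_continuous.
  - by apply: (cvg_comp _ _ (cvg_fst (G := nbhs X))); exact: cvg_fst.
  - by apply: (cvg_comp _ _ (cvg_fst (G := nbhs X))); exact: cvg_snd.
  - exact: cvg_snd.
by apply/funext => p; rewrite mxE.
Qed.

(** A kernel vector is a pair [(u, v)] with [8 u a + 2 v w = 0], which coprimality of the forms
    [a = apol] and [w] excludes by degree. *)
Lemma sysM_unit t X : 0 <= t <= 1 -> psd_cond t X /\ sysF t X = 0 -> sysM t X X \in unitmx.
Proof.
move=> t01 /solE_sys S; rewrite -row_free_unit; apply: inj_row_free => Z HZ.
have D0 : dpol t X X (gof Z) (wof Z) = 0.
  apply/polyP => i; rewrite coef0; case: (ltnP i 7) => i7.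
    by rewrite -(mulmx_sysM t X X Z (Ordinal i7)) HZ mxE.
  rewrite nth_default // (leq_trans _ i7) // size_polyN; apply: size_polyD_le.
    apply: (@size_polyM_le _ _ _ 2 4); first exact: size_gof.
    apply: size_polyD_le; first by do 2! rewrite (leq_trans (size_scale_leq _ _)) //; exact: size_kk.
    rewrite (leq_trans (size_scale_leq _ _)) //; apply: (@size_polyM_le _ _ _ 2 2); first exact: size_hh.
    by apply: size_polyD_le; exact: size_gof.
  apply: (@size_polyM_le _ _ _ 3 3); first exact: size_wof.
  by apply: size_polyD_le; exact: size_wof.
have [] := @no_common_zero_inj R _ _ (8 *: gof Z) (2 *: wof Z) (no_common_zeroP gen t01 S).
- apply: size_polyD_le; first by rewrite (leq_trans (size_scale_leq _ _)) //; exact: size_kk.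
  by apply: (@size_polyM_le _ _ _ 2 2); [exact: size_hh | exact: size_gof].
- exact: size_wof.
- by rewrite (leq_trans (size_scale_leq _ _)) // size_gof.
- by rewrite (leq_trans (size_scale_leq _ _)) // size_wof.
- apply: oppr_inj; rewrite oppr0 -D0 /dpol /apol -!mul_polyC; ring.
move=> /eqP; rewrite scale_poly_eq0 pnatr_eq0 /= => /eqP g0.
move=> /eqP; rewrite scale_poly_eq0 pnatr_eq0 /= => /eqP w0.
by rewrite -[Z]mk_gof_wof g0 w0; apply/rowP => j; rewrite !mxE !coef0 if_same.
Qed.

Lemma kpol_ge0 t g w : sol t g w -> forall x, 0 <= (kk g).[x].
Proof.
move=> S x; have := hpol_ge0 S x; rewrite le_eqVlt => /orP[/eqP h0|h0].
  exact: ltW (hpol_root_kpol S (size_p2 gc) (@p3_sep _ _ _ _ gen) (esym h0)).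
rewrite -(pmulr_rge0 _ h0) -(pmulr_rge0 _ (ltr0n R 4)) (solE_real S).
by rewrite addr_ge0 ?sqr_ge0.
Qed.

(** The bound [b] depends on [x] only. From [k >= 0] one gets [g^2 <= p4] and [k <= p4], then a
    bound on [h] as [t <= 1], and finally [w^2 <= 4 h k]. Using [2 |u| <= 1 + u^2] avoids square
    roots. *)
Lemma sol_pointwise_bound t g w x : 0 <= t <= 1 -> sol t g w ->
  exists2 b, b = 1 + p4.[x] + 4 * (p2.[x] + 2 * (1 + p4.[x])) * p4.[x] &
  `|g.[x]| <= b /\ `|w.[x]| <= b + 1.
Proof.
move=> /andP[t0 t1] S; eexists; first by [].
have k0 := kpol_ge0 S x; have h0 := hpol_ge0 S x; have E := solE_real S x.
have p20 := p2_gt0 gc x.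
have Ek : (kk g).[x] = p4.[x] - g.[x] ^+ 2 by rewrite /kpol hornerD hornerN horner_exp.
have Eh : (hh t g).[x] = p2.[x] - 2 * t * g.[x].
  by rewrite /hpol hornerD hornerN hornerZ -[t *+ 2]mulr_natl.
have w2 : w.[x] ^+ 2 <= 4 * ((hh t g).[x] * (kk g).[x]) by rewrite E lerDr sqr_ge0.
have g2 : g.[x] ^+ 2 <= p4.[x] by rewrite -subr_ge0 -Ek.
have p40 : 0 <= p4.[x] by apply: le_trans g2; exact: sqr_ge0.
have ga : `|g.[x]| <= 1 + p4.[x].
  have := sqr_ge0 (`|g.[x]| - 1); have := real_normK (num_real g.[x]); nra.
have kle : (kk g).[x] <= p4.[x] by rewrite Ek lerBlDr lerDl sqr_ge0.
have hle : (hh t g).[x] <= p2.[x] + 2 * (1 + p4.[x]).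
  have : - g.[x] <= 1 + p4.[x] by rewrite (le_trans _ ga) // -normrN ler_norm.
  by rewrite Eh; nra.
have hk : (hh t g).[x] * (kk g).[x] <= (p2.[x] + 2 * (1 + p4.[x])) * p4.[x] by exact: ler_pM.
have pp : 0 <= (p2.[x] + 2 * (1 + p4.[x])) * p4.[x] by rewrite mulr_ge0 //; lra.
split; first by lra.
have := sqr_ge0 (`|w.[x]| - 1); have := real_normK (num_real w.[x]); lra.
Qed.

Lemma solutions_bounded : exists B, forall t X, 0 <= t <= 1 ->
  psd_cond t X /\ sysF t X = 0 -> `|X| <= B.
Proof.
(* The values at 0, 1, -1 and 2 determine the coefficients of [g] and [w] by interpolation; 10 is a
   safe factor for inverting it. *)
pose b x := 1 + p4.[x] + 4 * (p2.[x] + 2 * (1 + p4.[x])) * p4.[x] + 1.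
exists (10 * (b 0 + b 1 + b (-1) + b 2)) => t X t01 /solE_sys S.
have H x : `|(gof X).[x]| <= b x /\ `|(wof X).[x]| <= b x.
  by have [c -> [H1 H2]] := sol_pointwise_bound x t01 S; rewrite /b; split; lra.
have g_ev x : (gof X).[x] = (gof X)`_0 + (gof X)`_1 * x + (gof X)`_2 * x ^+ 2.
  by rewrite (horner_coef_wide _ (size_gof X)) !big_ord_recl big_ord0 /=; ring.
have w_ev x : (wof X).[x] = (wof X)`_0 + (wof X)`_1 * x + (wof X)`_2 * x ^+ 2 + (wof X)`_3 * x ^+ 3.
  by rewrite (horner_coef_wide _ (size_wof X)) !big_ord_recl big_ord0 /=; ring.
have [] := H 0; have [] := H 1; have [] := H (-1); have [] := H 2.
rewrite !g_ev !w_ev !ler_norml.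
move=> /andP[a1 a2] /andP[a3 a4] /andP[a5 a6] /andP[a7 a8].
move=> /andP[b1 b2] /andP[b3 b4] /andP[b5 b6] /andP[b7 b8].
apply: rv_norm_le; first by lra.
move=> j; rewrite -(mk_gof_wof X) mxE ler_norml.
case: j => -[|[|[|[|[|[|[|j]]]]]]] //= _; apply/andP; split; lra.
Qed.

Lemma psd_cond_closed : closed [set p : R * V | psd_cond p.1 p.2].
Proof.
rewrite (_ : [set p : R * V | _] = \bigcap_(x : R) [set p : R * V | 0 <= (hh p.1 (gof p.2)).[x]]).
  apply: closed_bigI => x _.
  have cont : continuous (fun p : R * V => (hh p.1 (gof p.2)).[x]).
    move=> p; apply: (@horner_continuous _ _ p 3 (fun p : R * V => hh p.1 (gof p.2)) (fun=> x)).
    - by move=> q; exact: size_hh.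
    - by case: p => t X; apply: hpol_continuous; [exact: cvg_fst | exact: cvg_snd].
    - exact: cvg_cst.
  by apply: (@preimage_closed _ _ (fun p : R * V => (hh p.1 (gof p.2)).[x]) [set y | 0 <= y]); [move=> ? _; exact: cont | exact: closed_ge].
by apply/seteqP; split=> p /= H x; [move=> _|]; exact: H.
Qed.

(** The homogenization is needed because a real zero of [h] may sit at infinity and become finite
    under deformation. *)
Definition hform (n : nat) (p : {poly R}) (x y : R) := \sum_(i < n.+1) p`_i * (x ^+ i * y ^+ (n - i)).

Lemma hformE n (p : {poly R}) x y : y != 0 -> (size p <= n.+1)%N -> hform n p x y = y ^+ n * p.[x / y].
Proof.
move=> y0 sp; rewrite (horner_coef_wide _ sp) mulr_sumr; apply: eq_bigr => i _.
have -> : y ^+ n = y ^+ (n - i) * y ^+ i by rewrite -exprD subnK // -ltnS.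
rewrite expr_div_n; have yi : y ^+ i != 0 by rewrite expf_neq0.
field; exact: yi.
Qed.

Lemma hform0 n (p : {poly R}) x : (size p <= n.+1)%N -> hform n p x 0 = p`_n * x ^+ n.
Proof.
move=> sp; rewrite /hform big_ord_recr /= subnn expr0 mulr1 big1 ?add0r // => i _.
by rewrite expr0n subn_eq0 leqNgt ltn_ord /= !mulr0.
Qed.

Lemma hform_continuous (T : topologicalType) (z : T) n (P : T -> {poly R}) (a b : T -> R) :
  coef_continuous z P -> {for z, continuous a} -> {for z, continuous b} ->
  {for z, continuous (fun y => hform n (P y) (a y) (b y))}.
Proof.
move=> HP Ha Hb; apply: cont_sum => i; apply: cvgM; first exact: HP.
by apply: cvgM; exact: exp_continuous.
Qed.

Lemma hform_sol t X x y : eqpol p2 p3 p4 t (gof X) (wof X) = 0 ->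
  0 <= hform 2 (hh t (gof X)) x y * hform 4 (kk (gof X)) x y.
Proof.
rewrite /eqpol -addrA -opprD => /eqP; rewrite subr_eq0 => /eqP E.
have sh := size_hh t X; have sk := size_kk X.
rewrite -(pmulr_rge0 _ (ltr0n R 4)); have [->|y0] := eqVneq y 0.
  have := congr1 (fun p : {poly R} => p`_(3 + 3)%N) E.
  rewrite coefZ (coefM_top (m := 2) (n := 4) sh sk) (coefD (p3 ^+ 2)) [p3 ^+ 2]expr2 [wof X ^+ 2]expr2.
  rewrite (coefM_top (size_p3 gc) (size_p3 gc)) (coefM_top (size_wof X) (size_wof X)) => E'.
  rewrite (hform0 _ sh) (hform0 _ sk).
  rewrite (_ : 4 * _ = (4 * ((hh t (gof X))`_2 * (kk (gof X))`_4)) * x ^+ 6); last by ring.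
  rewrite E' -!expr2 mulr_ge0 ?addr_ge0 ?sqr_ge0 //.
  by rewrite (_ : x ^+ 6 = (x ^+ 3) ^+ 2) ?sqr_ge0 // -exprM.
rewrite (hformE _ y0 sh) (hformE _ y0 sk).
have := congr1 (fun p : {poly R} => p.[x / y]) E; rewrite hornerZ hornerM [(_ ^+ 2 + _).[_]]hornerD !horner_exp => E'.
rewrite (_ : 4 * _ = (4 * ((hh t (gof X)).[x / y] * (kk (gof X)).[x / y])) * (y ^+ 3) ^+ 2); last by ring.
by rewrite E' mulr_ge0 ?addr_ge0 ?sqr_ge0.
Qed.

Lemma hh_ev t X x : (hh t (gof X)).[x] =
  (hh t (gof X))`_2 * x ^+ 2 + (hh t (gof X))`_1 * x + (hh t (gof X))`_0.
Proof. by rewrite (horner_coef_wide _ (size_hh t X)) !big_ord_recl big_ord0 /=; ring. Qed.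

Lemma pos_near (T : topologicalType) (z : T) (f : T -> R) : {for z, continuous f} -> 0 < f z ->
  \forall y \near z, 0 < f y.
Proof. by move=> fc f0; apply: (cvgr_gt (f z) fc). Qed.

(** For any zero of the system [h k >= 0] as forms, since [4 h k = p3^2 + w^2]. The form [h] could
    become negative only near a double zero, and there [k > 0]. Let [h = a x^2 + b x y + c y^2].
    Evaluating at the vertex [(- b : 2 a)] of the perturbed [h], where its value is
    [a (4 a c - b^2)], shows that the discriminant keeps its sign. *)
Lemma psd_cond_open t X : 0 <= t <= 1 -> psd_cond t X /\ sysF t X = 0 ->
  \forall p \near (t, X), 0 <= p.1 <= 1 -> sysF p.1 p.2 = 0 -> psd_cond p.1 p.2.
Proof.
move=> t01 /solE_sys S.
pose co i := fun p : R * V => (hh p.1 (gof p.2))`_i.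
have hc : coef_continuous (t, X) (fun p : R * V => hh p.1 (gof p.2)).
  by apply: hpol_continuous; [exact: cvg_fst | exact: cvg_snd].
have kc : coef_continuous (t, X) (fun p : R * V => kk (gof p.2)).
  by apply: kpol_continuous; exact: cvg_snd.
have H0 x : 0 <= co 2%N (t, X) * x ^+ 2 + co 1%N (t, X) * x + co 0%N (t, X).
  by have := hpol_ge0 S x; rewrite hh_ev.
have a0 := quad_lead_ge0 H0.
have mc (f g : R * V -> R) : {for (t, X), continuous f} -> {for (t, X), continuous g} ->
   {for (t, X), continuous (fun p => f p * g p)} by move=> ? ?; apply: cvgM.
have nc i : {for (t, X), continuous (fun p => - co i p)} by apply: cvgN; exact: (hc i).
have dc i : {for (t, X), continuous (fun p => 2 * co i p)} by apply: mc; [exact: cvg_cst | exact: (hc i)].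
have discc : {for (t, X), continuous (fun p => 4 * co 2%N p * co 0%N p - co 1%N p * co 1%N p)}.
  apply: cvgB; last by apply: (mc (co 1%N) (co 1%N)); exact: hc.
  by apply: (mc _ (co 0%N)); [apply: (mc (fun=> 4) (co 2%N)); [exact: cvg_cst | exact: hc] | exact: hc].
move: a0; rewrite le_eqVlt => /orP[/eqP/esym a0|a0].
(* The double zero is at infinity. The vertex is taken in the other chart, at [(2 c : - b)], where
   the value of [h] is [c (4 a c - b^2)] and [c] stays positive. *)
- have [k4 c0] := hpol_infty_kpol S (size_p3 gc) (size_p2 gc) (size_p4 gc) (p3_size gen) a0.
  have b0 : co 1%N (t, X) = 0.
    apply/eqP; apply: contraT => h1; have := H0 (- (co 0%N (t, X) + 1) / co 1%N (t, X)).
    by rewrite a0 mul0r add0r mulrCA divff // mulr1; lra.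
  have K0 : 0 < hform 4 (kk (gof X)) (2 * co 0%N (t, X)) (- co 1%N (t, X)).
    rewrite b0 oppr0 (hform0 _ (size_kk X)) mulr_gt0 // exprn_gt0 // mulr_gt0 //.
  have n1 := pos_near (hform_continuous (n := 4) kc (dc 0%N) (nc 1%N)) K0.
  have n2 := pos_near (hc 0%N) c0.
  move: n1 n2; apply: filterS2 => -[t' X'] /= K' c' _ /sysF_eq0 E' x.
  have := hform_sol (2 * co 0%N (t', X')) (- co 1%N (t', X')) E'.
  rewrite (pmulr_lge0 _ K') => HH.
  have HE u v : hform 2 (hh t' (gof X')) u v =
      co 0%N (t', X') * v ^+ 2 + co 1%N (t', X') * (u * v) + co 2%N (t', X') * u ^+ 2.
    by rewrite /hform !big_ord_recl big_ord0 /= /co; ring.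
  have a' : 0 <= co 2%N (t', X').
    have [b'0|b'0] := eqVneq (co 1%N (t', X')) 0.
      move: HH; rewrite HE b'0 oppr0 expr0n /= !(mulr0, mul0r) ?add0r.
      by rewrite pmulr_lge0 // exprn_gt0 // mulr_gt0.
    move: HH; rewrite HE => HH.
    have b2 : 0 < co 1%N (t', X') ^+ 2 by rewrite exprn_even_gt0.
    have : 0 <= co 0%N (t', X') * (4 * co 2%N (t', X') * co 0%N (t', X') - co 1%N (t', X') ^+ 2).
      by apply: le_trans HH _; rewrite le_eqVlt; apply/orP; left; apply/eqP; ring.
    rewrite pmulr_rge0 // => HH2; rewrite leNgt; apply/negP => an.
    have : co 2%N (t', X') * co 0%N (t', X') < 0 by rewrite nmulr_rlt0.
    lra.
  rewrite hh_ev; apply: quad_ge0 => //; [exact: ltW | exact: ltr_wpDl|].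
  rewrite -subr_ge0 -(pmulr_rge0 _ c').
  by move: HH; rewrite HE /co /=; congr (0 <= _); ring.
- have D0 := quad_disc a0 H0.
  have HE p u v : hform 2 (hh p.1 (gof p.2)) u v =
      co 0%N p * v ^+ 2 + co 1%N p * (u * v) + co 2%N p * u ^+ 2.
    by rewrite /hform !big_ord_recl big_ord0 /= /co; ring.
  have fin p : 0 < co 2%N p -> 0 <= 4 * co 2%N p * co 0%N p - co 1%N p * co 1%N p -> psd_cond p.1 p.2.
    rewrite /co => a' d' x; rewrite hh_ev.
    set a := (hh _ _)`_2 in a' d' *; set b := (hh _ _)`_1 in d' *; set c := (hh _ _)`_0 in d' *.
    have b2 := sqr_ge0 b.
    have c' : 0 <= c by rewrite -(pmulr_rge0 _ a'); lra.
    by apply: quad_ge0; rewrite ?ltr_pwDl ?(ltW a') // -subr_ge0 expr2.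
  have n2 := pos_near (hc 2%N) a0.
  (* A definite [h] stays definite by continuity; only the case of a double zero uses the
     equation. *)
  have [dz|dz] := ltrP (co 1%N (t, X) ^+ 2) (4 * co 2%N (t, X) * co 0%N (t, X)).
    have dpos : 0 < 4 * co 2%N (t, X) * co 0%N (t, X) - co 1%N (t, X) * co 1%N (t, X).
      by rewrite subr_gt0 -expr2.
    move: (pos_near discc dpos) n2; apply: filterS2 => p d' a' _ _.
    by apply: fin => //; exact: ltW.
  have DE : co 1%N (t, X) ^+ 2 = 4 * co 2%N (t, X) * co 0%N (t, X).
    by apply/eqP; rewrite eq_le D0 dz.
  have y00 : 2 * co 2%N (t, X) != 0 by rewrite mulf_neq0 ?pnatr_eq0 ?gt_eqF.
  have hx0 : (hh t (gof X)).[- co 1%N (t, X) / (2 * co 2%N (t, X))] = 0.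
    apply: (mulfI (expf_neq0 2 y00)); rewrite mulr0 -(hformE _ y00 (size_hh t X)) (HE (t, X)).
    by rewrite (_ : _ + _ = co 2%N (t, X) * (4 * co 2%N (t, X) * co 0%N (t, X) - co 1%N (t, X) ^+ 2)); [rewrite DE subrr mulr0 | ring].
  have K0 : 0 < hform 4 (kk (gof X)) (- co 1%N (t, X)) (2 * co 2%N (t, X)).
    rewrite (hformE _ y00 (size_kk X)) mulr_gt0 //; first by rewrite exprn_even_gt0.
    exact: (hpol_root_kpol S (size_p2 gc) (@p3_sep _ _ _ _ gen) hx0).
  move: (pos_near (hform_continuous (n := 4) kc (nc 1%N) (dc 2%N)) K0) n2.
  apply: filterS2 => p K' a' _ /sysF_eq0 E'; apply: fin => //.
  have := hform_sol (- co 1%N p) (2 * co 2%N p) E'; rewrite (pmulr_lge0 _ K') HE => HH.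
  rewrite -(pmulr_rge0 _ a').
  by move: HH; rewrite /co /=; congr (0 <= _); ring.
Qed.

Definition distinct_solutions N t := exists Y : 'I_N -> {poly R} * {poly R},
  (forall i, sol t (Y i).1 (Y i).2) /\ (forall i j, i != j -> (Y i).1 <> (Y j).1).

Lemma sol_flip t g w : sol t g w -> sol t g (- w).
Proof.
case=> sg sw h E; split=> //; first by rewrite size_polyN.
by move: E; rewrite /eqpol sqrrN.
Qed.

Lemma sol_same t g w w' : sol t g w -> sol t g w' -> w' = w \/ w' = - w.
Proof.
move=> /sol_eq E /sol_eq E'; have /eqP : w' ^+ 2 = w ^+ 2.
  by apply: oppr_inj; apply: (addrI (4 *: (hh t g * kk g) - p3 ^+ 2)); rewrite [LHS]E' [RHS]E.
by rewrite eqf_sqr => /orP[] /eqP; [left | right].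
Qed.

Lemma distinct_solutionsE N t : distinct_solutions N t <->
  solutions sysF psd_cond (@flip R) N t.
Proof.
split=> [[Y [Ysol Yd]]|[Y [Ysol Yd]]].
  have gY i : gof (mk (Y i).1 (Y i).2) = (Y i).1 by rewrite gof_mk // (size_g (Ysol i)).
  have wY i : wof (mk (Y i).1 (Y i).2) = (Y i).2 by rewrite wof_mk // (size_w (Ysol i)).
  exists (fun i => mk (Y i).1 (Y i).2); split=> [i|i j ij].
    by apply/solE_sys; rewrite gY wY.
  split=> /(congr1 (@gof R)); rewrite ?gY; first exact: Yd.
  rewrite /flip gof_mk ?size_gof // gY; exact: Yd.
exists (fun i => (gof (Y i), wof (Y i))); split=> [i|i j ij /= E].
  exact/solE_sys/Ysol.
have Si := proj1 (solE_sys t (Y i)) (Ysol i); have Sj := proj1 (solE_sys t (Y j)) (Ysol j).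
have [d1 d2] := Yd i j ij; rewrite E in Si.
have [Ew|Ew] := sol_same Sj Si.
  by apply: d1; rewrite -(mk_gof_wof (Y i)) E Ew mk_gof_wof.
by apply: d2; rewrite -(mk_gof_wof (Y i)) E Ew.
Qed.

Lemma distinct_solutions01 N : distinct_solutions N 0 <-> distinct_solutions N 1.
Proof.
rewrite !distinct_solutionsE; apply: (solutions01 sysF_M sysF_cont sysM_cont sysM_unit
  solutions_bounded psd_cond_closed psd_cond_open (@flip_continuous R)).
move=> t X /solE_sys S; apply/solE_sys.
by rewrite /flip gof_mk ?size_gof // wof_mk ?size_polyN ?size_wof //; exact: sol_flip.
Qed.

End Equations.
End Deformation.

(** * The solutions at [t = 0] *)

Section ConeCount.
Variables (R : realType) (p2 p3 p4 : {poly R}).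
Hypothesis gen : cone_generic p2 p3 p4.
Local Notation C := R[i].
Local Notation cx := (map_poly (real_complex R)).
Local Notation sol0 := (solution p2 p3 p4 0).
Local Notation gof := (@Deformation.gof R).
Local Notation wof := (@Deformation.wof R).

Definition cone_disc : {poly R} := 4 *: (p2 * p4) - p3 ^+ 2.
Local Notation D := cone_disc.

(** The norm of [w + g sqrt(- 4 p2)] in the quadratic extension of the field of rational
    functions. *)
Definition norm_form (g w : {poly R}) : {poly R} := w ^+ 2 + 4 *: (p2 * g ^+ 2).

Lemma sol0E (g w : {poly R}) : (size g <= 3)%N -> (size w <= 4)%N ->
  sol0 g w <-> norm_form g w = D.
Proof.
move=> sg sw; have Eh : hpol p2 0 g = p2 by rewrite /hpol mul0rn scale0r subr0.
have E : eqpol p2 p3 p4 0 g w = D - norm_form g w.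
  by rewrite /eqpol Eh /kpol /D /norm_form -!mul_polyC; ring.
split=> [[_ _ _]|N]; first by rewrite E => /eqP; rewrite subr_eq0 => /eqP.
by split=> //; [move=> x; rewrite Eh ltW ?(p2_gt0 gen) | rewrite E N subrr].
Qed.

Lemma size_norm_form (g w : {poly R}) : (size g <= 3)%N -> (size w <= 4)%N -> (size (norm_form g w) <= 7)%N.
Proof.
move=> sg sw; apply: size_polyD_le; first by rewrite expr2; exact: (@size_polyM_le _ _ _ 3 3).
rewrite (leq_trans (size_scale_leq _ _)) //; apply: (@size_polyM_le _ _ _ 2 4); first exact: size_p2 gen.
by rewrite expr2; exact: (@size_polyM_le _ _ _ 2 2).
Qed.

Lemma size_D : size D = 7%N.
Proof.
apply/eqP; rewrite eqn_leq; apply/andP; split.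
  apply: size_polyD_le.
    rewrite (leq_trans (size_scale_leq _ _)) //.
    by apply: (@size_polyM_le _ _ _ 2 4); [exact: size_p2 gen | exact: size_p4 gen].
  by rewrite size_polyN expr2; apply: (@size_polyM_le _ _ _ 3 3); exact: size_p3 gen.
rewrite ltnNge; apply/negP => s6; have := cone_disc_lead gen.
by rewrite -/D nth_default // eqxx.
Qed.

Lemma D_gt0 x : 0 < D.[x].
Proof.
rewrite lt_def (cone_disc_ge0 gen) andbT; apply/negP => /eqP D0.
have [q Eq] := nneg_double_root (cone_disc_ge0 gen) D0.
apply: (@cone_disc_sep _ _ _ _ gen x%:C%C (cx q)).
by rewrite {1}[_ - _]Eq rmorphM rmorphXn rmorphB /= map_polyX map_polyC.
Qed.

(** [D] is separable of degree 6 and positive on the reals, so its roots are three conjugate pairs;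
    [a] lists those in the upper half plane. A real polynomial of degree at most 5 vanishing at them
    vanishes at all six roots. *)
Lemma cone_roots : exists a : 'I_3 -> C,
  [/\ forall i, evC D (a i) = 0 &
      forall p : {poly R}, (size p <= 6)%N -> (forall i, evC p (a i) = 0) -> p = 0].
Proof.
have [r Er] := closed_field_poly_normal (cx D).
have D0 : cx D != 0 by rewrite -size_poly_eq0 size_map_poly size_D.
have l0 : lead_coef (cx D) != 0 by rewrite lead_coef_eq0.
have sr : size r = 6%N.
  apply: succn_inj; rewrite -[RHS]size_D -(size_map_poly (real_complex R)) Er size_scale //.
  by rewrite size_prod_XsubC.
have rD x : (x \in r) = (evC D x == 0).
  by rewrite /evC -[RHS]/(root _ _) Er rootZ // root_prod_XsubC.
have ur : uniq r.
  apply: contraT => /uniqPn -/(_ 0) [i [j [ij jr Ei]]]; exfalso.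
  have ir : r`_i \in r by rewrite mem_nth // (ltn_trans ij).
  pose x := r`_i; rewrite -/x in ir.
  have c1 : (1 < count (pred1 x) r)%N.
    rewrite -(cat_take_drop j r) count_cat; apply: (@leq_trans (1 + 1)%N) => //.
    rewrite leq_add //.
      rewrite -has_count; apply/hasP; exists x => //=; rewrite /x -(nth_take 0 ij) mem_nth //.
      by rewrite size_take jr.
    by rewrite (drop_nth 0 jr) /= -Ei eqxx.
  have h1 := perm_to_rem ir.
  have i1 : x \in rem x r.
    rewrite -has_pred1 has_count; move/seq.permP/(_ (pred1 x)): h1 c1 => ->.
    by rewrite /= eqxx.
  have Er2 : perm_eq r (x :: x :: rem x (rem x r)).
    by rewrite (perm_trans h1) // perm_cons perm_to_rem.
  apply: (@cone_disc_sep _ _ _ _ gen x (lead_coef (cx D) *: \prod_(z <- rem x (rem x r)) ('X - z%:P))).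
  by rewrite -/D {1}Er (perm_big _ Er2) /= !big_cons -scalerAr expr2 mulrA.
have Im0 x : x \in r -> complex.Im x != 0.
  rewrite rD => /eqP Dx; apply/negP => /eqP I0; have := D_gt0 (complex.Re x).
  suff -> : D.[complex.Re x] = 0 by rewrite ltxx.
  by apply: evC_root; move: Dx I0; case: x => u v /= + v0; rewrite v0.
pose s := [seq x <- r | 0 < complex.Im x].
pose s' := [seq x <- r | complex.Im x < 0].
have cj x : (x^*%C \in r) = (x \in r).
  rewrite !rD; apply/eqP/eqP => /evC_conj0 //.
  by case: x => u v /=; rewrite opprK.
have cjI : injective (@conjc R) by move=> [u v] [u' v'] [-> /oppr_inj ->].
have ss' : (size s <= size s')%N.
  rewrite -(size_map (@conjc R)); apply: uniq_leq_size; first by rewrite map_inj_uniq // filter_uniq.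
  move=> y /mapP[x]; rewrite mem_filter => /andP[xI xr] ->; rewrite mem_filter cj xr andbT.
  by case: x xI {xr} => u v /= v0; rewrite oppr_lt0.
have s's : (size s' <= size s)%N.
  rewrite -(size_map (@conjc R)); apply: uniq_leq_size; first by rewrite map_inj_uniq // filter_uniq.
  move=> y /mapP[x]; rewrite mem_filter => /andP[xI xr] ->; rewrite mem_filter cj xr andbT.
  by case: x xI {xr} => u v /= v0; rewrite oppr_gt0.
have s3 : size s = 3%N.
  have Es : (size s + size s' = 6)%N.
    rewrite -sr /s /s' !size_filter -(count_predC (fun x => 0 < complex.Im x)); congr addn.
    by apply: eq_in_count => x /Im0 /=; case: ltrgtP.
  by move: Es ss' s's; move: (size s) (size s') => u v; lia.
exists (fun i : 'I_3 => s`_i); split=> [i|p sp Hp].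
  have : s`_i \in s by rewrite mem_nth // s3.
  by rewrite mem_filter rD => /andP[_ /eqP].
have p0 : cx p = 0.
  apply: (@roots_geq_poly_eq0 _ _ r) => //; last by rewrite sr size_map_poly.
  apply/allP => x xr; rewrite /root -/(evC p x).
  have ev y : y \in s -> evC p y = 0.
    by case/(seq.nthP (0 : C)) => i; rewrite s3 => i3 <-; exact: (Hp (Ordinal i3)).
  have := Im0 _ xr; case: (ltrgtP 0 (complex.Im x)) => [xI _|xI _|_ //].
    by rewrite ev // mem_filter xI.
  have -> : x = (x^*%C)^*%C by case: (x) => u v /=; rewrite opprK.
  rewrite evC_conj0 // ev // mem_filter cj xr andbT.
  by case: (x) xI => u v /=; rewrite oppr_gt0.
by apply: (map_poly_inj (real_complex R)); rewrite p0 rmorph0.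
Qed.

Section Signs.
Variables (a sigma : 'I_3 -> C).
Hypothesis Da : forall i, evC D (a i) = 0.
Hypothesis vanish_a : forall p : {poly R}, (size p <= 6)%N -> (forall i, evC p (a i) = 0) -> p = 0.
Hypothesis sigma2 : forall i, sigma i ^+ 2 = - 4 * evC p2 (a i).

Definition has_sign (e : 'I_3 -> bool) (g w : {poly R}) :=
  forall i, evC w (a i) = (-1) ^+ e i * sigma i * evC g (a i).

Lemma evC_norm_form g w x : evC (norm_form g w) x = evC w x ^+ 2 + 4 * evC p2 x * evC g x ^+ 2.
Proof. by rewrite /norm_form evCD evCZ evCX evCM evCX rmorph_nat mulrA. Qed.

Lemma sigma_neq0 i : sigma i != 0.
Proof.
rewrite -sqrf_eq0 sigma2 mulf_eq0 negb_or oppr_eq0 pnatr_eq0 /=.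
apply/negP => /eqP p20; apply: (p2_p3_coprime gen p20); apply/eqP.
have := Da i; rewrite /cone_disc evCD evCN evCZ evCX evCM p20 mul0r mulr0 add0r => /eqP.
by rewrite oppr_eq0 sqrf_eq0.
Qed.

(** Otherwise [w] vanishes at [a i] as well, and [D = w^2 + 4 p2 g^2] has a double root. *)
Lemma sol_neq0 g w i : sol0 g w -> evC g (a i) != 0.
Proof.
move=> S; have N : norm_form g w = D by apply/(sol0E (size_g S) (size_w S)).
apply/negP => /eqP g0; have w0 : evC w (a i) = 0.
  apply/eqP; rewrite -sqrf_eq0; have := evC_norm_form g w (a i).
  by rewrite N Da g0 expr0n mulr0 addr0 => <-.
have [u Eu] := factorC g0; have [v Ev] := factorC w0.
apply: (@cone_disc_sep _ _ _ _ gen (a i) (v ^+ 2 + (real_complex R 4) *: (cx p2 * u ^+ 2))).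
rewrite -/D -N rmorphD rmorphXn /= Ev map_polyZ /= rmorphM rmorphXn /= Eu !exprMn mulrDr -scalerAr.
by congr (_ + _ *: _); rewrite mulrCA.
Qed.

Lemma sol_poly_neq0 g w : sol0 g w -> g != 0.
Proof.
move=> S; apply/negP => /eqP g0; have := sol_neq0 ord0 S.
by rewrite g0 evC0 eqxx.
Qed.

Lemma sol_sign g w : sol0 g w -> exists e, has_sign e g w.
Proof.
move=> S; have N : norm_form g w = D by apply/(sol0E (size_g S) (size_w S)).
exists (fun i => evC w (a i) == - (sigma i * evC g (a i))) => i.
have : evC w (a i) ^+ 2 = (sigma i * evC g (a i)) ^+ 2.
  apply/eqP; rewrite -subr_eq0 exprMn sigma2; apply/eqP.
  by have := evC_norm_form g w (a i); rewrite N Da => ->; ring.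
move=> /eqP; rewrite eqf_sqr; case: eqP => [->|/eqP ne]; case: eqP => //= E _.
- by rewrite expr1 mulN1r mulNr.
- by rewrite expr0 mul1r.
- by rewrite E expr1 mulN1r mulNr.
Qed.

Lemma sol_sign_uniq g w e e' : sol0 g w -> has_sign e g w -> has_sign e' g w -> e =1 e'.
Proof.
move=> S H H' i; have sg0 : sigma i * evC g (a i) != 0 by rewrite mulf_neq0 ?sigma_neq0 // (sol_neq0 i S).
move: (H' i); rewrite (H i) -!mulrA => /(mulIf sg0) /eqP; rewrite -subr_eq0.
have n2 : (1 + 1 : C) != 0 by rewrite (_ : 1 + 1 = 2%:R) ?pnatr_eq0.
case: (e i) (e' i) => -[] //=; rewrite expr0 expr1; first by rewrite -opprD oppr_eq0 (negbTE n2).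
by rewrite opprK (negbTE n2).
Qed.

Lemma has_signNg e g w : has_sign e g w -> has_sign (fun i => ~~ e i) (- g) w.
Proof.
by move=> H i; rewrite H evCN; case: (e i); rewrite /= ?expr0 ?expr1; ring.
Qed.

Lemma has_signNw e g w : has_sign e g w -> has_sign (fun i => ~~ e i) g (- w).
Proof.
by move=> H i; rewrite evCN H; case: (e i); rewrite /= ?expr0 ?expr1; ring.
Qed.

Lemma sol0N g w : sol0 g w -> sol0 (- g) w.
Proof.
move=> S; have N : norm_form g w = D by apply/(sol0E (size_g S) (size_w S)).
by apply/sol0E; rewrite ?size_polyN ?(size_g S) ?(size_w S) // -N /norm_form sqrrN.
Qed.

(** The polynomial [w g' - w' g] has degree at most 5 and vanishes at the three roots, so it is
    zero; and [D (g'^2 - g^2) = w^2 g'^2 - w'^2 g^2]. *)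
Lemma same_sign_uniq e g w g' w' : sol0 g w -> sol0 g' w' -> has_sign e g w -> has_sign e g' w' ->
  g' = g \/ g' = - g.
Proof.
move=> S S' H H'.
have N : norm_form g w = D by apply/(sol0E (size_g S) (size_w S)).
have N' : norm_form g' w' = D by apply/(sol0E (size_g S') (size_w S')).
have E : w * g' - w' * g = 0.
  apply: vanish_a => [|i]; last by rewrite evCD evCN !evCM H H'; ring.
  apply: size_polyD_le; rewrite ?size_polyN; apply: (@size_polyM_le _ _ _ 3 2);
   by rewrite ?(size_g S) ?(size_w S) ?(size_g S') ?(size_w S').
have E2 : D * (g' ^+ 2 - g ^+ 2) = 0.
  rewrite mulrBr -{1}N -N' /norm_form.
  rewrite (_ : _ - _ = (w * g' - w' * g) * (w * g' + w' * g)); first by rewrite E mul0r.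
  by rewrite -!mul_polyC; ring.
have D0 : D != 0 by rewrite -size_poly_eq0 size_D.
move/eqP: E2; rewrite mulf_eq0 (negbTE D0) orFb subr_eq0 eqf_sqr => /orP[] /eqP ->; by [left | right].
Qed.

Definition sign_form (e : 'I_3 -> bool) j (Z : 'rV[R]_7) : C :=
  evC (wof Z) (a j) - (-1) ^+ e j * sigma j * evC (gof Z) (a j).

Lemma sign_form_lin e j (c : R) X Y :
  sign_form e j (c *: X + Y) = c%:C%C * sign_form e j X + sign_form e j Y.
Proof.
by rewrite /sign_form Deformation.gof_lin Deformation.wof_lin !evCD !evCZ; ring.
Qed.

Lemma sign_form0 e j : sign_form e j 0 = 0.
Proof.
have := sign_form_lin e j 1 0 0; rewrite scale1r addr0 rmorph1 mul1r => /esym/eqP.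
by rewrite -subr_eq0 addrK => /eqP.
Qed.

Definition sign_mx (e : 'I_3 -> bool) : 'M[R]_(7, 3 + 3) :=
  row_mx (\matrix_(i, j) complex.Re (sign_form e j (delta_mx 0 i)))
         (\matrix_(i, j) complex.Im (sign_form e j (delta_mx 0 i))).

(** Three complex conditions are six real equations in seven unknowns. *)
Lemma sign_kernel e : exists2 Z : 'rV[R]_7, Z != 0 & forall j, sign_form e j Z = 0.
Proof.
have : kermx (sign_mx e) != 0.
  rewrite kermx_eq0 -row_leq_rank -ltnNge.
  by rewrite (leq_ltn_trans (rank_leq_col (sign_mx e))).
move=> /rowV0Pn [Z /sub_kermxP HZ Z0]; exists Z => // j.
have Ere : complex.Re (sign_form e j Z) = (Z *m (\matrix_(i, j) complex.Re (sign_form e j (delta_mx 0 i)))) 0 j.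
  rewrite mxE; under [RHS]eq_bigr => i _ do rewrite mxE.
  rewrite {1}[Z]row_sum_delta.
  elim/big_rec2: _ => [|i u U _ IH]; first by rewrite sign_form0.
  rewrite sign_form_lin -{}IH; case: (sign_form _ _ _) => x y; case: (sign_form _ _ _) => x' y' /=.
  by rewrite mul0r subr0 addrC.
have Eim : complex.Im (sign_form e j Z) = (Z *m (\matrix_(i, j) complex.Im (sign_form e j (delta_mx 0 i)))) 0 j.
  rewrite mxE; under [RHS]eq_bigr => i _ do rewrite mxE.
  rewrite {1}[Z]row_sum_delta.
  elim/big_rec2: _ => [|i u U _ IH]; first by rewrite sign_form0.
  rewrite sign_form_lin -{}IH; case: (sign_form _ _ _) => x y; case: (sign_form _ _ _) => x' y' /=.
  by rewrite mul0r addr0 addrC.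
move: HZ; rewrite /sign_mx mul_mx_row -[0 in RHS]row_mx0 => /eq_row_mx[H1 H2].
rewrite [LHS]complexE Ere Eim H1 H2 !mxE /= rmorph0 mulr0 addr0 //.
Qed.

(** The norm form of a kernel vector vanishes at the roots of [D], hence is [c D]. Since [p2 > 0]
    the norm form is positive definite, so [c > 0], and dividing the vector by the square root of
    [c] gives a solution. *)
Lemma sign_exists e : exists g w, sol0 g w /\ has_sign e g w.
Proof.
have [Z Z0 HZ] := sign_kernel e.
pose g := gof Z; pose w := wof Z.
have sg : (size g <= 3)%N := Deformation.size_gof Z.
have sw : (size w <= 4)%N := Deformation.size_wof Z.
have sgn : has_sign e g w by move=> i; apply/eqP; rewrite -subr_eq0; apply/eqP; exact: HZ.
have Na i : evC (norm_form g w) (a i) = 0.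
  rewrite evC_norm_form sgn !exprMn sigma2 sqrr_sign; ring.
pose c := (norm_form g w)`_6 / D`_6.
have D6 : D`_6 != 0 by exact: (cone_disc_lead gen).
have EN : norm_form g w = c *: D.
  apply/eqP; rewrite -subr_eq0; apply/eqP; apply: vanish_a => [|i]; last first.
    by rewrite evCD evCN evCZ Na Da mulr0 subrr.
  (* The choice of [c] cancels the coefficient of degree 6, which brings the difference down to
     degree 5. *)
  apply/leq_sizeP => j; rewrite leq_eqVlt => /orP[/eqP <-|j6].
    by rewrite coefB coefZ divfK // subrr.
  rewrite coefB coefZ !nth_default ?mulr0 ?subrr ?size_D //.
  by rewrite (leq_trans (size_norm_form sg sw)).
have Nev x : (norm_form g w).[x] = w.[x] ^+ 2 + 4 * p2.[x] * g.[x] ^+ 2.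
  by rewrite /norm_form hornerD horner_exp hornerZ hornerM horner_exp mulrA.
have p20 x : 0 < 4 * p2.[x] by rewrite mulr_gt0 ?(p2_gt0 gen).
have c0 : 0 <= c.
  have : 0 <= (norm_form g w).[0] by rewrite Nev addr_ge0 ?sqr_ge0 // mulr_ge0 ?sqr_ge0 // ltW.
  by rewrite EN hornerZ pmulr_lge0 // D_gt0.
have cn0 : c != 0.
  apply/negP => /eqP ce; have H x : w.[x] = 0 /\ g.[x] = 0.
    have := Nev x; rewrite EN ce scale0r horner0 => /esym/eqP.
    rewrite paddr_eq0 ?sqr_ge0 //; last by rewrite mulr_ge0 ?sqr_ge0 // ltW.
    by rewrite [4 * _ * _ == 0]mulf_eq0 (gt_eqF (p20 x)) /= !sqrf_eq0 => /andP[/eqP -> /eqP ->].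
  case/negP: Z0; apply/eqP; rewrite -[Z]Deformation.mk_gof_wof -/g -/w.
  have g0 : g = 0 by apply: poly0_horner => x; case: (H x).
  have w0 : w = 0 by apply: poly0_horner => x; case: (H x).
  rewrite g0 w0.
  by apply/rowP => j; rewrite !mxE !coef0 if_same.
pose d := (Num.sqrt c)^-1.
have d2 : d ^+ 2 * c = 1 by rewrite exprVn sqr_sqrtr // mulVf.
exists (d *: g), (d *: w); split; last by move=> i; rewrite !evCZ sgn; ring.
apply/sol0E; rewrite ?(leq_trans (size_scale_leq _ _)) //.
rewrite (_ : norm_form _ _ = (d ^+ 2) *: norm_form g w).
  by rewrite EN scalerA d2 scale1r.
by rewrite /norm_form -!mul_polyC rmorphXn /=; ring.
Qed.

End Signs.

(* Sign vectors modulo a global sign: the four vectors with first entry [+]. *)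
Lemma cone_count : exists G W : 'I_4 -> {poly R},
  [/\ forall k, sol0 (G k) (W k), forall k, G k != 0,
      forall k l, k != l -> G k <> G l /\ G k <> - G l &
      forall g w, sol0 g w -> exists k, g = G k \/ g = - G k].
Proof.
have [a [Da van]] := cone_roots.
pose sigma i := sqrtC (- 4 * evC p2 (a i)).
have sigma2 i : sigma i ^+ 2 = - 4 * evC p2 (a i) by rewrite sqrtCK.
(* The last two signs are the binary digits of [k]. *)
pose sg (k : 'I_4) (j : 'I_3) : bool :=
  if nat_of_ord j == 0%N then false else if nat_of_ord j == 1%N then odd k else (1 < k)%N.
have ex k : exists p : {poly R} * {poly R}, sol0 p.1 p.2 /\ has_sign a sigma (sg k) p.1 p.2.
  by have [g [w H]] := sign_exists Da van sigma2 (sg k); exists (g, w).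
have [P HP] := boolp.choice ex.
exists (fun k => (P k).1), (fun k => (P k).2).
have uniq k l g w : sol0 g w -> has_sign a sigma (sg k) g w -> has_sign a sigma (sg l) g w -> k = l.
  move=> S H1 H2; have E := sol_sign_uniq Da sigma2 S H1 H2.
  have := E (inord 1); have := E (inord 2); rewrite /sg !inordK //=.
  by case: k {H1 E} => -[|[|[|[|k]]]] kk; case: l {H2} => -[|[|[|[|l]]]] ll //= _ _; apply: val_inj.
split=> [k|k|k l kl|g w S].
- by case: (HP k).
- exact: (sol_poly_neq0 Da (HP k).1).
- have [Sk Hk] := HP k; have [Sl Hl] := HP l.
  split=> E.
    rewrite -E in Sl Hl; have [Ew|Ew] := Deformation.sol_same Sk Sl; rewrite Ew in Hl.
      by move/eqP: kl; apply; exact: uniq Sk Hk Hl.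
    have := has_signNw Hl; rewrite opprK => H'.
    by have := sol_sign_uniq Da sigma2 Sk Hk H' ord0.
  have SN := sol0N Sl; have HN := has_signNg Hl; rewrite -E in SN HN.
  have [Ew|Ew] := Deformation.sol_same Sk SN; rewrite Ew in HN.
    by have := sol_sign_uniq Da sigma2 Sk Hk HN ord0.
  have HN' := has_signNw HN; rewrite opprK in HN'.
  move/eqP: kl; apply; apply: (uniq k l _ _ Sk Hk).
  by move=> i; rewrite (HN' i) negbK.
have [e He] := sol_sign Da sigma2 S.
(* Replacing [w] by [- w] keeps [g] and flips all signs. *)
wlog e0 : e w S He / e ord0 = false.
  move=> H; case E0 : (e ord0); last exact: (H e w).
  apply: (H (fun i => ~~ e i) (- w)); last by rewrite E0.
  - exact: Deformation.sol_flip S.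
  - exact: has_signNw.
pose k : 'I_4 := inord (e (inord 1) + 2 * e (inord 2)).
have Ek : nat_of_ord k = (e (inord 1) + 2 * e (inord 2))%N.
  by rewrite inordK //; case: (e _); case: (e _).
exists k; have [Sk Hk] := HP k.
apply: (same_sign_uniq van Sk S Hk) => i; rewrite He; congr ((-1) ^+ nat_of_bool _ * _ * _).
case: i => -[|[|[|i]]] Hi //.
- by rewrite /sg /= -e0; congr (e _); apply: val_inj.
- rewrite /sg /= Ek; rewrite (_ : Ordinal Hi = inord 1); last by apply: val_inj; rewrite /= inordK.
  by case: (e _); case: (e _).
- rewrite /sg /= Ek; rewrite (_ : Ordinal Hi = inord 2); last by apply: val_inj; rewrite /= inordK.
  by case: (e _); case: (e _).
Qed.

End ConeCount.

(** * The solutions at [t = 1] *)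

Section PencilCount.
Variables (R : realType) (p2 p3 p4 : {poly R}).
Hypothesis gen : pencil_generic p2 p3 p4.
Local Notation sol := (solution p2 p3 p4).

(** At [t = 0] the solutions [g] are the four [G0 k] and their negatives, so there are 8 distinct
    ones but not 9. Both facts are carried to [t = 1], and the second makes the 8 found there a
    complete list. *)
Lemma pencil_count : exists G W : 'I_8 -> {poly R},
  [/\ forall k, sol 1 (G k) (W k), forall k l, k != l -> G k <> G l &
      forall g w, sol 1 g w -> exists k, g = G k].
Proof.
have [G0 [W0 [S0 N0 D0 A0]]] := cone_count (pencil_cone gen).
have d8 : Deformation.distinct_solutions p2 p3 p4 8 0.
  have lt4 (i : 'I_8) : (i %% 4 < 4)%N by rewrite ltn_mod.
  pose m (i : 'I_8) := Ordinal (lt4 i).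
  exists (fun i : 'I_8 => (if (i < 4)%N then G0 (m i) else - G0 (m i), W0 (m i))).
  split=> [i|i j ij] /=.
    by case: ifP => _; [exact: S0 | exact: sol0N (pencil_cone gen) _ _ (S0 _)].
  have [E|ne] := eqVneq (m i) (m j).
    have lt : (i < 4)%N != (j < 4)%N.
      apply: contraNneq ij => lt; apply/eqP/val_inj.
      move/(congr1 val): E => /= E; move: lt E (ltn_ord i) (ltn_ord j).
      move: (nat_of_ord i) (nat_of_ord j) => u v.
      case: (ltnP u 4); case: (ltnP v 4) => // h1 h2 _; lia.
    rewrite E => F; case/negP: (N0 (m j)).
    have self (p : {poly R}) : p = - p -> p == 0.
      move=> Ep; have : p *+ 2 == 0 by rewrite mulr2n {1}Ep addNr.
      by rewrite -scaler_nat scale_poly_eq0 pnatr_eq0.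
    by move: lt F; case: ifP; case: ifP => // _ _ _ F; apply: self; rewrite // -F.
  have [d1 d2] := D0 _ _ ne.
  case: ifP => _; case: ifP => _ E.
  - exact: d1.
  - exact: d2.
  - by apply: d2; rewrite -E opprK.
  - by apply: d1; apply: oppr_inj.
have nd9 : ~ Deformation.distinct_solutions p2 p3 p4 9 0.
  move=> [Y [SY DY]].
  have ex i : exists kb : 'I_4 * bool, (Y i).1 = if kb.2 then - G0 kb.1 else G0 kb.1.
    by have [k [E|E]] := A0 _ _ (SY i); [exists (k, false) | exists (k, true)].
  have [f Hf] := boolp.choice ex.
  have inj : injective f.
    move=> i j E; apply/eqP; apply: contraT => /DY; case.
    by rewrite !Hf E.
  by have := leq_card f inj; rewrite card_prod !card_ord card_bool.
move/(Deformation.distinct_solutions01 gen): d8 => [Y [SY DY]].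
exists (fun i => (Y i).1), (fun i => (Y i).2); split=> // g w S.
apply: boolp.contrapT => nex; apply: nd9; apply/(Deformation.distinct_solutions01 gen).
exists (fun i : 'I_9 => if unlift ord_max i is Some j then Y j else (g, w)).
split=> [i|i j]; first by case: unliftP => [k _|_] //.
case: unliftP => [k ->|->]; case: unliftP => [l ->|->] ij E.
- by apply: DY E; apply: contraNneq ij => ->.
- by apply: nex; exists k.
- by apply: nex; exists l.
- by rewrite eqxx in ij.
Qed.

End PencilCount.

(** * Symmetric functions of the roots as polynomials in the coefficients *)

Section PolynomialFunctions.
Variable K : idomainType.

Definition polyfun (e : nat) (g : K -> K) :=
  exists nu : {poly K}, (size nu <= e.+1)%N /\ forall t, g t = nu.[t].

Lemma polyfun_ext e f g : f =1 g -> polyfun e f -> polyfun e g.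
Proof. by move=> fg [nu [s H]]; exists nu; split=> // t; rewrite -fg. Qed.

Lemma polyfun_const e c : polyfun e (fun=> c).
Proof.
exists c%:P; split=> [|t]; last by rewrite hornerC.
by rewrite (leq_trans (size_polyC_leq1 c)).
Qed.

Lemma polyfunD e f g : polyfun e f -> polyfun e g -> polyfun e (fun t => f t + g t).
Proof.
move=> [p [sp Hp]] [q [sq Hq]]; exists (p + q); split=> [|t].
  by rewrite (leq_trans (size_polyD _ _)) // geq_max sp sq.
by rewrite hornerD Hp Hq.
Qed.

Lemma polyfun_sum (I : Type) (r : seq I) (P : pred I) e f :
  (forall i, polyfun e (f i)) -> polyfun e (fun t => \sum_(i <- r | P i) f i t).
Proof.
move=> H; elim: r => [|x r IH].
  by apply: (polyfun_ext _ (polyfun_const e 0)) => t; rewrite big_nil.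
case Px: (P x).
  by apply: (polyfun_ext _ (polyfunD (H x) IH)) => t; rewrite big_cons Px.
by apply: (polyfun_ext _ IH) => t; rewrite big_cons Px.
Qed.

Lemma polyfunM e e' f g : polyfun e f -> polyfun e' g ->
  polyfun (e + e') (fun t => f t * g t).
Proof.
move=> [p [sp Hp]] [q [sq Hq]]; exists (p * q); split=> [|t].
  rewrite (leq_trans (size_polyMleq _ _)) // -subn1 leq_subLR add1n.
  by rewrite (leq_trans (leq_add sp sq)) // addSn addnS.
by rewrite hornerM Hp Hq.
Qed.

Lemma polyfunX e f n : polyfun e f -> polyfun (e * n) (fun t => f t ^+ n).
Proof.
move=> H; elim: n => [|n IH].
  by apply: (polyfun_ext _ (polyfun_const _ 1)) => t; rewrite expr0.
by rewrite mulnS; apply: (polyfun_ext _ (polyfunM H IH)) => t; rewrite exprS.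
Qed.

Lemma polyfun_prod (I : Type) (r : seq I) e f :
  (forall i, polyfun e (f i)) -> polyfun (e * size r) (fun t => \prod_(i <- r) f i t).
Proof.
move=> H; elim: r => [|x r IH].
  by apply: (polyfun_ext _ (polyfun_const _ 1)) => t; rewrite big_nil.
by rewrite /= mulnS; apply: (polyfun_ext _ (polyfunM (H x) IH)) => t; rewrite big_cons.
Qed.

End PolynomialFunctions.

Section Permanent.
Variables (K : comNzRingType) (m : nat).

(** Ryser's formula, by inclusion-exclusion over the set of allowed columns. When [a i j] is the
    value of a polynomial [q j] at a root [s i], each inner sum is the value at [s i] of a single
    polynomial independent of [i]. *)
Lemma ryser (a : 'I_m -> 'I_m -> K) :
  \sum_(s : 'S_m) \prod_i a i (s i) =
  \sum_(g : {ffun 'I_m -> bool}) (\prod_j (if g j then 1 else -1)) *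
    \prod_i \sum_(j | g j) a i j.
Proof.
have E (g : {ffun 'I_m -> bool}) : \prod_i \sum_(j | g j) a i j =
    \sum_(f : {ffun 'I_m -> 'I_m}) (\prod_i (g (f i))%:R) * \prod_i a i (f i).
  under eq_bigr => i _ do rewrite big_mkcond.
  rewrite bigA_distr_bigA; apply: eq_bigr => f _; rewrite -big_split /=.
  by apply: eq_bigr => i _; case: (g (f i)); rewrite ?mul1r ?mul0r.
under [RHS]eq_bigr => g _ do rewrite E mulr_sumr.
rewrite exchange_big /=.
pose sg (g : {ffun 'I_m -> bool}) : K := \prod_j (if g j then 1 else -1).
pose ind (f : {ffun 'I_m -> 'I_m}) (g : {ffun 'I_m -> bool}) : K := \prod_i (g (f i))%:R.
have E2 (f : {ffun 'I_m -> 'I_m}) :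
    \sum_(g : {ffun 'I_m -> bool}) sg g * (ind f g * \prod_i a i (f i)) =
    (injectiveb f)%:R * \prod_i a i (f i).
  under [LHS]eq_bigr => g _ do rewrite mulrA.
  rewrite -mulr_suml; congr (_ * _).
  (* Summed over [g], this product factors over the columns; a column outside the image of [f]
     contributes [1 - 1 = 0], so only bijections survive. *)
  have E3 (g : {ffun 'I_m -> bool}) : sg g * ind f g =
      \prod_j (if g j then 1 else - (j \notin codom f)%:R) :> K.
    rewrite /sg /ind; case: (boolP [forall i, g (f i)]) => [/forallP H|/forallPn [i Hi]].
      rewrite [X in _ * X]big1 ?mulr1 => [|i _]; last by rewrite H.
      apply: eq_bigr => j _; case: ifP => // gj.
      by case: codomP => // -[i ji]; rewrite ji H in gj.
    rewrite [X in _ * X](bigD1 i) //= (negbTE Hi) mul0r mulr0.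
    by rewrite (bigD1 (f i)) //= (negbTE Hi) codom_f oppr0 mul0r.
  under eq_bigr => g _ do rewrite E3.
  rewrite -(bigA_distr_bigA (fun j (b : bool) => if b then 1 else - (j \notin codom f)%:R)) /=.
  under eq_bigr => j _ do rewrite big_bool /=.
  case: (boolP (injectiveb f)) => [/injectiveP fi|nf].
    have fK := canF_sym (f_finv fi).
    by rewrite big1 // => j _; rewrite -[j](f_finv fi) codom_f oppr0 addr0.
  have [j Hj] : exists j, j \notin codom f.
    apply/existsP; rewrite -negb_forall; apply: contra nf => /forallP H.
    have /image_injP inj : #|image f 'I_m| == #|'I_m|.
      by apply/eqP/eq_card => j; rewrite H.
    by apply/injectiveP => x y; apply: inj.
  by rewrite (bigD1 j) //= Hj subrr mul0r.
rewrite [RHS](eq_bigr _ (fun f _ => E2 f)) (bigID (fun f : {ffun 'I_m -> 'I_m} => injectiveb f)) /=.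
rewrite [X in _ + X]big1 ?addr0 => [|f /negbTE ->]; last by rewrite mul0r.
rewrite (reindex (@pval _)) /=; last first.
  pose in_Sn := insubd (1%g : 'S_m).
  by exists in_Sn => /= f Uf; first apply: val_inj; apply: insubdK.
apply: eq_big => [s|s _]; first by rewrite (valP s).
by rewrite (valP s) mul1r; apply: eq_bigr => i _; rewrite pvalE.
Qed.

End Permanent.

Section SymmetricFunctions.
Variables (K : numClosedFieldType) (m : nat).
Hypothesis m_gt0 : (0 < m)%N.

(* [a0 ^ d * \prod_(s root of F) L s], written as a product over the roots of
   [L] instead, so that it makes sense and is polynomial in the coefficients of
   [F] even when the leading coefficient [a0] vanishes. *)
Definition root_prod (d : nat) (L F : {poly K}) : K :=
  F`_m ^+ (d - (size L).-1) * (lead_coef L ^+ m *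
    \prod_(x <- sval (closed_field_poly_normal L)) ((-1) ^+ m * F.[x])).

Lemma root_prodE d (L F : {poly K}) (s : 'I_m -> K) : (size L <= d.+1)%N ->
  F = F`_m *: \prod_i ('X - (s i)%:P) ->
  F`_m != 0 -> root_prod d L F = F`_m ^+ d * \prod_i L.[s i].
Proof.
move=> sL EF a0; rewrite /root_prod; case: closed_field_poly_normal => r /= EL.
have [L0|L0] := eqVneq L 0.
  rewrite L0 lead_coef0 expr0n (gtn_eqF m_gt0) mul0r mulr0.
  by rewrite (bigD1 (Ordinal m_gt0)) //= horner0 mul0r mulr0.
have sr : size r = (size L).-1.
  by rewrite EL size_scale ?lead_coef_eq0 // size_prod_XsubC.
have -> : \prod_i L.[s i] = lead_coef L ^+ m * \prod_(x <- r) \prod_i (s i - x).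
  rewrite exchange_big /= {1}EL.
  under eq_bigr => i _ do rewrite hornerZ horner_prod.
  rewrite big_split /= prodr_const card_ord; congr (_ * _).
  by apply: eq_bigr => i _; apply: eq_bigr => x _; rewrite hornerXsubC.
have -> : \prod_(x <- r) ((-1) ^+ m * F.[x]) =
    F`_m ^+ size r * \prod_(x <- r) \prod_i (s i - x).
  have -> : F`_m ^+ size r = \prod_(x <- r) F`_m.
    by rewrite big_const_seq count_predT iter_mulr_1.
  rewrite -big_split /=.
  apply: eq_bigr => x _; rewrite {1}EF hornerZ horner_prod mulrCA; congr (_ * _).
  have -> : (-1) ^+ m = \prod_(i < m) (-1) :> K by rewrite prodr_const card_ord.
  by rewrite -big_split; apply: eq_bigr => i _ /=; rewrite hornerXsubC mulN1r opprB.
have le_d : ((size L).-1 <= d)%N.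
  by rewrite -ltnS (leq_trans _ sL) // prednK // size_poly_gt0.
by rewrite sr mulrCA [X in _ * X]mulrA -exprD subnK // mulrCA.
Qed.

(** The values and the coefficient of degree [m] are the only data of a polynomial that enter
    [root_prod]. *)
Definition polypath (e : nat) (Fp : K -> {poly K}) :=
  (forall x, polyfun e (fun t => (Fp t).[x])) /\ polyfun e (fun t => (Fp t)`_m).

Lemma root_prod_path e d (L : {poly K}) Fp : (size L <= d.+1)%N -> polypath e Fp ->
  polyfun (e * d) (fun t => root_prod d L (Fp t)).
Proof.
move=> sL [H1 H2]; rewrite /root_prod; case: closed_field_poly_normal => r /= EL.
have [L0|L0] := eqVneq L 0.
  apply: (polyfun_ext _ (polyfun_const _ 0)) => t.
  by rewrite L0 lead_coef0 expr0n (gtn_eqF m_gt0) mul0r mulr0.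
have sr : size r = (size L).-1.
  by rewrite EL size_scale ?lead_coef_eq0 // size_prod_XsubC.
have -> : (e * d = e * (d - (size L).-1) + (0 + e * size r))%N.
  rewrite add0n -mulnDr sr subnK // -ltnS (leq_trans _ sL) // prednK // size_poly_gt0 //.
apply: polyfunM; first exact: polyfunX.
apply: polyfunM; first exact: polyfun_const.
apply: polyfun_prod => x; rewrite -[e]add0n; apply: polyfunM => //.
exact: polyfun_const.
Qed.

(** A polynomial in [m] variables of degree at most [d j] in the j-th one, kept as an explicit sum
    of products so that permuting the variables produces permanents. *)
Definition separable_fun (d : 'I_m -> nat) (T : ('I_m -> K) -> K) :=
  exists (I : finType) (q : I -> 'I_m -> {poly K}),
    (forall k j, (size (q k j) <= (d j).+1)%N) /\
    (forall s, T s = \sum_k \prod_j (q k j).[s j]).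

Lemma separable_fun1 : separable_fun (fun=> 0%N) (fun=> 1).
Proof.
exists unit, (fun _ _ => 1); split=> [k j|s]; first by rewrite size_poly1.
by rewrite (big_pred1 tt) => [|[]] //; rewrite big1 // => j _; rewrite hornerC.
Qed.

Lemma separable_funM d1 d2 T1 T2 : separable_fun d1 T1 -> separable_fun d2 T2 ->
  separable_fun (fun j => d1 j + d2 j)%N (fun s => T1 s * T2 s).
Proof.
move=> [I [p [sp Hp]]] [J [q [sq Hq]]].
exists (I * J)%type, (fun k j => p k.1 j * q k.2 j); split=> [k j|s].
  rewrite (leq_trans (size_polyMleq _ _)) // -subn1 leq_subLR add1n.
  by rewrite (leq_trans (leq_add (sp _ _) (sq _ _))) // addSn addnS.
rewrite Hp Hq mulr_suml -(pair_bigA _ (fun k l => \prod_j (p k j * q l j).[s j])) /=.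
apply: eq_bigr => k _; rewrite mulr_sumr; apply: eq_bigr => l _.
by rewrite -big_split /=; apply: eq_bigr => j _; rewrite hornerM.
Qed.

Lemma separable_fun_ext d1 d2 T1 T2 : d1 =1 d2 -> T1 =1 T2 ->
  separable_fun d1 T1 -> separable_fun d2 T2.
Proof.
move=> Ed ET [I [q [sq Hq]]]; exists I, q; split=> [k j|s]; first by rewrite -Ed.
by rewrite -ET.
Qed.

Lemma separable_fun_prod (A : Type) (r : seq A) (P : pred A) d T :
  (forall a, P a -> separable_fun (d a) (T a)) ->
  separable_fun (fun j => \sum_(a <- r | P a) d a j)%N
    (fun s => \prod_(a <- r | P a) T a s).
Proof.
move=> H; elim: r => [|a r IH].
  by apply: (separable_fun_ext _ _ separable_fun1) => ?; rewrite big_nil.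
case Pa: (P a).
  by apply: (separable_fun_ext _ _ (separable_funM (H a Pa) IH)) => ?; rewrite big_cons Pa.
by apply: (separable_fun_ext _ _ IH) => ?; rewrite big_cons Pa.
Qed.

(** Averaging [T] over permutations turns each product into a permanent. Ryser's formula rewrites it
    through products of values of one polynomial [L] at all roots, and these, multiplied by the
    power [d] of the leading coefficient, are [root_prod d L]. *)
Lemma symmetric_polynomial d (T : ('I_m -> K) -> K) :
  separable_fun (fun=> d) T -> (forall (g : 'S_m) s, T (s \o g) = T s) ->
  exists N : {poly K} -> K,
    (forall e Fp, polypath e Fp -> polyfun (e * d) (N \o Fp)) /\
    (forall (F : {poly K}) (s : 'I_m -> K), F = F`_m *: \prod_i ('X - (s i)%:P) -> F`_m != 0 ->
       N F = F`_m ^+ d * T s).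
Proof.
move=> [I [q [sq Hq]]] symT.
pose L k (g : {ffun 'I_m -> bool}) := \sum_(j | g j) q k j.
have sL k g : (size (L k g) <= d.+1)%N.
  apply: (big_ind (fun p : {poly K} => (size p <= d.+1)%N)) => [|x y hx hy|j _] //.
    by rewrite size_poly0.
  by rewrite (leq_trans (size_polyD _ _)) // geq_max hx hy.
pose N (F : {poly K}) := \sum_k \sum_(g : {ffun 'I_m -> bool})
  ((m`!%:R)^-1 * \prod_(j < m) (if g j then 1 else -1)) * root_prod d (L k g) F.
exists N; split=> [e Fp HF|F s EF F0].
  apply: polyfun_sum => k; apply: polyfun_sum => g; rewrite -[(e * d)%N]add0n.
  by apply: polyfunM; [exact: polyfun_const | exact: root_prod_path].
have fact0 : (m`!%:R : K) != 0 by rewrite pnatr_eq0 -lt0n fact_gt0.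
have -> : T s = (m`!%:R)^-1 * \sum_(g : 'S_m) T (s \o g).
  under eq_bigr => g _ do rewrite symT.
  by rewrite sumr_const card_Sn -[T s *+ _]mulr_natl mulKf.
have -> : \sum_(g : 'S_m) T (s \o g) = \sum_k \sum_(g : 'S_m) \prod_j (q k j).[s (g j)].
  by under eq_bigr => g _ do rewrite Hq; rewrite exchange_big.
rewrite /N !mulr_sumr; apply: eq_bigr => k _.
have -> : \sum_(g : 'S_m) \prod_j (q k j).[s (g j)] =
    \sum_(g : 'S_m) \prod_i (q k (g i)).[s i].
  rewrite (reindex_inj invg_inj) /=; apply: eq_bigr => g _.
  by rewrite (reindex_inj (@perm_inj _ g)) /=; apply: eq_bigr => i _; rewrite permK.
rewrite (ryser (fun i j => (q k j).[s i])) !mulr_sumr; apply: eq_bigr => g _.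
rewrite (root_prodE (sL k g) EF F0) mulrCA -!mulrA; congr (_ * (_ * (_ * _))).
by apply: eq_bigr => i _; rewrite /L horner_sum.
Qed.

End SymmetricFunctions.

Section PairProducts.
Variables (K : numClosedFieldType) (m : nat).
Hypothesis m_gt0 : (0 < m)%N.
Variables (e : nat) (ker : K -> K -> K).
Hypothesis ker_sym : forall u v, ker u v = ker v u.
Hypothesis ker_sep : exists (I : finType) (p q : I -> {poly K}),
  (forall k, (size (p k) <= e.+1)%N /\ (size (q k) <= e.+1)%N) /\
  (forall u v, ker u v = \sum_k (p k).[u] * (q k).[v]).

Definition pair_prod (s : 'I_m -> K) :=
  \prod_(i < m) \prod_(j < m | (i < j)%N) ker (s i) (s j).

Lemma pair_prod_perm (g : 'S_m) s : pair_prod (s \o g) = pair_prod s.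
Proof.
(* The image of an ordered pair of indices, sorted again; the symmetry of [ker] makes the sorting
   harmless. *)
pose h (g : 'S_m) (p : 'I_m * 'I_m) :=
  if (g p.1 < g p.2)%N then (g p.1, g p.2) else (g p.2, g p.1).
have hK (f : 'S_m) (p : 'I_m * 'I_m) : (p.1 < p.2)%N -> h f^-1%g (h f p) = p.
  case: p => a b /= ab; rewrite /h /=.
  case: (ltnP (f a) (f b)) => _ /=; rewrite !permK ?ab //.
  by rewrite ltnNge (ltnW ab).
have hlt (f : 'S_m) (p : 'I_m * 'I_m) : (p.1 < p.2)%N -> ((h f p).1 < (h f p).2)%N.
  case: p => a b /= ab; rewrite /h /=; case: (ltngtP (f a) (f b)) => //= E.
  have ba := perm_inj (ord_inj E).
  by rewrite ba ltnn in ab.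
rewrite /pair_prod !pair_big_dep /=.
rewrite [RHS](reindex_onto (h g) (h g^-1%g)) /=; last first.
  by move=> p p12; rewrite -{1}[g]invgK hK.
apply: eq_big => [p|p p12].
  apply/idP/andP => [p12|[p12 /eqP <-]]; last exact: hlt.
  by rewrite hlt // hK.
by rewrite /h; case: ifP => _ /=; rewrite // ker_sym.
Qed.

(** Each variable occurs in [m - 1] of the pairs, with degree at most [e] in each. *)
Lemma pair_prod_separable : separable_fun (fun _ : 'I_m => e * m.-1)%N pair_prod.
Proof.
have [I [p [q [spq Hpq]]]] := ker_sep.
pose d (a : 'I_m * 'I_m) (k : 'I_m) := (e * ((k == a.1) + (k == a.2)))%N.
have H (a : 'I_m * 'I_m) : (a.1 < a.2)%N -> separable_fun (d a) (fun s => ker (s a.1) (s a.2)).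
  case: a => i j /= ij; have nij : i != j by rewrite neq_ltn ij.
  exists I, (fun k l => if l == i then p k else if l == j then q k else 1).
  split=> [k l|s].
    rewrite /d /=; case: eqP => [->|_].
      by rewrite (negbTE nij) addn0 muln1; case: (spq k).
    by case: eqP => _; [rewrite add0n muln1; case: (spq k) | rewrite size_poly1].
  rewrite Hpq; apply: eq_bigr => k _.
  rewrite (bigD1 i) //= eqxx (bigD1 j) ?(eq_sym j i) //= (negbTE nij) eqxx.
  rewrite big1 ?mulr1 // => l /andP[/negbTE -> /negbTE ->].
  by rewrite hornerC.
have Hp := separable_fun_prod (index_enum _) H.
apply: (separable_fun_ext _ _ Hp) => [k|s]; last by rewrite /pair_prod pair_big_dep.
rewrite -big_distrr /=; congr (_ * _)%N.
rewrite -(pair_big_dep xpredT (fun i j : 'I_m => (i < j)%N) (fun i j => (k == i) + (k == j))%N) /=.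
under eq_bigr => i _ do rewrite big_split /=.
rewrite big_split /=.
have -> : (\sum_(i < m) \sum_(j < m | (i < j)%N) (k == i) = \sum_(j < m) (k < j))%N.
  rewrite (bigD1 k) //= [X in (_ + X)%N]big1 ?addn0 => [|i /negbTE ki].
    by rewrite big_mkcond; apply: eq_bigr => j _; rewrite eqxx; case: ltnP.
  by rewrite big1 // => j _; rewrite eq_sym ki.
have -> : (\sum_(i < m) \sum_(j < m | (i < j)%N) (k == j) = \sum_(j < m) (j < k))%N.
  apply: eq_bigr => i _; rewrite big_mkcond (bigD1 k) //= eqxx.
  rewrite big1 ?addn0 => [|j /negbTE jk]; first by case: ltnP.
  by rewrite eq_sym jk; case: ifP.
rewrite -big_split /= (bigD1 k) //= ltnn addn0 add0n.
rewrite (eq_bigr (fun=> 1%N)) => [|j jk]; last first.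
  by move: jk; rewrite neq_ltn /= addnC; case: ltngtP.
rewrite sum1_card; have := cardC1 k.
by rewrite card_ord => <-; apply: eq_card => x; rewrite !inE.
Qed.

Lemma pair_prod_poly : exists N : {poly K} -> K,
    (forall f Fp, polypath m f Fp -> polyfun (f * (e * m.-1)) (N \o Fp)) /\
    (forall (F : {poly K}) (s : 'I_m -> K), F = F`_m *: \prod_i ('X - (s i)%:P) -> F`_m != 0 ->
       N F = F`_m ^+ (e * m.-1) * pair_prod s).
Proof. exact: (symmetric_polynomial m_gt0 pair_prod_separable pair_prod_perm). Qed.

End PairProducts.

(** * Extension to a vanishing leading coefficient *)

Section Extension.
Variable R : realType.
Local Notation C := R[i].
Local Notation toC := (@toC R).

Lemma interp0E D (p : {poly R}) g : (size p <= D.+1)%N ->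
  (forall k, g k.+1%:R = p.[k.+1%:R]) -> interp0 D g = p.[0].
Proof.
move=> sp Hg; pose c (k l : 'I_D.+1) : R := k.+1%:R - l.+1%:R.
have c0 k l : l != k -> c k l != 0.
  move=> lk; rewrite subr_eq0 eqr_nat eqSS; apply: contra lk => /eqP E.
  by apply/eqP/ord_inj.
pose L := \sum_(k < D.+1) g k.+1%:R *:
    \prod_(l < D.+1 | l != k) ((c k l)^-1 *: ('X - (l.+1%:R)%:P)).
have sL : (size L <= D.+1)%N.
  apply: (big_ind (fun p : {poly R} => (size p <= D.+1)%N)) => [|x y hx hy|k _].
  - by rewrite size_poly0.
  - by rewrite (leq_trans (size_polyD _ _)) // geq_max hx hy.
  rewrite (leq_trans (size_scale_leq _ _)) //.
  rewrite scaler_prod (leq_trans (size_scale_leq _ _)) //.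
  rewrite -big_filter size_prod_XsubC ltnS size_filter.
  rewrite -sum1_count sum1_card.
  have := cardC1 k; rewrite card_ord /= => Ek; rewrite -[X in (_ <= X)%N]Ek.
  by rewrite leq_eqVlt; apply/orP; left; apply/eqP/eq_card => x; rewrite !inE.
suff -> : p = L.
  rewrite horner_sum; apply: eq_bigr => k _; rewrite hornerZ horner_prod; congr (_ * _).
  by apply: eq_bigr => l _; rewrite hornerZ hornerXsubC mulrC.
apply/eqP; rewrite -subr_eq0; apply/eqP.
apply: (@roots_geq_poly_eq0 _ _ [seq k.+1%:R : R | k <- iota 0 D.+1]).
- apply/allP => x /mapP[k]; rewrite mem_iota add0n => /andP[_ kD] ->.
  rewrite rootE hornerD hornerN horner_sum (bigD1 (Ordinal kD)) //=.
  rewrite [X in _ - (_ + X)]big1 ?addr0 => [|l lk].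
    rewrite hornerZ horner_prod big1 ?mulr1 ?Hg ?subrr // => l lk.
    by rewrite hornerZ hornerXsubC mulVf // c0.
  rewrite hornerZ horner_prod (bigD1 (Ordinal kD)) 1?eq_sym //=.
  by rewrite hornerZ hornerXsubC subrr mulr0 mul0r mulr0.
- rewrite map_inj_uniq ?iota_uniq // => a b /eqP.
  by rewrite eqr_nat eqSS => /eqP.
- rewrite size_map size_iota (leq_trans (size_polyD _ _)) // geq_max sp size_polyN.
  by rewrite sL.
Qed.

Lemma toC_map (p : {poly R}) : map_poly toC p = map_poly (real_complex R) p.
Proof. by apply: eq_map_poly. Qed.

Lemma coef_trunc m (p : {poly R}) k : (trunc m p)`_k = if (k < m.+1)%N then p`_k else 0.
Proof. by rewrite coef_poly. Qed.

Lemma coef_setlead m (p : {poly R}) t k :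
  (setlead m p t)`_k = if (k < m)%N then p`_k else if k == m then t else 0.
Proof.
rewrite /setlead coefD coef_trunc coefZ coefXn ltnS leq_eqVlt.
have [->|km] := eqVneq k m; first by rewrite ltnn mulr1 addrC subrK.
by rewrite mulr0 addr0.
Qed.

Lemma size_setlead m (p : {poly R}) t : t != 0 -> size (setlead m p t) = m.+1.
Proof.
move=> t0; apply/eqP; rewrite eqn_leq; apply/andP; split.
  apply/leq_sizeP => j mj; rewrite coef_setlead.
  by rewrite ltnNge (ltnW mj) /= gtn_eqF.
by rewrite ltnNge; apply/negP => /leq_sizeP /(_ m (leqnn m)) /eqP; rewrite coef_setlead ltnn eqxx (negbTE t0).
Qed.

Lemma croots_setlead m (p : {poly R}) t (P := map_poly (real_complex R) (setlead m p t)) :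
  t != 0 -> P`_m = toC t /\ P = P`_m *: \prod_(i < m) ('X - ((croots (setlead m p t))`_i)%:P).
Proof.
move=> t0; have Pm : P`_m = toC t by rewrite coef_map coef_setlead ltnn eqxx.
split=> //; have sP : size P = m.+1 by rewrite size_map_poly size_setlead.
rewrite /croots; case: closed_field_poly_normal => r /=; rewrite toC_map -/P => Er.
have P0 : P != 0 by rewrite -size_poly_eq0 sP.
have sr : size r = m.
  by apply: succn_inj; rewrite -sP Er size_scale ?lead_coef_eq0 // size_prod_XsubC.
rewrite {1}Er {1}lead_coefE -/P sP /=; congr (_ *: _).
by rewrite (big_nth 0) sr big_mkord.
Qed.

(** The root expression agrees with the polynomial function [N] when the leading coefficient is
    nonzero. As [N] has degree at most [D] along the line on which only that coefficient varies,
    interpolation at [D + 1] nodes recovers its value at 0. *)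
Lemma polyext_root m e (ker : C -> C -> C) D : (0 < m)%N -> (D = e * m.-1)%N ->
  (forall u v, ker u v = ker v u) ->
  (exists (I : finType) (p q : I -> {poly C}),
    (forall k, (size (p k) <= e.+1)%N /\ (size (q k) <= e.+1)%N) /\
    (forall u v, ker u v = \sum_k (p k).[u] * (q k).[v])) ->
  exists N : {poly C} -> C,
    [/\ (forall f Fp, polypath m f Fp -> exists e', polyfun e' (N \o Fp)),
       (forall (F : {poly C}) (s : 'I_m -> C), F = F`_m *: \prod_i ('X - (s i)%:P) ->
          F`_m != 0 -> N F = F`_m ^+ D * pair_prod ker s) &
       forall p : {poly R}, polyext D (fun t => let s := croots (setlead m p t) in
          complex.Re (toC t ^+ D * \prod_(i < m) \prod_(j < m | (i < j)%N) ker s`_i s`_j)) p`_m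
        = complex.Re (N (map_poly (real_complex R) (trunc m p)))].
Proof.
move=> m0 -> sym sep; have [N [N1 N2]] := pair_prod_poly m0 sym sep.
exists N; split=> [f Fp HF|//|p]; first by eexists; exact: N1 HF.
pose G t := map_poly (real_complex R) (setlead m p t).
have NG t : t != 0 -> N (G t) = toC t ^+ (e * m.-1) *
    \prod_(i < m) \prod_(j < m | (i < j)%N) ker (croots (setlead m p t))`_i (croots (setlead m p t))`_j.
  move=> t0; have [Gm EG] := @croots_setlead m p t t0.
  by rewrite (N2 _ _ EG) ?Gm //; apply: contra t0 => /eqP [->].
have G0 : G p`_m = map_poly (real_complex R) (trunc m p).
  by congr map_poly; rewrite /setlead subrr scale0r addr0.
rewrite /polyext; case: eqP => [pm|/eqP pm] /=; last by rewrite -NG // G0.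
pose Fp (t : C) := map_poly (real_complex R) (trunc m p) + t *: 'X^m.
have FpE t : Fp (toC t) = G t.
  apply/polyP => k; rewrite /Fp coefD coefZ coefXn !coef_map coef_trunc coef_setlead.
  rewrite ltnS leq_eqVlt; have [->|km] := eqVneq k m.
    by rewrite /= pm ltnn mulr1 add0r.
  by rewrite /= mulr0 addr0.
have [nu [snu Hnu]] : polyfun (1 * (e * m.-1)) (N \o Fp).
  have pc (a b : C) : polyfun 1 (fun t => a + t * b).
    exists (a%:P + b *: 'X); split=> [|t].
      rewrite (leq_trans (size_polyD _ _)) // geq_max (leq_trans (size_polyC_leq1 _)) //=.
      by rewrite (leq_trans (size_scale_leq _ _)) // size_polyX.
    by rewrite hornerD hornerC hornerZ hornerX mulrC.
  apply: N1; split=> [x|].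
    by apply: (polyfun_ext _ (pc _ _)) => t; rewrite hornerD hornerZ; reflexivity.
  by apply: (polyfun_ext _ (pc _ _)) => t; rewrite coefD coefZ; reflexivity.
(* The nodes are real, so taking real parts of the coefficients commutes with evaluation there. *)
pose rho := \poly_(k < (e * m.-1).+1) complex.Re nu`_k.
have Erho t : complex.Re nu.[toC t] = rho.[t].
  rewrite (horner_coef_wide _ snu) mul1n (horner_coef_wide _ (size_poly _ _)).
  rewrite raddf_sum /=; apply: eq_bigr => k _; rewrite coef_poly ltn_ord.
  have -> : toC t ^+ k = (t ^+ k)%:C%C by rewrite rmorphXn.
  by case: (nu`_k) => a b /=; rewrite mulr0 subr0.
rewrite (@interp0E _ rho); last 2 first.
- exact: size_poly.
- move=> k; have k0 : k.+1%:R != 0 :> R by rewrite pnatr_eq0.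
  by rewrite -(NG _ k0) -FpE -Erho -Hnu.
by rewrite -Erho -Hnu /= FpE -pm G0.
Qed.

End Extension.

(** * Vanishing on degenerate polynomials *)

Section Vanishing.
Variables (K : numClosedFieldType).

Variables (m : nat) (ker : K -> K -> K) (D : nat) (N : {poly K} -> K).
Hypothesis m_gt1 : (1 < m)%N.
Hypothesis N_path : forall f Fp, polypath m f Fp -> exists e, polyfun e (N \o Fp).
Hypothesis N_root : forall (F : {poly K}) (s : 'I_m -> K),
  F = F`_m *: \prod_i ('X - (s i)%:P) -> F`_m != 0 -> N F = F`_m ^+ D * pair_prod ker s.

(** Where the leading coefficient [a0(t)] is nonzero, [N] is a product over pairs of roots with the
    factor [ker a b = 0]. So [a0] times the polynomial of [N] along the path vanishes everywhere,
    and [N] vanishes even where [a0(t) = 0]. *)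
Lemma vanish_path f Fp (a0 : {poly K}) : polypath m f Fp -> a0 != 0 ->
  (forall t, (Fp t)`_m = a0.[t]) ->
  (forall t, a0.[t] != 0 -> exists a b F1,
     [/\ Fp t = ('X - a%:P) * ('X - b%:P) * F1, (size F1 <= m.-1)%N & ker a b = 0]) ->
  forall t, N (Fp t) = 0.
Proof.
move=> HF a00 Ha0 HN; have [e [nu [_ Hnu]]] := N_path HF.
suff nu0 : nu = 0 by move=> t; have := Hnu t; rewrite /= => ->; rewrite nu0 horner0.
apply/eqP; rewrite -(mulIr_eq0 _ (mulIf a00)); apply/eqP/poly0_horner => t.
rewrite hornerM; have [->|at0] := eqVneq a0.[t] 0; first by rewrite mulr0.
have [a [b [F1 [EF sF1 kab]]]] := HN t at0.
have [r Er] := closed_field_poly_normal F1.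
have cm : (Fp t)`_m = lead_coef F1 /\ size F1 = m.-1.
  have F10 : F1 != 0.
    by apply: contra at0 => /eqP E; rewrite -Ha0 EF E mulr0 coef0.
  have sF : size (Fp t) = (size F1).+2.
    by rewrite EF !size_mul ?mulf_neq0 ?polyXsubC_eq0 // !size_XsubC.
  have s1 : size F1 = m.-1.
    apply/eqP; rewrite eqn_leq sF1 /= leqNgt; apply/negP => lt.
    move: at0; rewrite -Ha0 nth_default ?eqxx // sF.
    by move: lt; rewrite -(ltn_add2r 1) !addn1 prednK // ltnW.
  split=> //; have -> : (Fp t)`_m = lead_coef (Fp t).
    by rewrite lead_coefE sF s1 /= prednK // ltnW.
  by rewrite EF !lead_coefM !lead_coefXsubC !mul1r.
have [cm1 cm2] := cm.
have sr : size r = m.-2.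
  apply: succn_inj; rewrite prednK -?cm2; last by rewrite cm2 -ltnS prednK // ltnW.
  rewrite {1}Er size_scale ?size_prod_XsubC // lead_coef_eq0.
  by rewrite -size_poly_eq0 cm2 -lt0n -ltnS prednK // ltnW.
pose s (i : 'I_m) := (a :: b :: r)`_i.
have Es : Fp t = (Fp t)`_m *: \prod_i ('X - (s i)%:P).
  have -> : \prod_(i < m) ('X - (s i)%:P) = \prod_(x <- a :: b :: r) ('X - x%:P).
    have Em : size (a :: b :: r) = m.
      by rewrite /= sr prednK -1?ltnS prednK // ltnW.
    by rewrite (big_nth 0) Em big_mkord.
  by rewrite !big_cons cm1 {1}EF {1}Er -!scalerAr mulrA.
have := Hnu t; rewrite /= => <-; rewrite (N_root Es) ?Ha0 //.
have m0 : (0 < m)%N by rewrite ltnW.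
rewrite /pair_prod (bigD1 (Ordinal m0)) //= (bigD1 (Ordinal m_gt1)) //=.
by rewrite /s /= kab !(mul0r, mulr0).
Qed.

Lemma polyfun_affine (a b c : K) : polyfun 1 (fun t => a * (b + t * c)).
Proof.
exists ((a * b)%:P + (a * c) *: 'X); split=> [|t].
  rewrite (leq_trans (size_polyD _ _)) // geq_max (leq_trans (size_polyC_leq1 _)) //=.
  by rewrite (leq_trans (size_scale_leq _ _)) // size_polyX.
by rewrite hornerD hornerC hornerZ hornerX; ring.
Qed.

(** Adding [t X^(m-2)] to the cofactor restores degree [m] for generic [t] and keeps the roots [a]
    and [b]. *)
Lemma vanish_root a b (F1 : {poly K}) : (size F1 <= m.-1)%N -> ker a b = 0 ->
  N (('X - a%:P) * ('X - b%:P) * F1) = 0.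
Proof.
move=> sF1 kab.
pose G t := F1 + t *: 'X^(m.-2).
pose Fp t := ('X - a%:P) * ('X - b%:P) * G t.
have m2 : m.-2.+1 = m.-1 by rewrite prednK // -ltnS prednK // ltnW.
have sG t : (size (G t) <= m.-1)%N.
  rewrite (leq_trans (size_polyD _ _)) // geq_max sF1 /=.
  by rewrite (leq_trans (size_scale_leq _ _)) // size_polyXn m2.
have Fpm t : (Fp t)`_m = F1`_m.-2 + t.
  have -> : m = m.-2.+2 by rewrite m2 prednK // ltnW.
  rewrite /Fp -mulrA mulrBl coefB coefXM /= coefCM mulrBl coefB coefXM /= coefCM.
  rewrite [(G t)`_m.-2.+1]nth_default ?mulr0 ?subr0; last by rewrite m2 sG.
  rewrite coefB coefXM /= coefCM ![(G t)`__.+1]nth_default ?mulr0 ?subr0 ?m2 ?sG //; last first.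
    by rewrite (leq_trans (sG t)) // -m2.
  by rewrite mulr0 subr0 /G coefD coefZ coefXn eqxx mulr1.
have HF : polypath m 1 Fp.
  split=> [x|].
    apply: (@polyfun_ext _ _ _ _ _ (polyfun_affine ((x - a) * (x - b)) F1.[x] (x ^+ m.-2))) => t.
    by rewrite /Fp /G !hornerM !hornerXsubC hornerD hornerZ hornerXn.
  apply: (@polyfun_ext _ _ _ _ _ (polyfun_affine 1 F1`_m.-2 1)) => t.
  by rewrite Fpm mul1r mulr1.
rewrite (_ : _ * F1 = Fp 0); last by rewrite /Fp /G scale0r addr0.
apply: (vanish_path (a0 := (F1`_m.-2)%:P + 'X) HF) => [|t|t _].
- by rewrite addrC -[F1`_m.-2]opprK polyCN polyXsubC_eq0.
- by rewrite Fpm hornerD hornerC hornerX.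
- by exists a, b, (G t).
Qed.

(** Degree at most [m - 2] means a double root at infinity. The path [(1 - t X)^2 (F + t X^(m-2))]
    moves it to the finite double root [1 / t]. *)
Lemma vanish_infty (F : {poly K}) : (size F <= m.-1)%N -> (forall u, ker u u = 0) -> N F = 0.
Proof.
move=> sF kuu; pose G t := F + t *: 'X^(m.-2).
pose Fp t := (1 - t *: 'X) ^+ 2 * G t.
have m2 : m.-2.+1 = m.-1 by rewrite prednK // -ltnS prednK // ltnW.
have sG t : (size (G t) <= m.-1)%N.
  rewrite (leq_trans (size_polyD _ _)) // geq_max sF /=.
  by rewrite (leq_trans (size_scale_leq _ _)) // size_polyXn m2.
have Fpm t : (Fp t)`_m = t ^+ 2 * (F`_m.-2 + t).
  have -> : m = m.-2.+2 by rewrite m2 prednK // ltnW.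
  have -> : Fp t = G t - (t *+ 2) *: ('X * G t) + (t ^+ 2) *: ('X * ('X * G t)).
    by rewrite /Fp -!mul_polyC rmorphMn rmorphXn /=; ring.
  rewrite coefD coefB !coefZ !coefXM /=.
  rewrite [(G t)`_m.-2.+1]nth_default ?m2 ?sG //.
  rewrite [(G t)`_m.-1.+1]nth_default; last by rewrite (leq_trans (sG t)).
  by rewrite mulr0 subr0 add0r /G coefD coefZ coefXn eqxx mulr1.
have HF : polypath m 3 Fp.
  split=> [x|].
    apply: (@polyfun_ext _ _ (fun t => (1 * (1 + t * - x)) ^+ 2 * (1 * (F.[x] + t * (x ^+ m.-2))))).
      by move=> t; rewrite /Fp /G !hornerM !hornerD !hornerN !hornerZ !hornerXn hornerX hornerC; ring.
    by apply: (@polyfunM _ (1 * 2) 1); [apply: polyfunX|]; exact: polyfun_affine.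
  apply: (@polyfun_ext _ _ (fun t => (1 * (0 + t * 1)) ^+ 2 * (1 * (F`_m.-2 + t * 1)))).
    by move=> t; rewrite Fpm; ring.
  by apply: (@polyfunM _ (1 * 2) 1); [apply: polyfunX|]; exact: polyfun_affine.
rewrite (_ : F = Fp 0); last by rewrite /Fp /G !scale0r subr0 expr1n mul1r addr0.
apply: (vanish_path (a0 := 'X ^+ 2 * ((F`_m.-2)%:P + 'X)) HF) => [|t|t].
- rewrite mulf_neq0 ?expf_neq0 ?polyX_eq0 //.
  by rewrite addrC -[F`_m.-2]opprK polyCN polyXsubC_eq0.
- by rewrite Fpm hornerM hornerXn hornerD hornerC hornerX.
rewrite hornerM hornerXn mulf_eq0 negb_or => /andP[t20 _].
have t0 : t != 0 by apply: contra t20 => /eqP ->; rewrite expr0n.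
exists t^-1, t^-1, (t ^+ 2 *: G t); split; last exact: kuu.
  have -> : Fp t = (t%:P * ('X - (t^-1)%:P)) ^+ 2 * G t.
    rewrite mulrBr -polyCM divff // /Fp -mul_polyC; congr (_ * _); ring.
  by rewrite -mul_polyC rmorphXn /=; ring.
by rewrite (leq_trans (size_scale_leq _ _)).
Qed.

End Vanishing.

(** Explicit division of [g(u) h(v) - g(v) h(u)] by [u - v]: the terms [(a, b)] and [(b, a)] combine
    into multiples of [u^a v^b - u^b v^a], a geometric sum times [u - v]. *)
Lemma bezout_sum (A : comNzRingType) (g h : nat -> A) n (u v : A) :
  (u - v) * (\sum_(a < n) \sum_(b < n | (b < a)%N) (g a * h b - g b * h a) *
     \sum_(k < (a - b)%N) u ^+ (b + k) * v ^+ (a.-1 - k)) =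
  (\sum_(a < n) g a * u ^+ a) * (\sum_(b < n) h b * v ^+ b) -
  (\sum_(a < n) g a * v ^+ a) * (\sum_(b < n) h b * u ^+ b).
Proof.
pose f (a b : nat) := u ^+ a * v ^+ b - u ^+ b * v ^+ a.
have Ef (a b : nat) : (b < a)%N ->
    (u - v) * (\sum_(k < (a - b)%N) u ^+ (b + k) * v ^+ (a.-1 - k)) = f a b.
  move=> ba; have := subrXX v u (a - b)%N.
  set S := \sum_(k < _) _; set S' := \sum_(k < _) _ => E.
  have ES : S' = (u * v) ^+ b * S.
    rewrite /S /S' mulr_sumr; apply: eq_bigr => k _.
    rewrite exprMn exprD -!mulrA; congr (_ * _).
    rewrite [RHS]mulrA -exprD [RHS]mulrC; congr (_ * v ^+ _).
    by have := ltn_ord k; move: (nat_of_ord k) => k'; lia.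
  rewrite ES mulrCA -opprB mulNr -E opprB /f exprMn.
  have -> : u ^+ a = u ^+ b * u ^+ (a - b) by rewrite -exprD subnKC // ltnW.
  have -> : v ^+ a = v ^+ b * v ^+ (a - b) by rewrite -exprD subnKC // ltnW.
  ring.
have -> : (\sum_(a < n) g a * u ^+ a) * (\sum_(b < n) h b * v ^+ b) -
  (\sum_(a < n) g a * v ^+ a) * (\sum_(b < n) h b * u ^+ b) =
  \sum_(a < n) \sum_(b < n) g a * h b * f a b.
  rewrite !mulr_suml -sumrB; apply: eq_bigr => a _.
  by rewrite !mulr_sumr -sumrB; apply: eq_bigr => b _; rewrite /f; ring.
have -> : \sum_(a < n) \sum_(b < n) g a * h b * f a b =
  \sum_(a < n) \sum_(b < n | (b < a)%N) g a * h b * f a b +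
  \sum_(a < n) \sum_(b < n | (a < b)%N) g a * h b * f a b.
  rewrite -big_split; apply: eq_bigr => a _ /=.
  rewrite (bigID (fun b : 'I_n => (b < a)%N)) /=; congr (_ + _).
  rewrite (bigID (fun b : 'I_n => (a < b)%N)) /= [X in _ + X]big1 ?addr0.
    by apply: eq_bigl => b; case: ltngtP.
  move=> b; case: ltngtP => // E _; rewrite /f -(ord_inj E); ring.
rewrite [X in _ = _ + X](exchange_big_dep xpredT) //= -big_split /= mulr_sumr.
apply: eq_bigr => a _; rewrite -big_split /= mulr_sumr; apply: eq_bigr => b ba.
by rewrite mulrCA Ef // /f; ring.
Qed.

(** * Discriminants and [Phi] at degenerate polynomials *)

Section Discriminant.
Variable R : realType.
Local Notation C := R[i].
Local Notation cx := (map_poly (real_complex R)).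

Lemma trunc_id m (p : {poly R}) : (size p <= m.+1)%N -> trunc m p = p.
Proof.
move=> sp; apply/polyP => k; rewrite coef_trunc; case: ltnP => // mk.
by rewrite nth_default // (leq_trans sp).
Qed.

Lemma disc_rootE m : (1 < m)%N -> exists N : {poly C} -> C,
    [/\ (forall f Fp, polypath m f Fp -> exists e', polyfun e' (N \o Fp)),
       (forall (F : {poly C}) (s : 'I_m -> C), F = F`_m *: \prod_i ('X - (s i)%:P) ->
          F`_m != 0 -> N F = F`_m ^+ (2 * m - 2) * pair_prod (fun u v => (u - v) ^+ 2) s) &
       forall p : {poly R}, disc m p = complex.Re (N (cx (trunc m p)))].
Proof.
move=> m1; apply: (@polyext_root R m 2 (fun u v => (u - v) ^+ 2)) => [||u v|].
- exact: ltnW.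
- by lia.
- by rewrite -opprB sqrrN.
(* The three terms of [(u - v)^2 = u^2 - 2 u v + v^2]. *)
exists 'I_3, (fun k : 'I_3 => [:: 'X^2; -2%:R *: 'X; 1]`_k), (fun k : 'I_3 => [:: 1; 'X; 'X^2]`_k).
split=> [[[|[|[|]]]] //= _|u v].
- by rewrite size_polyXn size_poly1.
- by rewrite size_polyX (leq_trans (size_scale_leq _ _)) // size_polyX.
- by rewrite size_polyXn size_poly1.
rewrite !big_ord_recl big_ord0 /= !(hornerXn, hornerX, hornerZ, hornerC); ring.
Qed.

Lemma disc_double m (p : {poly R}) (a : C) (F1 : {poly C}) : (1 < m)%N ->
  (size p <= m.+1)%N -> (size F1 <= m.-1)%N -> (cx p) = ('X - a%:P) ^+ 2 * F1 -> disc m p = 0.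
Proof.
move=> m1 sp sF E; have [N [N1 N2 N3]] := disc_rootE m1.
rewrite N3 trunc_id // E expr2 (vanish_root m1 N1 N2) //.
by rewrite subrr expr0n.
Qed.

Lemma disc_infty m (p : {poly R}) : (1 < m)%N -> (size p <= m.-1)%N -> disc m p = 0.
Proof.
move=> m1 sp; have [N [N1 N2 N3]] := disc_rootE m1.
rewrite N3 trunc_id ?(leq_trans sp) //; last by lia.
rewrite (vanish_infty m1 N1 N2) ?size_map_poly // => u.
by rewrite subrr expr0n.
Qed.

(** The quotient by [u - v] has degree at most [n - 1] in each variable, which is the degree
    required for the factor [a0^((m-1)(n-1))]. *)
Lemma bez_separable n (G H : {poly R}) : (0 < n)%N -> (size G <= n.+1)%N -> (size H <= n.+1)%N ->
  exists (I : finType) (p q : I -> {poly C}),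
    (forall k, (size (p k) <= n.-1.+1)%N /\ (size (q k) <= n.-1.+1)%N) /\
    (forall u v, bez G H u v = \sum_k (p k).[u] * (q k).[v]).
Proof.
move=> n0 sG sH; pose g := (cx G); pose h := (cx H).
have sg : (size g <= n.+1)%N by rewrite size_map_poly.
have sh : (size h <= n.+1)%N by rewrite size_map_poly.
pose c (a b : nat) := g`_a * h`_b - g`_b * h`_a.
pose I := ('I_n.+1 * 'I_n.+1 * 'I_n)%type.
pose ok (i : I) := (i.1.2 < i.1.1)%N && (i.2 < i.1.1 - i.1.2)%N.
pose p (i : I) : {poly C} := if ok i then c i.1.1 i.1.2 *: 'X^(i.1.2 + i.2) else 0.
pose q (i : I) : {poly C} := if ok i then 'X^(i.1.1.-1 - i.2) else 0.
exists I, p, q; split=> [[[a b] k]|u v].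
  rewrite /p /q /=; case: ifP => [/andP[/= ba kab]|_]; last by rewrite size_poly0.
  have an := ltn_ord a.
  rewrite size_polyXn (leq_trans (size_scale_leq _ _)) ?size_polyXn; lia.
have ES (A : comNzRingType) (f : {rmorphism C -> A}) (x y : A) :
   \sum_(i : I) (if ok i then f (c i.1.1 i.1.2) * (x ^+ (i.1.2 + i.2) * y ^+ (i.1.1.-1 - i.2)) else 0) =
   \sum_(a < n.+1) \sum_(b < n.+1 | (b < a)%N) f (c a b) *
     \sum_(k < (a - b)%N) x ^+ (b + k) * y ^+ (a.-1 - k).
  rewrite -(pair_bigA _ (fun (ab : 'I_n.+1 * 'I_n.+1) k => if ok (ab, k) then
     f (c ab.1 ab.2) * (x ^+ (ab.2 + k) * y ^+ (ab.1.-1 - k)) else 0)) /=.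
  rewrite -(pair_bigA _ (fun (a b : 'I_n.+1) => \sum_(k < n) if ok (a, b, k) then
     f (c a b) * (x ^+ (b + k) * y ^+ (a.-1 - k)) else 0)) /=.
  apply: eq_bigr => a _; rewrite [RHS]big_mkcond; apply: eq_bigr => b _ /=.
  rewrite /ok /=; case: ltnP => ba; last by rewrite big1.
  rewrite mulr_sumr -big_mkcond /=.
  have ab : (a - b <= n)%N by have := ltn_ord a; lia.
  by rewrite (big_ord_widen n (fun k => f (c a b) * (x ^+ (b + k) * y ^+ (a.-1 - k))) ab).
pose S := \sum_(a < n.+1) \sum_(b < n.+1 | (b < a)%N) c a b *
     \sum_(k < (a - b)%N) u ^+ (b + k) * v ^+ (a.-1 - k).
have -> : \sum_k (p k).[u] * (q k).[v] = S.
  apply: etrans (ES C idfun u v); apply: eq_bigr => i _; rewrite /p /q; case: ifP => _.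
    by rewrite hornerZ !hornerXn mulrA.
  by rewrite horner0 mul0r.
have hw (r : {poly C}) x : (size r <= n.+1)%N -> r.[x] = \sum_(a < n.+1) r`_a * x ^+ a.
  by move=> sr; rewrite (horner_coef_wide x sr).
have EuS : (u - v) * S = g.[u] * h.[v] - g.[v] * h.[u].
  by rewrite !(hw g) // !(hw h) // -(bezout_sum (fun a => g`_a) (fun b => h`_b)).
have mt (r : {poly R}) : map_poly (@toC R) r = (cx r) by exact: toC_map.
rewrite /bez !mt -/g -/h; case: eqP => [uv|/eqP uv] /=; last first.
  by apply: (mulfI (x := u - v)); rewrite ?subr_eq0 // EuS mulrC divfK // subr_eq0.
subst v.
(* On the diagonal the quotient is found by dividing [g(X) h(u) - g(u) h(X)] by [X - u] and
   differentiating at [u]. *)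
pose P := \sum_(a < n.+1) \sum_(b < n.+1 | (b < a)%N) (c a b)%:P *
     \sum_(k < (a - b)%N) 'X ^+ (b + k) * (u%:P) ^+ (a.-1 - k).
have EP : ('X - u%:P) * P = g * (h.[u])%:P - (g.[u])%:P * h.
  have w (r : {poly C}) : (size r <= n.+1)%N -> r = \sum_(a < n.+1) (r`_a)%:P * 'X ^+ a.
    move=> sr; apply/polyP => k; rewrite coef_sum; under eq_bigr do rewrite coefCM coefXn.
    case: (ltnP k n.+1) => kn.
      rewrite (bigD1 (Ordinal kn)) //= eqxx mulr1 big1 ?addr0 // => i ik.
      case: eqP => [ki|_]; last by rewrite mulr0.
      by case/eqP: ik; apply: ord_inj.
    rewrite nth_default ?(leq_trans sr) // big1 // => i _.
    by rewrite gtn_eqF ?mulr0 // (leq_trans (ltn_ord i)).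
  have := bezout_sum (fun a => (g`_a)%:P) (fun b => (h`_b)%:P) n.+1 'X u%:P.
  rewrite -(w g sg) -(w h sh).
  have -> : \sum_(b < n.+1) (h`_b)%:P * u%:P ^+ b = (h.[u])%:P.
    by rewrite (hw h) // rmorph_sum; apply: eq_bigr => b _; rewrite rmorphM rmorphXn.
  have -> : \sum_(b < n.+1) (g`_b)%:P * u%:P ^+ b = (g.[u])%:P.
    by rewrite (hw g) // rmorph_sum; apply: eq_bigr => b _; rewrite rmorphM rmorphXn.
  move=> <-; congr (_ * _); apply: eq_bigr => a _; apply: eq_bigr => b _; congr (_ * _).
  by rewrite /c rmorphB !rmorphM.
have PuS : P.[u] = S.
  rewrite /P /S horner_sum; apply: eq_bigr => a _; rewrite horner_sum; apply: eq_bigr => b _.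
  rewrite hornerCM horner_sum; congr (_ * _); apply: eq_bigr => k _.
  by rewrite hornerM !horner_exp hornerX hornerC.
have := congr1 (fun r => (r^`()).[u]) EP.
rewrite !derivE !(hornerD, hornerN, hornerM, hornerX, hornerC, hornerMn).
by rewrite -PuS mul1r subrr mul0r addr0 mulr0 addr0 => ->.
Qed.

Lemma Phi_common m n (F G H : {poly R}) (a b : C) (F1 : {poly C}) :
  (1 < m)%N -> (0 < n)%N -> (size F <= m.+1)%N -> (size G <= n.+1)%N -> (size H <= n.+1)%N ->
  (size F1 <= m.-1)%N -> (cx F) = ('X - a%:P) * ('X - b%:P) * F1 -> a != b ->
  (cx G).[a] * (cx H).[b] = (cx G).[b] * (cx H).[a] -> Phi m n F G H = 0.
Proof.
move=> m1 n0 sF sG sH sF1 EF ab E.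
have sym u v : bez G H u v = bez G H v u.
  rewrite /bez eq_sym; case: eqP => [->//|_] /=.
  by rewrite -[u - v]opprB invrN mulrN -mulNr opprB.
have ED : ((m - 1) * (n - 1) = n.-1 * m.-1)%N by rewrite mulnC !subn1.
have [N [N1 N2 N3]] := polyext_root (ltnW m1) ED sym (bez_separable n0 sG sH).
rewrite /Phi /Phi_root !trunc_id // N3 trunc_id // EF (vanish_root m1 N1 N2) //.
rewrite /bez ab; have mt (r : {poly R}) : map_poly (@toC R) r = (cx r) by exact: toC_map.
by rewrite !mt E subrr mul0r.
Qed.

End Discriminant.

(** * Orthogonal equivalence and normal forms of representations *)

Section OrthogonalAction.
Variables (R : realType).
Local Notation P2 := {poly {poly R}}.
Local Notation tup := ('I_3 -> P2).

(* A form in x, y, z is represented by its dehomogenization at y = 1, as a polynomial in z over R[x]. *)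
Definition equivP (P P' : tup) := exists S : 'M[R]_3, S^T *m S = 1%:M /\
  forall j, P' j = \sum_(i < 3) (S i j)%:P *: P i.

Definition act (S : 'M[R]_3) (P : tup) : tup := fun j => \sum_(i < 3) (S i j)%:P *: P i.

Lemma act_mul S S' P j : act S' (act S P) j = act (S *m S') P j.
Proof.
rewrite /act; under eq_bigr => i _ do rewrite scaler_sumr.
rewrite exchange_big; apply: eq_bigr => i _ /=.
under eq_bigr => k _ do rewrite scalerA -polyCM mulrC.
by rewrite -scaler_suml -rmorph_sum /= mxE.
Qed.

Lemma act1 P j : act 1%:M P j = P j.
Proof.
rewrite /act (bigD1 j) //= big1 ?addr0 => [|i /negbTE ij].
  by rewrite mxE eqxx scale1r.
by rewrite mxE ij scale0r.
Qed.

Lemma equivP_act S P P' : S^T *m S = 1%:M -> P' =1 act S P -> equivP P P'.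
Proof. by move=> HS E; exists S; split=> // j; rewrite E. Qed.

Lemma equivP_sym P P' : equivP P P' -> equivP P' P.
Proof.
move=> [S [HS E]]; have HS' : S *m S^T = 1%:M by apply: mulmx1C.
exists S^T; split; first by rewrite trmxK.
move=> j; rewrite -[LHS]act1 -HS' -act_mul; apply: eq_bigr => i _.
by rewrite E.
Qed.

Lemma equivP_trans P P' P'' : equivP P P' -> equivP P' P'' -> equivP P P''.
Proof.
move=> [S [HS E]] [S' [HS' E']]; exists (S *m S'); split.
  by rewrite trmx_mul mulmxA -(mulmxA S'^T) HS mulmx1.
move=> j; rewrite -/(act _ _ _) -act_mul E'; apply: eq_bigr => i _.
by rewrite E.
Qed.

Lemma equivP_sos P P' : equivP P P' -> \sum_i P' i ^+ 2 = \sum_i P i ^+ 2.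
Proof.
move=> [S [HS E]]; have HS' : S *m S^T = 1%:M by apply: mulmx1C.
have -> : \sum_i P' i ^+ 2 = \sum_k \sum_l ((S *m S^T) k l)%:P *: (P k * P l).
  under eq_bigr => j _ do rewrite E expr2 mulr_suml.
  rewrite exchange_big; apply: eq_bigr => k _ /=.
  under eq_bigr => j _ do rewrite mulr_sumr.
  rewrite exchange_big; apply: eq_bigr => l _ /=.
  rewrite mxE rmorph_sum scaler_suml; apply: eq_bigr => j _.
  by rewrite mxE -scalerAl -scalerAr scalerA -polyCM.
rewrite HS'; apply: eq_bigr => k _; rewrite (bigD1 k) //= big1 ?addr0 => [|l lk].
  by rewrite mxE eqxx scale1r expr2.
by rewrite mxE eq_sym (negbTE lk) scale0r.
Qed.

(* The reflection exchanging [e_0] and [n]. *)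
Lemma orthogonal_extend (n : 'I_3 -> R) : \sum_i n i ^+ 2 = 1 ->
  exists S : 'M[R]_3, S^T *m S = 1%:M /\ forall i, S i 0 = n i.
Proof.
move=> n1; pose v i := n i - (i == 0)%:R; pose q := 1 - n 0.
have vq : \sum_i v i ^+ 2 = 2 * q.
  move: n1; rewrite !big_ord_recl !big_ord0 /v /q /= => n1.
  rewrite -[0 in RHS]/(ord0 : 'I_3).
  by move: n1; move: (n _) (n _) (n _) => a b c n1; rewrite !subr0; lra.
have [q0|q0] := eqVneq q 0.
  have nE i : n i = (i == 0)%:R.
    have : \sum_i v i ^+ 2 = 0 by rewrite vq q0 mulr0.
    move=> /eqP; rewrite psumr_eq0 => [|j _]; last exact: sqr_ge0.
    by move=> /allP /(_ i); rewrite mem_index_enum sqrf_eq0 subr_eq0 => /(_ isT)/eqP.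
  exists 1%:M; split; first by rewrite trmx1 mulmx1.
  by move=> i; rewrite mxE nE.
(* Since [|v|^2 = 2 q], this is the reflection [1 - 2 v v^T / |v|^2]. *)
pose S : 'M[R]_3 := \matrix_(i, j) ((i == j)%:R - v i * v j / q).
exists S; split.
  apply/matrixP => i j; rewrite !mxE.
  transitivity (\sum_k ((k == i)%:R * (k == j)%:R - (k == i)%:R * v k * (v j / q)
      - (k == j)%:R * v k * (v i / q) + v k ^+ 2 * (v i * v j / q ^+ 2))).
    by apply: eq_bigr => k _; rewrite !mxE; field.
  have pick (f : 'I_3 -> R) l : \sum_k (k == l)%:R * f k = f l.
    rewrite (bigD1 l) //= eqxx mul1r big1 ?addr0 // => k /negbTE ->.
    by rewrite mul0r.
  rewrite big_split /= !sumrB -!mulr_suml !pick vq; field.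
  exact: q0.
move=> i; rewrite mxE -/(v 0); have -> : v 0 = - q by rewrite /v /q eqxx opprB.
by rewrite mulrN mulNr mulfK // opprK /v addrC subrK.
Qed.

End OrthogonalAction.

Section NormalForms.
Variables (R : realType) (t : R) (p2 p3 p4 : {poly R}).
Local Notation P2 := {poly {poly R}}.
Local Notation tup := ('I_3 -> P2).

Definition quad (a : R) (b c : {poly R}) : P2 := a%:P *: 'X^2 + b *: 'X + c%:P.

Definition form2 (B : P2) :=
  exists a b c, [/\ B = quad a b c, (size b <= 2)%N & (size c <= 3)%N].

Lemma quad_coef a b c : [/\ (quad a b c)`_0 = c, (quad a b c)`_1 = b & (quad a b c)`_2 = a%:P].
Proof.
by rewrite /quad; split; rewrite !coefD !coefZ coefXn coefX coefC /= ?mulr1 ?mulr0 ?add0r ?addr0.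
Qed.

Lemma quad_inj a b c a' b' c' : quad a b c = quad a' b' c' -> [/\ a = a', b = b' & c = c'].
Proof.
have [e0 e1 e2] := quad_coef a b c; have [f0 f1 f2] := quad_coef a' b' c'.
move=> E; rewrite E in e0 e1 e2; split; [apply: (@polyC_inj R) | |]; congruence.
Qed.

Lemma quad_lin s a b c a' b' c' :
  s%:P *: quad a b c + quad a' b' c' = quad (s * a + a') (s *: b + b') (s *: c + c').
Proof. by rewrite /quad -!mul_polyC !(rmorphD, rmorphM) /=; ring. Qed.

Lemma quad_sum (s a : 'I_3 -> R) (b c : 'I_3 -> {poly R}) :
  \sum_(i < 3) (s i)%:P *: quad (a i) (b i) (c i) =
  quad (\sum_(i < 3) s i * a i) (\sum_(i < 3) s i *: b i) (\sum_(i < 3) s i *: c i).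
Proof.
rewrite !big_ord_recl !big_ord0 /=.
have e : 0 = quad 0 0 0 :> P2 by rewrite /quad !polyC0 !scale0r !addr0.
by rewrite [X in _ + (_ + (_ + X))]e !quad_lin.
Qed.

Definition target : P2 := (t ^+ 2)%:P *: 'X^4 + p2 *: 'X^2 + p3 *: 'X + p4%:P.

Definition is_rep (P : tup) := (forall i, form2 (P i)) /\ \sum_i P i ^+ 2 = target.

Lemma equivP_rep P P' : equivP P P' -> is_rep P -> is_rep P'.
Proof.
move=> E [fP sP]; split; last by rewrite (equivP_sos E).
have [abc Habc] := boolp.choice (fun i => fP i).
have [bc Hbc] := boolp.choice Habc; have [c Hc] := boolp.choice Hbc.
have [S [_ ES]] := E; move=> j; rewrite ES.
have -> : \sum_(i < 3) (S i j)%:P *: P i = \sum_(i < 3) (S i j)%:P *: quad (abc i) (bc i) (c i).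
  by apply: eq_bigr => i _; case: (Hc i) => ->.
rewrite quad_sum; do 3 eexists; split; first by [].
  apply: (big_ind (fun p : {poly R} => (size p <= 2)%N)) => [|x y hx hy|i _].
  - by rewrite size_poly0.
  - exact: size_polyD_le.
  - by rewrite (leq_trans (size_scale_leq _ _)) //; case: (Hc i).
apply: (big_ind (fun p : {poly R} => (size p <= 3)%N)) => [|x y hx hy|i _].
- by rewrite size_poly0.
- exact: size_polyD_le.
- by rewrite (leq_trans (size_scale_leq _ _)) //; case: (Hc i).
Qed.

Lemma sum_quad_sqr (a : 'I_3 -> R) (b c : 'I_3 -> {poly R}) :
  \sum_(i < 3) quad (a i) (b i) (c i) ^+ 2 = target <->
  [/\ \sum_i a i ^+ 2 = t ^+ 2, \sum_i a i *: b i = 0,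
      \sum_i (b i ^+ 2 + (a i *+ 2) *: c i) = p2, \sum_i (b i * c i) *+ 2 = p3 &
      \sum_i c i ^+ 2 = p4].
Proof.
have E : \sum_(i < 3) quad (a i) (b i) (c i) ^+ 2 =
    (\sum_i a i ^+ 2)%:P *: 'X^4 + (\sum_i a i *: b i) *+ 2 *: 'X^3 +
    (\sum_i (b i ^+ 2 + (a i *+ 2) *: c i)) *: 'X^2 + (\sum_i (b i * c i) *+ 2) *: 'X +
    (\sum_i c i ^+ 2)%:P.
  rewrite !big_ord_recl !big_ord0 /quad -!mul_polyC.
  by rewrite !(rmorphD, rmorphM, rmorphXn, rmorphMn) /= !polyC0; ring.
have cf (u v w x y : {poly R}) : let q := u *: 'X^4 + v *: 'X^3 + w *: 'X^2 + x *: 'X + y%:P in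
    [/\ q`_4 = u, q`_3 = v, q`_2 = w, q`_1 = x & q`_0 = y].
  by move=> q; split; rewrite /q !coefD !coefZ !coefXn coefX coefC /= ?mulr1 ?mulr0 ?add0r ?addr0.
rewrite E; have [c4 c3 c2 c1 c0] := cf (\sum_i a i ^+ 2)%:P ((\sum_i a i *: b i) *+ 2)
   (\sum_i (b i ^+ 2 + (a i *+ 2) *: c i)) (\sum_i (b i * c i) *+ 2) (\sum_i c i ^+ 2).
have Et : target = (t ^+ 2)%:P *: 'X^4 + (0 : {poly R}) *: 'X^3 + p2 *: 'X^2 + p3 *: 'X + p4%:P.
  by rewrite scale0r addr0.
have [d4 d3 d2 d1 d0] := cf (t ^+ 2)%:P 0 p2 p3 p4; rewrite -Et in d4 d3 d2 d1 d0.
split=> [H|[-> -> -> -> ->]]; last by rewrite mul0rn Et.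
rewrite H in c4 c3 c2 c1 c0; split.
- by apply: (@polyC_inj R); rewrite -c4 d4.
- have : (\sum_i a i *: b i) *+ 2 = 0 by rewrite -c3 d3.
  by move/eqP; rewrite -scaler_nat scale_poly_eq0 pnatr_eq0 => /eqP.
- by rewrite -c2 d2.
- by rewrite -c1 d1.
- by rewrite -c0 d0.
Qed.

Definition normP (g b1 b2 c1 c2 : {poly R}) : tup :=
  fun i => quad (if i == 0 then t else 0) (if i == 0 then 0 else if i == 1 then b1 else b2)
                (if i == 0 then g else if i == 1 then c1 else c2).

Definition normal (g b1 b2 c1 c2 : {poly R}) :=
  [/\ (size b1 <= 2)%N /\ (size b2 <= 2)%N, [/\ size g <= 3, size c1 <= 3 & size c2 <= 3]%N,
      b1 ^+ 2 + b2 ^+ 2 = hpol p2 t g, c1 ^+ 2 + c2 ^+ 2 = kpol p4 g & (b1 * c1 + b2 * c2) *+ 2 = p3].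

Lemma sum3 (V : nmodType) (F : 'I_3 -> V) : \sum_i F i = F 0 + F 1 + F (inord 2).
Proof.
rewrite !big_ord_recl big_ord0 addr0 addrA; congr (F _ + F _ + F _); apply: val_inj => //=.
by rewrite inordK.
Qed.

Lemma ord2 : ((inord 2 : 'I_3) == 0) = false /\ ((inord 2 : 'I_3) == 1) = false.
Proof. by split; apply/negP => /eqP/(congr1 val) /=; rewrite inordK. Qed.

Lemma normal_rep g b1 b2 c1 c2 : normal g b1 b2 c1 c2 -> is_rep (normP g b1 b2 c1 c2).
Proof.
move=> [[sb1 sb2] [sg sc1 sc2] Eh Ek E3]; split=> [i|].
  do 3 eexists; split; first by [].
    by case: (i == 0); case: (i == 1); rewrite ?size_poly0.
  by case: (i == 0); case: (i == 1).
have [o1 o2] := ord2.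
apply/sum_quad_sqr; rewrite !sum3 !o1 !o2 !eqxx /=; split.
- by rewrite expr0n !addr0.
- by rewrite !scale0r scaler0 !addr0.
- have -> : b2 ^+ 2 = hpol p2 t g - b1 ^+ 2 by rewrite -Eh addrC addKr.
  by rewrite /hpol !mul0rn !scale0r expr0n /= !addr0 -mul_polyC; ring.
- by rewrite -E3 mul0r mul0rn add0r mulrnDl.
- have -> : c2 ^+ 2 = kpol p4 g - c1 ^+ 2 by rewrite -Ek addrC addKr.
  by rewrite /kpol; ring.
Qed.

(** It suffices to find a unit vector [n] with [a = t n] and [sum n_i b_i = 0]; an orthogonal matrix
    with first column [n] then gives the normal form. For [t = 1] take [n = a], the coefficient of
    [z^3] giving the relation. *)
Lemma rep_normal P : (t = 0 \/ t = 1) -> is_rep P ->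
  exists g b1 b2 c1 c2, normal g b1 b2 c1 c2 /\ equivP P (normP g b1 b2 c1 c2).
Proof.
move=> t01 [fP sP].
have [a Ha] := boolp.choice (fun i => fP i).
have [b Hb] := boolp.choice Ha; have [c Hc] := boolp.choice Hb.
have EP i : P i = quad (a i) (b i) (c i) by case: (Hc i).
have sb i : (size (b i) <= 2)%N by case: (Hc i).
have sP' : \sum_i quad (a i) (b i) (c i) ^+ 2 = target.
  by rewrite -sP; apply: eq_bigr => i _; rewrite EP.
have [A1 A2 _ _ _] := (sum_quad_sqr a b c).1 sP'.
have [n [n1 na nb]] : exists n : 'I_3 -> R,
    [/\ \sum_i n i ^+ 2 = 1, (forall i, a i = t * n i) & \sum_i n i *: b i = 0].
  case: t01 => t1; last first.
    exists a; split=> //; first by rewrite A1 t1 expr1n.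
    by move=> i; rewrite t1 mul1r.
  (* For [t = 0] all [a i] vanish, and the three polynomials [b i] of degree at most 1 satisfy a
     linear relation. *)
  pose M : 'M[R]_(3, 2) := \matrix_(i, j) (b i)`_j.
  have : kermx M != 0.
    by rewrite kermx_eq0 -row_leq_rank -ltnNge (leq_ltn_trans (rank_leq_col M)).
  move=> /rowV0Pn [Z /sub_kermxP HZ Z0].
  pose q := \sum_i Z 0 i ^+ 2.
  have q0 : 0 < q.
    rewrite lt_def sumr_ge0 ?andbT => [|i _]; last exact: sqr_ge0.
    apply: contra Z0; rewrite psumr_eq0 => [/allP H|i _]; last exact: sqr_ge0.
    apply/eqP/rowP => i; rewrite mxE; apply/eqP; rewrite -sqrf_eq0.
    exact: (H i (mem_index_enum i)).
  have sq : Num.sqrt q ^+ 2 = q by rewrite sqr_sqrtr // ltW.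
  exists (fun i => Z 0 i / Num.sqrt q); split.
  - under eq_bigr => i _ do rewrite expr_div_n sq.
    by rewrite -mulr_suml -/q divff // gt_eqF.
  - move=> i; rewrite t1 mul0r; move: A1; rewrite t1 expr0n /= => /eqP.
    rewrite psumr_eq0 => [/allP /(_ i (mem_index_enum i))|j _]; last exact: sqr_ge0.
    by rewrite sqrf_eq0 => /eqP.
  have ZB : \sum_i Z 0 i *: b i = 0.
    apply/polyP => k; rewrite coef0 coef_sum; case: (ltnP k 2) => k2.
      have := congr1 (fun X : 'rV[R]_2 => X 0 (Ordinal k2)) HZ; rewrite !mxE => HZk.
      by apply: etrans HZk; apply: eq_bigr => i _; rewrite coefZ mxE.
    by rewrite big1 // => i _; rewrite coefZ nth_default ?mulr0 // (leq_trans (sb i)).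
  under eq_bigr => i _ do rewrite mulrC -scalerA.
  by rewrite -scaler_sumr ZB scaler0.
have [S [HS Sn]] := orthogonal_extend n1.
have eqv : equivP P (act S P) by exists S.
have [f' s'] := equivP_rep eqv (conj fP sP).
pose a' j := \sum_i S i j * a i; pose b' j := \sum_i S i j *: b i; pose c' j := \sum_i S i j *: c i.
have EP' j : act S P j = quad (a' j) (b' j) (c' j).
  by rewrite -quad_sum; apply: eq_bigr => i _; rewrite EP.
have a'E j : a' j = t * (j == 0)%:R.
  rewrite /a'; under eq_bigr => i _ do rewrite na mulrCA -Sn.
  rewrite -mulr_sumr; congr (_ * _).
  have := congr1 (fun X : 'M[R]_3 => X j 0) HS; rewrite !mxE => <-.
  by apply: eq_bigr => i _; rewrite mxE.
have b'0 : b' 0 = 0.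
  transitivity (\sum_i n i *: b i); last exact: nb.
  by apply: eq_bigr => i _; rewrite Sn.
have [o1 o2] := ord2.
have EN : act S P =1 normP (c' 0) (b' 1) (b' (inord 2)) (c' 1) (c' (inord 2)).
  move=> j; rewrite EP' /normP a'E.
  case: j => -[|[|[|j]]] Hj //.
  - have -> : Ordinal Hj = 0 by apply: val_inj.
    by rewrite eqxx b'0 mulr1.
  - have -> : Ordinal Hj = 1 by apply: val_inj.
    by rewrite eqxx mulr0.
  - have -> : Ordinal Hj = inord 2 by apply: val_inj; rewrite /= inordK.
    by rewrite o1 o2 mulr0.
have sz j : (size (b' j) <= 2)%N /\ (size (c' j) <= 3)%N.
  have [x [y [z [E sy sz]]]] := f' j; rewrite EP' in E.
  by have [_ -> ->] := quad_inj E.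
exists (c' 0), (b' 1), (b' (inord 2)), (c' 1), (c' (inord 2)).
split; last by apply: (equivP_act HS) => j; rewrite EN.
have s'' : \sum_i quad (a' i) (b' i) (c' i) ^+ 2 = target.
  by rewrite -s'; apply: eq_bigr => i _; rewrite EP'.
have [_ _] := (sum_quad_sqr a' b' c').1 s''.
rewrite !sum3 !a'E !o1 !eqxx b'0 /= => E2 E3 E4.
split.
- by split; [case: (sz 1) | case: (sz (inord 2))].
- by split; [case: (sz 0) | case: (sz 1) | case: (sz (inord 2))].
- rewrite /hpol -E2 !mulr0 !mul0rn !scale0r expr0n /= mulr1 add0r !addr0.
  by rewrite -addrA addrC addrK.
- by rewrite /kpol -E4; ring.
- by rewrite -E3 mul0r mul0rn add0r mulrnDl.
Qed.

Section ComplexPairs.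
Local Notation C := R[i].
Local Notation cx := (map_poly (real_complex R)).

Definition mkC (p q : {poly R}) : {poly C} := cx p + ('i%C)%:P * cx q.

Lemma sqr_iC : ('i%C : C) * 'i%C = -1.
Proof. by apply/eqP; rewrite eq_complex /= !(mulr0, mul0r, mulr1, subr0, addr0, sub0r, oppr0) !eqxx. Qed.

Lemma mkCM p q r s : mkC p q * mkC r s = mkC (p * r - q * s) (p * s + q * r).
Proof.
have i2 : ('i%C)%:P * ('i%C)%:P = -1 :> {poly C} by rewrite -polyCM sqr_iC polyCN polyC1.
rewrite /mkC !(rmorphB, rmorphD, rmorphM) /=.
transitivity (cx p * cx r + (('i%C)%:P * ('i%C)%:P) * (cx q * cx s) +
  ('i%C)%:P * (cx p * cx s + cx q * cx r)); first by ring.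
by rewrite i2; ring.
Qed.

Lemma coef_mkC p q k : (mkC p q)`_k = Complex p`_k q`_k.
Proof.
rewrite /mkC coefD coefCM !coef_map /=; apply/eqP; rewrite eq_complex /=.
by rewrite !(mulr0, mul0r, mulr1, mul1r, subr0, addr0, add0r) !eqxx.
Qed.

Lemma mkC_inj p q p' q' : mkC p q = mkC p' q' -> p = p' /\ q = q'.
Proof.
move=> E; have H k : p`_k = p'`_k /\ q`_k = q'`_k.
  by have := congr1 (fun r : {poly C} => r`_k) E; rewrite !coef_mkC => -[-> ->].
by split; apply/polyP => k; case: (H k).
Qed.

Lemma mkC_surj (M : {poly C}) : exists p q, M = mkC p q /\
  ((size p <= size M)%N /\ (size q <= size M)%N).
Proof.
exists (\poly_(k < size M) complex.Re M`_k), (\poly_(k < size M) complex.Im M`_k).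
split; last by split; exact: size_poly.
apply/polyP => k; rewrite coef_mkC !coef_poly; case: ltnP => kM.
  by case: (M`_k).
by rewrite nth_default.
Qed.

Lemma mkC0 p q : mkC p q = 0 -> p = 0 /\ q = 0.
Proof.
have e : (0 : {poly C}) = mkC 0 0 by rewrite /mkC rmorph0 mulr0 addr0.
by rewrite e; exact: mkC_inj.
Qed.

Lemma mkC_real p : mkC p 0 = cx p.
Proof. by rewrite /mkC rmorph0 mulr0 addr0. Qed.

Lemma size_mkC (p q : {poly R}) n : (size p <= n)%N -> (size q <= n)%N -> (size (mkC p q) <= n)%N.
Proof.
move=> sp sq; apply/leq_sizeP => k nk; rewrite coef_mkC !nth_default //; exact: leq_trans nk.
Qed.

Lemma size_mkC_conj p q : size (mkC p (- q)) = size (mkC p q).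
Proof.
have H (r s : {poly R}) n : (size (mkC r s) <= n)%N -> (size (mkC r (- s)) <= n)%N.
  move=> /leq_sizeP Hn; apply/leq_sizeP => k nk; have := Hn k nk.
  by rewrite !coef_mkC coefN => -[-> ->]; rewrite oppr0.
apply/eqP; rewrite eqn_leq; apply/andP; split; first exact: H.
by have := H _ _ _ (leqnn (size (mkC p (- q)))); rewrite opprK.
Qed.

Lemma mkC_ev p q x : (mkC p q).[x] = evC p x + 'i%C * evC q x.
Proof. by rewrite /mkC hornerD hornerM hornerC. Qed.

Lemma mkC_conj_ev p q x : (mkC p (- q)).[x^*%C] = ((mkC p q).[x]^*)%C.
Proof.
rewrite !mkC_ev evCN !evC_conj rmorphD rmorphM mulrN -mulNr; congr (_ + _ * _).
by apply/eqP; rewrite eq_complex /= oppr0 !eqxx.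
Qed.

Lemma mkC_half (r : R) p q : r != 0 ->
  mkC (r%:P * ((2 * r)^-1)%:P * p) (r%:P * ((2 * r)^-1)%:P * q) *+ 2 = mkC p q.
Proof.
move=> r0; have e : (2 * r)^-1 * r *+ 2 = 1 by field.
have e2 : r%:P * ((2 * r)^-1)%:P *+ 2 = 1 :> {poly R} by rewrite -polyCM mulrC -polyCMn e.
rewrite mulr2n /mkC !(rmorphM _ (_ * _)) /=.
transitivity (cx (r%:P * ((2 * r)^-1)%:P *+ 2) * cx p + ('i%C)%:P * (cx (r%:P * ((2 * r)^-1)%:P *+ 2) * cx q)).
  by rewrite rmorphMn /=; ring.
by rewrite e2 rmorph1 !mul1r.
Qed.

Lemma conjC0 (z : C) : (z^*)%C = 0 -> z = 0.
Proof. by case: z => a b [-> /eqP]; rewrite oppr_eq0 => /eqP ->. Qed.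

Lemma poly_size2_root (L : {poly C}) x : (size L <= 2)%N -> L.[x] = 0 ->
  exists q, L = q%:P * ('X - x%:P).
Proof.
move=> sL /rootP/factor_theorem [q Eq].
have sq : (size q <= 1)%N.
  have [->|q0] := eqVneq q 0; first by rewrite size_poly0.
  by move: sL; rewrite Eq size_mul ?polyXsubC_eq0 // size_XsubC addn2.
by exists q`_0; rewrite Eq {1}(size1_polyC sq).
Qed.

(** [L = b1 + i b2] and [L'] have degree at most 1 and the same norm [h]. If a root [x] of [L] were
    not a root of [L'], it would be a root of the conjugate factor of [L']. Then [n1 + i n2]
    vanishes at [x] and at its conjugate, so [n1(x) = 0]; and [x] is nonreal with [k(x) = 0], which
    is excluded. *)
Lemma normal_proportional (b1 b2 b1' b2' c1 c2 c1' c2' h k n1 n2 : {poly R}) :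
  (size b1 <= 2)%N -> (size b2 <= 2)%N -> (size b1' <= 2)%N -> (size b2' <= 2)%N ->
  h != 0 -> b1 ^+ 2 + b2 ^+ 2 = h -> b1' ^+ 2 + b2' ^+ 2 = h -> c1 ^+ 2 + c2 ^+ 2 = k ->
  b1 * c1 + b2 * c2 = n1 -> b1' * c1' + b2' * c2' = n1 ->
  b1 * c2 - b2 * c1 = n2 -> b1' * c2' - b2' * c1' = n2 ->
  (forall x : C, x != x^*%C -> evC h x = 0 -> evC k x = 0 -> evC n1 x = 0 -> False) ->
  exists u : C, mkC b1' b2' = u%:P * mkC b1 b2.
Proof.
move=> s1 s2 s1' s2' h0 Eh Eh' Ek E1 E1' E2 E2' nc.
set L := mkC b1 b2; set L' := mkC b1' b2'.
pose Lb := mkC b1 (- b2); pose Lb' := mkC b1' (- b2'); pose K := mkC c1 c2; pose K' := mkC c1' c2'.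
have LL : L * Lb = cx h by rewrite /L /Lb mkCM -mkC_real -Eh; congr mkC; ring.
have LL' : L' * Lb' = cx h by rewrite /L' /Lb' mkCM -mkC_real -Eh'; congr mkC; ring.
have KK : K * mkC c1 (- c2) = cx k by rewrite /K mkCM -mkC_real -Ek; congr mkC; ring.
have N1 : Lb * K = mkC n1 n2 by rewrite /Lb /K mkCM -E1 -E2; congr mkC; ring.
have N1' : Lb' * K' = mkC n1 n2 by rewrite /Lb' /K' mkCM -E1' -E2'; congr mkC; ring.
have hC0 : cx h != 0 by rewrite map_poly_eq0.
have L0 : L != 0 by apply: contraNneq hC0 => E; rewrite -LL E mul0r.
have L0' : L' != 0 by apply: contraNneq hC0 => E; rewrite -LL' E mul0r.
have sL : (size L <= 2)%N by exact: size_mkC.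
have sL' : (size L' <= 2)%N by exact: size_mkC.
have szh : ((size L) * 2 = (size L') * 2)%N.
  have := congr1 (fun p : {poly C} => size p) (etrans LL (esym LL')).
  have e : size Lb = size L := size_mkC_conj b1 b2.
  have e' : size Lb' = size L' := size_mkC_conj b1' b2'.
  rewrite /= !size_mul //; try by rewrite -size_poly_eq0 ?e ?e' size_poly_eq0.
  rewrite e e'; move: L0 L0'; rewrite -!size_poly_gt0.
  by move: (size L) (size L') => x y; lia.
case: (leqP (size L) 1) => sL1.
  have sL1' : (size L' <= 1)%N by move: szh sL1; move: (size L) (size L') => x y; lia.
  have [l El] : exists l, L = l%:P by exists L`_0; exact: size1_polyC.
  have [l' El'] : exists l', L' = l'%:P by exists L'`_0; exact: size1_polyC.
  have l0 : l != 0 by apply: contra L0 => /eqP E; rewrite El E polyC0.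
  by exists (l' / l); rewrite El El' -polyCM divfK.
have [x Hx] : exists x, root L x by apply/closed_rootP; rewrite neq_ltn sL1 orbT.
have Lx : L.[x] = 0 by exact/rootP.
have [q Eq] := poly_size2_root sL Lx.
have q0 : q != 0 by apply: contra L0 => /eqP E; rewrite Eq E polyC0 mul0r.
have [L'x|L'x] := eqVneq L'.[x] 0.
  have [q' Eq'] := poly_size2_root sL' L'x.
  by exists (q' / q); rewrite Eq Eq' mulrA -polyCM divfK.
exfalso.
have hx : evC h x = 0 by rewrite /evC -LL hornerM Lx mul0r.
have Lb'x : Lb'.[x] = 0.
  apply/eqP; move/eqP: hx; rewrite /evC -LL' hornerM mulf_eq0 (negbTE L'x) //.
have Lbxc : Lb.[x^*%C] = 0 by rewrite mkC_conj_ev -/L Lx rmorph0.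
have Nx : (mkC n1 n2).[x] = 0 by rewrite -N1' hornerM Lb'x mul0r.
have Nxc : (mkC n1 n2).[x^*%C] = 0 by rewrite -N1 hornerM Lbxc mul0r.
have n1x : evC n1 x = 0.
  have H : (mkC n1 (- n2)).[x] = 0.
    by have := mkC_conj_ev n1 n2 x^*%C; rewrite conjcK Nxc rmorph0.
  move: Nx H; rewrite !mkC_ev evCN mulrN => Na Nb.
  have : evC n1 x *+ 2 = 0 by rewrite mulr2n -[X in X + _](addrK ('i%C * evC n2 x)) Na sub0r addrC Nb.
  by move/eqP; rewrite mulrn_eq0 => /eqP.
have Lbx : Lb.[x] != 0.
  apply/negP => /eqP Lbx.
  have xx : x = x^*%C.
    have Lxc : L.[x^*%C] = 0.
      by apply: conjC0; rewrite -mkC_conj_ev conjcK.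
    move: Lxc; rewrite Eq hornerM hornerC hornerXsubC => /eqP.
    by rewrite mulf_eq0 (negbTE q0) subr_eq0 => /eqP.
  case/negP: L'x; apply/eqP/conjC0.
  by rewrite -mkC_conj_ev -xx.
have Kx : K.[x] = 0.
  by apply/eqP; move/eqP: Nx; rewrite -N1 hornerM mulf_eq0 (negbTE Lbx).
apply: (nc x _ hx _ n1x).
  by apply: contra Lbx => /eqP xx; rewrite xx Lbxc.
by rewrite /evC -KK hornerM Kx mul0r.
Qed.

End ComplexPairs.


Lemma ord3_case (P : 'I_3 -> Prop) : P 0 -> P 1 -> P (inord 2) -> forall i, P i.
Proof.
move=> P0 P1 P2' [[|[|[|i]]] Hi] //.
- by rewrite (_ : Ordinal Hi = 0) //; apply: val_inj.
- by rewrite (_ : Ordinal Hi = 1) //; apply: val_inj.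
- by rewrite (_ : Ordinal Hi = inord 2) //; apply: val_inj; rewrite /= inordK.
Qed.

(** A sign on the first form and an orthogonal 2 by 2 block on the other two. The condition
    [t * e = t] preserves the term [t z^2], so the sign -1 is available only at [t = 0]. *)
Lemma equivP_block (e x y z v : R) g b1 b2 c1 c2 :
  e ^+ 2 = 1 -> x ^+ 2 + z ^+ 2 = 1 -> y ^+ 2 + v ^+ 2 = 1 -> x * y + z * v = 0 -> t * e = t ->
  equivP (normP g b1 b2 c1 c2)
    (normP (e *: g) (x *: b1 + z *: b2) (y *: b1 + v *: b2) (x *: c1 + z *: c2) (y *: c1 + v *: c2)).
Proof.
move=> e1 xz yv xyzv te; have [o1 o2] := ord2.
have o3 : ((0 : 'I_3) == inord 2) = false by rewrite eq_sym o1.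
have o4 : ((1 : 'I_3) == inord 2) = false by rewrite eq_sym o2.
pose S : 'M[R]_3 := \matrix_(i, j)
  (if i == 0 then (if j == 0 then e else 0)
   else if i == 1 then (if j == 0 then 0 else if j == 1 then x else y)
   else (if j == 0 then 0 else if j == 1 then z else v)).
exists S; split.
  apply/matrixP; apply: ord3_case; apply: ord3_case;
    rewrite !mxE sum3 !mxE ?o1 ?o2 ?o3 ?o4 ?eqxx /= ?(mulr0, mul0r, addr0, add0r) //;
    rewrite -?expr2 //; by rewrite addrC mulrC [z * v]mulrC addrC in xyzv *.
move=> j; rewrite /normP quad_sum !sum3 !mxE ?o1 ?o2 ?eqxx /=.
move: j; apply: ord3_case; rewrite ?o1 ?o2 ?eqxx /= ?(mulr0, scale0r, scaler0, addr0, add0r) ?mul0r ?addr0 //.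
by rewrite mulrC te.
Qed.

(** The identity [|b|^2 |c|^2 = (b1 c1 + b2 c2)^2 + (b1 c2 - b2 c1)^2]. *)
Lemma normal_solution g b1 b2 c1 c2 : normal g b1 b2 c1 c2 ->
  solution p2 p3 p4 t g ((b1 * c2 - b2 * c1) *+ 2).
Proof.
move=> [[s1 s2] [sg sc1 sc2] Eh Ek E3]; split=> //.
- rewrite -scaler_nat (leq_trans (size_scale_leq _ _)) //.
  apply: size_polyD_le; rewrite ?size_polyN; exact: (@size_polyM_le _ _ _ 1 2).
- by move=> x; rewrite -Eh hornerD !horner_exp addr_ge0 ?sqr_ge0.
- by rewrite /eqpol -Eh -Ek -E3 -mul_polyC rmorph_nat; ring.
Qed.

Lemma double_inj (p q : {poly R}) : p *+ 2 = q *+ 2 -> p = q.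
Proof.
move=> E; apply/eqP; rewrite -subr_eq0.
have : (p - q) *+ 2 == 0 by rewrite mulrnBl E subrr.
by rewrite -scaler_nat scale_poly_eq0 pnatr_eq0.
Qed.

(** After a reflection of the last coordinate both forms have the same [w]. Then
    [b1' + i b2' = u (b1 + i b2)] with [|u| = 1], and since the products with the conjugate agree,
    [c1 + i c2] is multiplied by the same [u]: a rotation. *)
Lemma normal_unique g b1 b2 c1 c2 b1' b2' c1' c2' :
  normal g b1 b2 c1 c2 -> normal g b1' b2' c1' c2' -> hpol p2 t g != 0 ->
  (forall x : R[i], x != x^*%C -> evC (hpol p2 t g) x = 0 -> evC (kpol p4 g) x = 0 ->
     evC p3 x = 0 -> False) ->
  equivP (normP g b1 b2 c1 c2) (normP g b1' b2' c1' c2').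
Proof.
move=> N N' h0 nc.
wlog Ew : b2' c2' N' / (b1' * c2' - b2' * c1') = (b1 * c2 - b2 * c1).
  move=> H; have S := normal_solution N; have S' := normal_solution N'.
  have [E|E] := Deformation.sol_same S S'; first by apply: H => //; exact: double_inj.
  have N'' : normal g b1' (- b2') c1' (- c2').
    case: N' => [[s1 s2] [sg sc1 sc2] Eh Ek E3]; split; rewrite ?size_polyN ?sqrrN ?mulrNN //.
  apply: (equivP_trans (H _ _ N'' _)).
    apply: double_inj.
    transitivity (- ((b1' * c2' - b2' * c1') *+ 2)); first by ring.
    by rewrite E opprK.
  have := @equivP_block 1 1 0 0 (-1) g b1' (- b2') c1' (- c2').
  rewrite !scale1r !scale0r !addr0 !add0r !scaleN1r !opprK; apply; rewrite ?mulr1 //; ring.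
case: N => [[s1 s2] [sg sc1 sc2] Eh Ek E3]; case: N' => [[s1' s2'] [_ sc1' sc2'] Eh' Ek' E3'].
have E1 : b1' * c1' + b2' * c2' = b1 * c1 + b2 * c2.
  by apply: double_inj; rewrite E3 E3'.
have nc' x : x != x^*%C -> evC (hpol p2 t g) x = 0 -> evC (kpol p4 g) x = 0 ->
    evC (b1 * c1 + b2 * c2) x = 0 -> False.
  by move=> nx hx kx n1; apply: (nc x nx hx kx); rewrite -E3 evCMn n1 mul0rn.
have [[u1 u2] Eu] := normal_proportional s1 s2 s1' s2' h0 Eh Eh' Ek erefl E1 erefl Ew nc'.
have Euu : mkC b1' b2' = mkC (u1 *: b1 - u2 *: b2) (u1 *: b2 + u2 *: b1).
  rewrite Eu (_ : (Complex u1 u2)%:P = mkC u1%:P u2%:P) ?mkCM ?mul_polyC //.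
  by apply/polyP => k; rewrite coef_mkC !coefC; case: eqP.
have [Eb1 Eb2] := mkC_inj Euu.
have u1u2 : u1 ^+ 2 + u2 ^+ 2 = 1.
  have E : ((u1 ^+ 2 + u2 ^+ 2)%:P - 1) * hpol p2 t g = 0.
    rewrite mulrBl mul1r -{2}Eh' Eb1 Eb2 -Eh -!mul_polyC rmorphD !rmorphXn /=; ring.
  move/eqP: E; rewrite mulf_eq0 (negbTE h0) orbF subr_eq0 => /eqP E.
  by apply: (@polyC_inj R); rewrite E polyC1.
have EK : mkC c1' c2' = mkC (u1 *: c1 - u2 *: c2) (u1 *: c2 + u2 *: c1).
  have L0 : mkC b1' (- b2') != 0.
    apply: contra h0 => /eqP /mkC0 [z1 /eqP]; rewrite oppr_eq0 => /eqP z2.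
    by rewrite -Eh' z1 z2 expr0n addr0.
  apply: (mulfI L0); rewrite !mkCM.
  have -> : b1' * c1' - - b2' * c2' = b1 * c1 + b2 * c2 by rewrite -E1; ring.
  have -> : b1' * c2' + - b2' * c1' = b1 * c2 - b2 * c1 by rewrite -Ew; ring.
  have U : u1%:P * u1%:P + u2%:P * u2%:P = 1 :> {poly R} by rewrite -!polyCM -polyCD -!expr2 u1u2.
  rewrite Eb1 Eb2 -!mul_polyC; congr mkC.
    transitivity ((u1%:P * u1%:P + u2%:P * u2%:P) * (b1 * c1 + b2 * c2)); last by ring.
    by rewrite U mul1r.
  transitivity ((u1%:P * u1%:P + u2%:P * u2%:P) * (b1 * c2 - b2 * c1)); last by ring.
  by rewrite U mul1r.
have [Ec1 Ec2] := mkC_inj EK.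
have := @equivP_block 1 u1 u2 (- u2) u1 g b1 b2 c1 c2.
rewrite scale1r !scaleNr -Eb1 -Ec1 ![u2 *: _ + u1 *: _]addrC -Eb2 -Ec2; apply; rewrite ?mulr1 ?expr1n ?sqrrN ?[u2 ^+ 2 + _]addrC ?u1u2 //; ring.
Qed.

Lemma quad_factor (h : {poly R}) (u v : R) : (size h <= 3)%N -> (forall x, 0 <= h.[x]) ->
  evC h (Complex u v) = 0 -> h = h`_2 *: (('X - u%:P) ^+ 2 + (v%:P) ^+ 2).
Proof.
move=> sh hge hx.
have sq : size (('X - u%:P) ^+ 2) = 3 by rewrite size_exp_XsubC.
have q2 : (('X - u%:P) ^+ 2)`_2 = 1.
  by have /monicP := monic_exp 2 (monicXsubC u); rewrite lead_coefE sq.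
have [v0|v0] := eqVneq v 0.
  have [q Eq] := nneg_double_root hge (evC_root (x := u) (etrans (congr1 _ (congr1 _ (esym v0))) hx)).
  have Q0 : ('X - u%:P) ^+ 2 != 0 by rewrite -size_poly_eq0 sq.
  have [c Ec] : exists c, q = c%:P.
    exists q`_0; apply: size1_polyC; have [->|q0] := eqVneq q 0; first by rewrite size_poly0.
    by move: sh; rewrite Eq size_mul // sq.
  by rewrite v0 expr0n addr0 Eq Ec mulrC mul_polyC coefZ q2 mulr1.
apply/eqP; rewrite -subr_eq0; apply/eqP; apply: (@evC_nonreal_linear _ _ (Complex u v)).
- by rewrite eq_complex /= negb_and; apply/orP; right; apply: contra v0 => /eqP ?; apply/eqP; lra.
- apply/leq_sizeP => j; rewrite leq_eqVlt coefB coefZ coefD -polyC_exp coefC => /orP[/eqP <-|j2].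
    by rewrite q2 addr0 mulr1 subrr.
  have Xj : (('X - u%:P) ^+ 2)`_j = 0 by rewrite nth_default // sq.
  by rewrite Xj (nth_default _ (leq_trans sh j2)) gtn_eqF ?addr0 ?mulr0 ?subrr // (leq_trans _ j2).
- rewrite evCD evCN evCZ hx evCD !evCX evCD evCN /evC map_polyX !map_polyC /= hornerX !hornerC.
  by apply/eqP; rewrite eq_complex /=; apply/andP; split; apply/eqP; ring.
Qed.

(** One factors [N = p3 + i w], whose norm is [4 h k], as twice a factor of norm [h] times a
    cofactor. If [h] is a constant, the first factor is its square root and [N] has degree at most
    2. Otherwise [h = r^2 |X - x|^2] for a root [x] shared with [N], and the first factor is
    [r (X - x)]. *)
Lemma normal_exists g w : (size p2 <= 3)%N -> (size p3 <= 4)%N -> (size p4 <= 5)%N ->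
  solution p2 p3 p4 t g w -> hpol p2 t g != 0 ->
  exists b1 b2 c1 c2, normal g b1 b2 c1 c2.
Proof.
move=> s2 s3 s4 S h0; set h := hpol p2 t g in h0 *; set k := kpol p4 g.
have sh : (size h <= 3)%N := size_hpol S s2.
have sk : (size k <= 5)%N := size_kpol S s4.
have hge := hpol_ge0 S; rewrite -/h in hge.
have E := solE S; rewrite -/h -/k in E.
have hev x : h.[x] = h`_2 * x ^+ 2 + h`_1 * x + h`_0.
  by rewrite (horner_coef_wide _ sh) !big_ord_recl big_ord0 /=; ring.
pose N := mkC p3 w; pose Nb := mkC p3 (- w).
have NN : N * Nb = map_poly (real_complex R) (4 *: (h * k)).
  by rewrite E /N /Nb mkCM -mkC_real; congr mkC; ring.
have sN : (size N <= 4)%N by apply: size_mkC => //; exact: size_w S.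
(* [r * (X - x0)] and [c] play the roles of the conjugate of [b1 + i b2] and of [c1 + i c2]. *)
suff [d1 [d2 [c1 [c2 [sd sc Ed EN]]]]] : exists d1 d2 c1 c2 : {poly R},
    [/\ (size d1 <= 2)%N /\ (size d2 <= 2)%N, (size c1 <= 3)%N /\ (size c2 <= 3)%N,
      d1 ^+ 2 + d2 ^+ 2 = h & mkC d1 d2 * mkC c1 c2 *+ 2 = N].
  exists d1, (- d2), c1, c2; rewrite /normal.
  have EN' : mkC ((d1 * c1 - d2 * c2) *+ 2) ((d1 * c2 + d2 * c1) *+ 2) = N.
    by rewrite -EN mkCM !mulr2n /mkC !rmorphD /=; ring.
  have [E3 Ew] := mkC_inj EN'.
  case: sd => sd1 sd2; case: sc => sc1 sc2; split.
  - by rewrite size_polyN.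
  - by split=> //; exact: size_g S.
  - by rewrite sqrrN.
  - have E4 : 4 *: (h * (c1 ^+ 2 + c2 ^+ 2)) = 4 *: (h * k).
      by rewrite E -E3 -Ew -Ed -mul_polyC rmorph_nat; ring.
    move/eqP: E4; rewrite -subr_eq0 -scalerBr scale_poly_eq0 pnatr_eq0 /= -mulrBr mulf_eq0 (negbTE h0) /=.
    by rewrite subr_eq0 => /eqP.
  - by rewrite -E3; ring.
have real_sum_const (c : R) : h = c%:P -> exists d1 d2 c1 c2 : {poly R},
    [/\ (size d1 <= 2)%N /\ (size d2 <= 2)%N, (size c1 <= 3)%N /\ (size c2 <= 3)%N,
      d1 ^+ 2 + d2 ^+ 2 = h & mkC d1 d2 * mkC c1 c2 *+ 2 = N].
  move=> Eh; have c0 : 0 < c.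
    rewrite lt_def; apply/andP; split; first by apply: contra h0 => /eqP z; rewrite Eh z polyC0.
    by have := hge 0; rewrite Eh hornerC.
  have sN3 : (size N <= 3)%N.
    have [->|N0] := eqVneq N 0; first by rewrite size_poly0.
    have := congr1 (fun p : {poly R[i]} => size p) NN; rewrite /= size_mul //; last first.
      by rewrite -size_poly_eq0 size_mkC_conj size_poly_eq0.
    rewrite size_mkC_conj -/N size_map_poly => Es.
    have : (size (4 *: (h * k)) <= 5)%N.
      by rewrite (leq_trans (size_scale_leq _ _)) // Eh mul_polyC (leq_trans (size_scale_leq _ _)).
    by rewrite -Es; move: (size N) => m; lia.
  have [c1 [c2 [Ec [s1 s2']]]] := mkC_surj N.
  pose r := Num.sqrt c; have r0 : r != 0 by rewrite sqrtr_eq0 -ltNge.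
  exists r%:P, 0, ((2 * r)^-1 *: c1), ((2 * r)^-1 *: c2); split.
  - by rewrite size_poly0 (leq_trans (size_polyC_leq1 _)).
  - by split; rewrite (leq_trans (size_scale_leq _ _)) // (leq_trans _ sN3).
  - by rewrite expr0n addr0 -rmorphXn /= sqr_sqrtr ?Eh // ltW.
  - by rewrite mkCM Ec -[RHS](mkC_half _ _ r0); congr (mkC _ _ *+ 2); rewrite -!mul_polyC; ring.
have a0 := quad_lead_ge0 (fun x => let H := hge x in eq_rect _ (fun y => is_true (0 <= y)) H _ (hev x)).
move: a0; rewrite le_eqVlt => /orP[/eqP/esym h2|h2].
  have h1 : h`_1 = 0.
    apply/eqP; apply: contraT => h1; have := hge (- (h`_0 + 1) / h`_1).
    by rewrite hev h2 mul0r add0r mulrCA divff // mulr1; lra.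
  apply: (real_sum_const h`_0); apply/polyP => -[|[|[|j]]]; rewrite coefC //=.
  by rewrite nth_default // (leq_trans sh).
have hC : exists x, root (map_poly (real_complex R) h) x.
  apply/closed_rootP; rewrite size_map_poly; apply/negP => /eqP s1.
  by move: h2; rewrite nth_default ?ltxx // s1.
have [x0 /rootP hx0] := hC.
(* At a root of [h] either [N] or its conjugate vanishes; in the second case the conjugate root
   serves. *)
have [x [hx Nx]] : exists x, evC h x = 0 /\ N.[x] = 0.
  have : (N * Nb).[x0] = 0 by rewrite NN -/(evC _ _) evCZ evCM /evC hx0 mul0r mulr0.
  rewrite hornerM => /eqP; rewrite mulf_eq0 => /orP[] /eqP z; first by exists x0.
  exists x0^*%C; split; first exact: evC_conj0.
  by apply: conjC0; rewrite -mkC_conj_ev conjcK.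
case: x hx Nx => u v hx Nx.
have [M EM] : exists M, N = ('X - (Complex u v)%:P) * M.
  by have /rootP/factor_theorem [M ->] := Nx; exists M; rewrite mulrC.
have sM : (size M <= 3)%N.
  have [->|M0] := eqVneq M 0; first by rewrite size_poly0.
  by move: sN; rewrite EM size_mul ?polyXsubC_eq0 // size_XsubC.
have [m1 [m2 [Em [s1 s2']]]] := mkC_surj M.
pose r := Num.sqrt h`_2; have r0 : r != 0 by rewrite sqrtr_eq0 -ltNge.
have rr : r ^+ 2 = h`_2 by rewrite sqr_sqrtr // ltW.
have EX : 'X - (Complex u v)%:P = mkC ('X - u%:P) (- v%:P).
  apply/polyP => j; rewrite coef_mkC !(coefB, coefN, coefX, coefC); apply/eqP.
  by rewrite eq_complex; case: j => [|[|j]] /=; rewrite ?subr0 ?oppr0 ?sub0r !eqxx.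
have Hh := quad_factor sh hge hx.
exists (r *: ('X - u%:P)), (r *: (- v%:P)), ((2 * r)^-1 *: m1), ((2 * r)^-1 *: m2); split.
- split; rewrite (leq_trans (size_scale_leq _ _)) ?size_XsubC //.
  by rewrite size_polyN (leq_trans (size_polyC_leq1 _)).
- by split; rewrite (leq_trans (size_scale_leq _ _)) // (leq_trans _ sM).
- by rewrite [RHS]Hh -rr -!mul_polyC rmorphXn /=; ring.
- by rewrite EM EX Em !mkCM -[RHS](mkC_half _ _ r0); congr (mkC _ _ *+ 2); rewrite -!mul_polyC; ring.
Qed.

End NormalForms.

(** * From solutions to equivalence classes *)

Section Classes.
Variables (R : realType) (t : R) (p2 p3 p4 : {poly R}).
Local Notation sol := (solution p2 p3 p4 t).
Hypothesis t01 : t = 0 \/ t = 1.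
Hypotheses (s2 : (size p2 <= 3)%N) (s3 : (size p3 <= 4)%N) (s4 : (size p4 <= 5)%N).
Hypothesis p2_pos : forall x, 0 < p2.[x].
Hypothesis p2_lead_pos : 0 < p2`_2.
Hypothesis h_neq0 : forall g w, sol g w -> hpol p2 t g != 0.
Hypothesis h_k_p3 : forall g w (x : R[i]), sol g w -> x != x^*%C ->
  evC (hpol p2 t g) x = 0 -> evC (kpol p4 g) x = 0 -> evC p3 x = 0 -> False.

Definition same_class (g g' : {poly R}) := g = g' \/ (t = 0 /\ g = - g').

(** A relation gives [(u^2 + v^2) p2 = l^2] with [l = v b1 - u b2]. If [u^2 + v^2] is nonzero, [l]
    has degree exactly 1, hence a real zero, where [p2] would vanish. *)
Lemma linear_indep (b1 b2 : {poly R}) (u v : R) : (size b1 <= 2)%N -> (size b2 <= 2)%N ->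
  b1 ^+ 2 + b2 ^+ 2 = p2 -> u *: b1 + v *: b2 = 0 -> u = 0 /\ v = 0.
Proof.
move=> s1 s2' Eb E; pose l := v *: b1 - u *: b2.
have El : (u ^+ 2 + v ^+ 2) *: p2 = l ^+ 2.
  transitivity ((u *: b1 + v *: b2) ^+ 2 + l ^+ 2); last by rewrite E expr0n add0r.
  by rewrite -Eb /l -!mul_polyC rmorphD !rmorphXn /=; ring.
have sl : (size l <= 2)%N.
  by apply: size_polyD_le; rewrite ?size_polyN (leq_trans (size_scale_leq _ _)).
have l1 : l`_1 ^+ 2 = (u ^+ 2 + v ^+ 2) * p2`_2.
  by rewrite -coefZ El expr2 [l ^+ 2]expr2 -[2%N]/(1 + 1)%N (coefM_top sl sl).
have [uv|uv] := eqVneq (u ^+ 2 + v ^+ 2) 0.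
  move/eqP: uv; rewrite paddr_eq0 ?sqr_ge0 // !sqrf_eq0 => /andP[/eqP -> /eqP ->] //.
exfalso; have l10 : l`_1 != 0.
  by rewrite -sqrf_eq0 l1; apply: mulf_neq0 => //; rewrite gt_eqF.
pose x := - l`_0 / l`_1.
have lx : l.[x] = 0.
  have -> : l.[x] = l`_0 + l`_1 * x.
    by rewrite (horner_coef_wide _ sl) !big_ord_recl big_ord0 /=; ring.
  by rewrite /x; field.
have := congr1 (fun p : {poly R} => p.[x]) El.
rewrite hornerZ horner_exp lx expr0n /= => /eqP; rewrite mulf_eq0 (negbTE uv) /=.
by rewrite gt_eqF.
Qed.

(** The first column of [S] must be the first basis vector up to sign: at [t = 1] its first entry is
    1, and at [t = 0] its other entries vanish by independence of [b1] and [b2]. *)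
Lemma normal_same_class g b1 b2 c1 c2 g' b1' b2' c1' c2' :
  normal t p2 p3 p4 g b1 b2 c1 c2 -> normal t p2 p3 p4 g' b1' b2' c1' c2' ->
  equivP (normP t g b1 b2 c1 c2) (normP t g' b1' b2' c1' c2') -> same_class g' g.
Proof.
move=> N N' [S [HS E]]; have [o1 o2] := ord2.
have o3 : ((1 : 'I_3) == 0) = false by [].
have E0 j : [/\ (if j == 0 then t else 0) = S 0 j * t,
   (if j == 0 then 0 else if j == 1 then b1' else b2') = S 1 j *: b1 + S (inord 2) j *: b2 &
   (if j == 0 then g' else if j == 1 then c1' else c2') = S 0 j *: g + S 1 j *: c1 + S (inord 2) j *: c2].
  have := E j; rewrite /normP quad_sum !sum3 !o1 !o2 !o3 /= => /quad_inj [A B G].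
  by split; [rewrite A | rewrite B | rewrite G]; rewrite ?mulr0 ?addr0 ?scaler0 ?add0r.
have [A B G] := E0 0; rewrite eqxx in A B G.
have col : S 0 0 ^+ 2 + S 1 0 ^+ 2 + S (inord 2) 0 ^+ 2 = 1.
  have := congr1 (fun X : 'M[R]_3 => X 0 0) HS; rewrite !mxE sum3 !mxE eqxx => E1.
  by rewrite !expr2; exact: E1.
case: t01 => t1; last first.
  left; rewrite t1 mulr1 in A.
  move: col; rewrite -A expr1n => col.
  have q1 := sqr_ge0 (S 1 0); have q2 := sqr_ge0 (S (inord 2) 0).
  have z1 : S 1 0 = 0 by apply/eqP; rewrite -sqrf_eq0; apply/eqP; lra.
  have z2 : S (inord 2) 0 = 0 by apply/eqP; rewrite -sqrf_eq0; apply/eqP; lra.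
  by rewrite G -A z1 z2 !scale0r !addr0 scale1r.
have [[sb1 sb2] _ Eh _ _] := N.
have Eh' : b1 ^+ 2 + b2 ^+ 2 = p2 by rewrite Eh /hpol t1 mul0rn scale0r subr0.
have [z1 z2] := linear_indep sb1 sb2 Eh' (esym B).
move: col; rewrite z1 z2 expr0n !addr0 => /eqP; rewrite sqrf_eq1 => /orP[] /eqP z0.
  by left; rewrite G z0 z1 z2 !scale0r !addr0 scale1r.
by right; split=> //; rewrite G z0 z1 z2 !scale0r !addr0 scaleN1r.
Qed.

Theorem rep_classes N (G W : 'I_N -> {poly R}) :
  (forall k, sol (G k) (W k)) -> (forall k l, k != l -> ~ same_class (G k) (G l)) ->
  (forall g w, sol g w -> exists k, same_class g (G k)) ->
  exists r : 'I_N -> 'I_3 -> {poly {poly R}},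
    [/\ forall k, is_rep t p2 p3 p4 (r k), forall k l, k != l -> ~ equivP (r k) (r l) &
        forall P, is_rep t p2 p3 p4 P -> exists k, equivP (r k) P].
Proof.
move=> SG DG AG.
have ex k : exists B : {poly R} * {poly R} * {poly R} * {poly R},
    normal t p2 p3 p4 (G k) B.1.1.1 B.1.1.2 B.1.2 B.2.
  have [b1 [b2 [c1 [c2 H]]]] := normal_exists s2 s3 s4 (SG k) (h_neq0 (SG k)).
  by exists (b1, b2, c1, c2).
have [B HB] := boolp.choice ex.
exists (fun k => normP t (G k) (B k).1.1.1 (B k).1.1.2 (B k).1.2 (B k).2).
split=> [k|k l kl E|P HP]; first exact: normal_rep.
  by apply: (DG l k); [rewrite eq_sym | exact: normal_same_class (HB k) (HB l) E].
have [g [b1 [b2 [c1 [c2 [Nm EP]]]]]] := rep_normal t01 HP.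
have S := normal_solution Nm; have [k Hk] := AG _ _ S.
exists k; apply: equivP_trans (equivP_sym EP).
have uq b1' b2' c1' c2' : normal t p2 p3 p4 (G k) b1' b2' c1' c2' ->
    equivP (normP t (G k) (B k).1.1.1 (B k).1.1.2 (B k).1.2 (B k).2) (normP t (G k) b1' b2' c1' c2').
  move=> Nm'; apply: (normal_unique (HB k) Nm'); first exact: h_neq0 (SG k).
  by move=> x; exact: h_k_p3 (SG k).
case: Hk => [Eg|[t0 Eg]]; first by rewrite -Eg in uq *; exact: uq.
have Nm' : normal t p2 p3 p4 (G k) b1 b2 c1 c2.
  case: Nm => [sb [sg sc1 sc2] Eh Ek E3]; split=> //.
  - by split=> //; rewrite -[G k]opprK -Eg size_polyN.
  - by rewrite Eh /hpol t0 mul0rn !scale0r.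
  - by rewrite Ek /kpol Eg sqrrN.
apply: equivP_trans (uq _ _ _ _ Nm') _.
(* At [t = 0] changing the sign of the first form identifies [g] and [- g]. *)
have := @equivP_block R t (-1) 1 0 0 1 (G k) b1 b2 c1 c2.
rewrite !scale1r !scale0r !addr0 !add0r scaleN1r -Eg; apply.
- by rewrite sqrrN expr1n.
- by rewrite expr1n expr0n addr0.
- by rewrite expr1n expr0n add0r.
- by rewrite mulr0 mul0r addr0.
- by rewrite t0 mul0r.
Qed.

End Classes.

From mathcomp Require Import mpoly.

(** * Forms and their dehomogenizations *)

Section Dehomogenization.
Variable R : realType.
Local Notation P2 := {poly {poly R}}.

Lemma homog_ind n d (P : {mpoly R[n]} -> Prop) : P 0 ->
  (forall c m p, mdeg m = d -> P p -> P (c *: 'X_[m] + p)) -> forall p, p \is d.-homog -> P p.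
Proof.
move=> P0 PS p /dhomogP Hp; rewrite [p]mpolyE big_seq.
elim/big_rec: _ => // m q mp Pq; apply: PS => //; exact: Hp.
Qed.

Lemma dehomX (m : 'X_{1..2}) : dehom ('X_[m] : {mpoly R[2]}) = 'X^(m ord0).
Proof. by rewrite /dehom mmapX /mmap1 !big_ord_recl big_ord0 /= expr1n !mulr1. Qed.

Lemma dehomD (p q : {mpoly R[2]}) : dehom (p + q) = dehom p + dehom q.
Proof. by rewrite /dehom mmapD. Qed.
Lemma dehomZ c (p : {mpoly R[2]}) : dehom (c *: p) = c *: dehom p.
Proof. by rewrite /dehom mmapZ mul_polyC. Qed.
Lemma dehom0 : dehom (0 : {mpoly R[2]}) = 0.
Proof. by rewrite /dehom raddf0. Qed.
Lemma dehomM (p q : {mpoly R[2]}) : dehom (p * q) = dehom p * dehom q.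
Proof. by rewrite /dehom rmorphM. Qed.

Lemma dehom_sum (I : Type) (r : seq I) (P : pred I) (F : I -> {mpoly R[2]}) :
  dehom (\sum_(i <- r | P i) F i) = \sum_(i <- r | P i) dehom (F i).
Proof. by rewrite /dehom raddf_sum. Qed.

Lemma size_dehom d (p : {mpoly R[2]}) : p \is d.-homog -> (size (dehom p) <= d.+1)%N.
Proof.
move: p; apply: homog_ind; first by rewrite dehom0 size_poly0.
move=> c m q dm sq; rewrite dehomD dehomZ dehomX; apply: size_polyD_le => //.
rewrite (leq_trans (size_scale_leq _ _)) // size_polyXn ltnS -dm mdegE !big_ord_recl.
by rewrite leq_addr.
Qed.

Definition hom2 (d : nat) (p : {poly R}) : {mpoly R[2]} :=
  \sum_(i < d.+1) p`_i *: ('X_ord0 ^+ i * 'X_ord_max ^+ (d - i)).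

Lemma hom2_homog d p : hom2 d p \is d.-homog.
Proof.
apply: rpred_sum => i _; apply: rpredZ.
have H e : ('X_ord0 ^+ i * 'X_ord_max ^+ e : {mpoly R[2]}) \is (1 * i + 1 * e).-homog.
  by apply: dhomogM; apply: dhomogMn; rewrite dhomogX /= mdeg1.
by have := H (d - i)%N; rewrite !mul1n subnKC // -ltnS.
Qed.

Lemma dehomXX i j : dehom ('X_ord0 ^+ i * 'X_ord_max ^+ j : {mpoly R[2]}) = 'X^i.
Proof.
have X0 : dehom ('X_ord0 : {mpoly R[2]}) = 'X by rewrite dehomX mnm1E eqxx.
have X1 : dehom ('X_ord_max : {mpoly R[2]}) = 1 by rewrite dehomX mnm1E.
by rewrite dehomM /dehom !rmorphXn /= -!/(dehom _) X0 X1 expr1n mulr1.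
Qed.

Lemma dehom_hom2 d (p : {poly R}) : (size p <= d.+1)%N -> dehom (hom2 d p) = p.
Proof.
move=> sp; rewrite /hom2 /dehom raddf_sum /= -/(dehom _).
transitivity (\sum_(i < d.+1) p`_i *: 'X^i : {poly R}).
  by apply: eq_bigr => i _; rewrite -/(dehom _) dehomZ dehomXX.
by rewrite -poly_def; apply/polyP => k; rewrite coef_poly; case: ltnP => // dk; rewrite nth_default // (leq_trans sp).
Qed.

Lemma hom2_lin d c (p q : {poly R}) : hom2 d (c *: p + q) = c *: hom2 d p + hom2 d q.
Proof.
rewrite /hom2 scaler_sumr -big_split /=; apply: eq_bigr => i _.
by rewrite coefD coefZ scalerA scalerDl.
Qed.

Lemma hom2_0 d : hom2 d 0 = 0.
Proof. by rewrite /hom2 big1 // => i _; rewrite coef0 scale0r. Qed.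

Lemma hom2_dehom d (p : {mpoly R[2]}) : p \is d.-homog -> hom2 d (dehom p) = p.
Proof.
move: p; apply: homog_ind; first by rewrite dehom0 hom2_0.
move=> c m q dm E; rewrite dehomD dehomZ hom2_lin E dehomX; congr (_ *: _ + _).
have Ed : d = (m ord0 + m ord_max)%N.
  rewrite -dm mdegE !big_ord_recl big_ord0 addn0; congr (_ + m _)%N; exact: val_inj.
have lt : (m ord0 < d.+1)%N by rewrite Ed ltnS leq_addr.
rewrite /hom2 (bigD1 (Ordinal lt)) //= big1 ?addr0 => [|i im]; last first.
  rewrite coefXn; case: eqP => [E'|_]; last by rewrite scale0r.
  by case/eqP: im; apply: val_inj.
rewrite coefXn eqxx scale1r [RHS]mpolyXE_id !big_ord_recl big_ord0 mulr1 {1}Ed addKn.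
by congr (_ * 'X_ _ ^+ m _); exact: val_inj.
Qed.

Lemma dehom_inj d (p q : {mpoly R[2]}) : p \is d.-homog -> q \is d.-homog ->
  dehom p = dehom q -> p = q.
Proof. by move=> hp hq E; rewrite -(hom2_dehom hp) E hom2_dehom. Qed.

Definition pt2 (a b : R) : 'I_2 -> R := fun i => nth 0 [:: a; b] i.

Lemma dehom_horner (p : {mpoly R[2]}) x : p.@[pt2 x 1] = (dehom p).[x].
Proof.
rewrite [p]mpolyE /dehom !raddf_sum horner_sum /=; apply: eq_bigr => m _.
rewrite -/(dehom _) dehomZ dehomX hornerZ hornerXn mevalZ mevalX !big_ord_recl big_ord0.
by rewrite /pt2 /= expr1n !mulr1.
Qed.

Lemma dehom_lead d (p : {mpoly R[2]}) : p \is d.-homog -> p.@[pt2 1 0] = (dehom p)`_d.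
Proof.
move: p; apply: homog_ind; first by rewrite meval0 dehom0 coef0.
move=> c m q dm E; rewrite dehomD coefD dehomZ coefZ dehomX coefXn mevalD mevalZ E; congr (_ * _ + _).
rewrite mevalX -dm mdegE !big_ord_recl !big_ord0 /pt2 /= expr1n mul1r mulr1 addn0 expr0n.
by rewrite -{2}[m ord0]addn0 eqn_add2l.
Qed.

Definition dehom3 (p : {mpoly R[3]}) : P2 :=
  mmap (@polyC {poly R} \o @polyC R)
    (fun i : 'I_3 => if i == 0 then ('X : {poly R})%:P else if i == 1 then 1 else 'X) p.

Lemma dehom3D p q : dehom3 (p + q) = dehom3 p + dehom3 q.
Proof. by rewrite /dehom3 mmapD. Qed.
Lemma dehom3Z c p : dehom3 (c *: p) = c%:P *: dehom3 p.
Proof. by rewrite /dehom3 mmapZ /= mul_polyC. Qed.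
Lemma dehom3_0 : dehom3 0 = 0.
Proof. by rewrite /dehom3 raddf0. Qed.
Lemma dehom3M p q : dehom3 (p * q) = dehom3 p * dehom3 q.
Proof. by rewrite /dehom3 rmorphM. Qed.
Lemma dehom3Xn p n : dehom3 (p ^+ n) = dehom3 p ^+ n.
Proof. by rewrite /dehom3 rmorphXn. Qed.
Lemma dehom3_sum (I : Type) (r : seq I) (P : pred I) F :
  dehom3 (\sum_(i <- r | P i) F i) = \sum_(i <- r | P i) dehom3 (F i).
Proof. by rewrite /dehom3 raddf_sum. Qed.

Lemma dehom3X (m : 'X_{1..3}) : dehom3 'X_[m] = ('X^(m 0))%:P * 'X^(m (inord 2)).
Proof.
have [o1 o2] := ord2.
have s3 (F : 'I_3 -> P2) : \prod_i F i = F 0 * F 1 * F (inord 2).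
  rewrite !big_ord_recl big_ord0 mulr1 mulrA; congr (F _ * F _ * F _); apply: val_inj => //=.
  by rewrite inordK.
by rewrite /dehom3 mmapX /mmap1 s3 !o1 !o2 !eqxx /= expr1n mulr1 -rmorphXn.
Qed.

Lemma mdeg3 (m : 'X_{1..3}) : mdeg m = (m 0%R + m 1%R + m (inord 2))%N.
Proof.
rewrite mdegE !big_ord_recl big_ord0 addn0 addnA; congr (m _ + m _ + m _)%N; apply: val_inj => //=.
by rewrite inordK.
Qed.

Definition hom3 (d : nat) (B : P2) : {mpoly R[3]} :=
  \sum_(j < d.+1) \sum_(i < d.+1) (B`_j)`_i *:
    ('X_(0 : 'I_3) ^+ i * 'X_(1 : 'I_3) ^+ (d - i - j) * 'X_(inord 2 : 'I_3) ^+ j).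

Lemma hom3_lin d (c : R) B B' : hom3 d (c%:P *: B + B') = c *: hom3 d B + hom3 d B'.
Proof.
rewrite /hom3 scaler_sumr -big_split /=; apply: eq_bigr => j _.
rewrite scaler_sumr -big_split /=; apply: eq_bigr => i _.
by rewrite coefD coefZ coefD coefCM scalerA scalerDl.
Qed.

Lemma hom3_0 d : hom3 d 0 = 0.
Proof. by rewrite /hom3 big1 // => j _; rewrite big1 // => i _; rewrite !coef0 scale0r. Qed.

Lemma hom3_dehom3 d p : p \is d.-homog -> hom3 d (dehom3 p) = p.
Proof.
move: p; apply: homog_ind; first by rewrite dehom3_0 hom3_0.
move=> c m q dm E; rewrite dehom3D dehom3Z hom3_lin E dehom3X; congr (_ *: _ + _).
rewrite mdeg3 in dm.
have lt0 : (m 0%R < d.+1)%N by lia.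
have lt2 : (m (inord 2) < d.+1)%N by lia.
have cf j i : (((('X^(m 0) : {poly R})%:P * 'X^(m (inord 2))) : P2)`_j)`_i =
    ((j == m (inord 2)) && (i == m 0))%:R.
  by rewrite coefCM coefXn; case: eqP => _; rewrite ?mulr1 ?mulr0 ?coefXn ?coef0.
rewrite /hom3 (bigD1 (Ordinal lt2)) //= [X in _ + X]big1 ?addr0 => [|j jm]; last first.
  rewrite big1 // => i _; rewrite cf; case: eqP => [E'|_]; last by rewrite scale0r.
  by case/eqP: jm; apply: val_inj.
rewrite (bigD1 (Ordinal lt0)) //= big1 ?addr0 => [|i im]; last first.
  rewrite cf; case: (i =P m 0 :> nat) => [E'|_]; last by rewrite andbF scale0r.
  by case/eqP: im; apply: val_inj.
rewrite cf !eqxx scale1r [RHS]mpolyXE_id !big_ord_recl big_ord0 mulr1 mulrA.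
have e1 : lift ord0 ord0 = 1 :> 'I_3 by apply: val_inj.
have e2 : lift ord0 (lift ord0 ord0) = inord 2 :> 'I_3 by apply: val_inj; rewrite /= inordK.
rewrite e1 e2; congr (_ * _ ^+ _ * _).
by rewrite -dm; lia.
Qed.

Lemma dehom3_inj d p q : p \is d.-homog -> q \is d.-homog -> dehom3 p = dehom3 q -> p = q.
Proof. by move=> hp hq E; rewrite -(hom3_dehom3 hp) E hom3_dehom3. Qed.

Lemma dehom3_emb2 (F : {mpoly R[2]}) : dehom3 (emb2 F) = (dehom F)%:P.
Proof.
rewrite [F]mpolyE dehom_sum /emb2 !raddf_sum /= dehom3_sum; apply: eq_bigr => m _.
rewrite dehomZ dehomX mwidenZ mwidenX dehom3Z dehom3X.
have -> : mnmwiden m (inord 2) = 0%N.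
  by apply: etrans (mnmwiden_ordmax m); congr (mnmwiden m _); apply: val_inj; rewrite /= inordK.
have -> : mnmwiden m 0 = m ord0.
  by apply: etrans (mnmwiden_widen m _); congr (mnmwiden m _); apply: val_inj.
by rewrite expr0 mulr1 -mul_polyC -polyCM mul_polyC.
Qed.

Lemma dehom3_zvar : dehom3 (zvar R) = 'X.
Proof.
rewrite /zvar dehom3X !mnm1E.
have -> : (@ord_max 2 == 0) = false by [].
have -> : (@ord_max 2 == inord 2) = true by apply/eqP/val_inj; rewrite /= inordK.
by rewrite expr0 expr1 mul1r.
Qed.

Lemma emb2_homog d (F : {mpoly R[2]}) : F \is d.-homog -> emb2 F \is d.-homog.
Proof.
move: F; apply: homog_ind; first by rewrite /emb2 mwiden0 dhomog0.
move=> c m q dm E; rewrite /emb2 mwidenD mwidenZ mwidenX; apply: dhomogD => //.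
apply: dhomogZ; rewrite dhomogX /= -dm; apply/eqP.
rewrite !mdegE big_ord_recr /= mnmwiden_ordmax addn0; apply: eq_bigr => i _.
by rewrite mnmwiden_widen.
Qed.

Lemma zvar_homog : zvar R \is 1.-homog.
Proof. by rewrite /zvar dhomogX /= mdeg1. Qed.

Lemma meval_emb2 (F : {mpoly R[2]}) a b c : (emb2 F).@[pt3 a b c] = F.@[pt2 a b].
Proof.
elim/mpolyind: F => [|k m q _ _ E]; first by rewrite /emb2 mwiden0 !meval0.
rewrite /emb2 mwidenD !mevalD E mwidenZ mwidenX !mevalZ !mevalX; congr (_ * _ + _).
rewrite big_ord_recr /= mnmwiden_ordmax expr0 mulr1; apply: eq_bigr => i _.
rewrite mnmwiden_widen /pt3 /pt2 /=; congr (_ ^+ _).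
by case: i => -[|[|i]].
Qed.

Lemma meval_zvar a b c : (zvar R).@[pt3 a b c] = c.
Proof. by rewrite /zvar mevalXU. Qed.

Lemma dehom3_form2 p : p \is 2.-homog -> form2 (dehom3 p).
Proof.
move: p; apply: homog_ind.
  exists 0, 0, 0; split; rewrite ?size_poly0 // dehom3_0 /quad !polyC0 !scale0r !addr0 //.
move=> c m q dm [a' [b' [c' [E sb sc]]]]; rewrite dehom3D dehom3Z E dehom3X.
rewrite mdeg3 in dm.
have key a b e : (('X^(m 0) : {poly R})%:P * 'X^(m (inord 2)) : P2) = quad a b e ->
    (size b <= 2)%N -> (size e <= 3)%N -> form2 (c%:P *: (('X^(m 0))%:P * 'X^(m (inord 2))) + quad a' b' c').
  move=> -> sb' se; rewrite quad_lin; do 3 eexists; split; first by [].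
    by apply: size_polyD_le => //; rewrite (leq_trans (size_scale_leq _ _)).
  by apply: size_polyD_le => //; rewrite (leq_trans (size_scale_leq _ _)).
have [m2|[m2|m2]] : (m (inord 2) = 0 \/ m (inord 2) = 1 \/ m (inord 2) = 2)%N by lia.
- apply: (key 0 0 'X^(m 0)); rewrite ?size_poly0 ?size_polyXn //; last by lia.
  by rewrite m2 /quad !polyC0 !scale0r !add0r expr0 mulr1.
- apply: (key 0 'X^(m 0) 0); rewrite ?size_poly0 ?size_polyXn //; last by lia.
  by rewrite m2 /quad !polyC0 !scale0r add0r addr0 expr1 mul_polyC.
- have m0 : m 0 = 0%N by lia.
  apply: (key 1 0 0); rewrite ?size_poly0 //.
  by rewrite m2 m0 /quad !polyC1 !polyC0 scale0r !addr0 scale1r mul1r.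
Qed.

Lemma form2_dehom3 B : form2 B -> exists2 p, p \is 2.-homog & dehom3 p = B.
Proof.
move=> [a [b [c [-> sb sc]]]].
exists (a *: zvar R ^+ 2 + emb2 (hom2 1 b) * zvar R + emb2 (hom2 2 c)).
  apply: dhomogD; last exact/emb2_homog/hom2_homog.
  apply: dhomogD; last exact: (dhomogM (emb2_homog (hom2_homog 1 b)) zvar_homog).
  by apply: dhomogZ; exact: (dhomogMn 2 zvar_homog).
by rewrite !dehom3D dehom3Z dehom3M dehom3Xn !dehom3_emb2 dehom3_zvar !dehom_hom2 // /quad mul_polyC.
Qed.

(** On forms of a fixed degree [dehom3] is injective, linear and compatible with products, so
    representations and orthogonal equivalence transfer in both directions. *)
Lemma num_classes (f : {mpoly R[3]}) N t p2 p3 p4 : f \is 4.-homog -> dehom3 f = target t p2 p3 p4 ->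
  (exists r : 'I_N -> 'I_3 -> P2,
    [/\ forall k, is_rep t p2 p3 p4 (r k), forall k l, k != l -> ~ equivP (r k) (r l) &
        forall P, is_rep t p2 p3 p4 P -> exists k, equivP (r k) P]) ->
  num_sos3_classes f N.
Proof.
move=> hf Ef [r [rP rD rA]].
have ex (ki : 'I_N * 'I_3) : exists p, p \is 2.-homog /\ dehom3 p = r ki.1 ki.2.
  by have [p ? ?] := form2_dehom3 ((rP ki.1).1 ki.2); exists p.
have [q Hq] := boolp.choice ex.
pose q' k i := q (k, i).
have q'h k i : q' k i \is 2.-homog by case: (Hq (k, i)).
have q'r k i : dehom3 (q' k i) = r k i by case: (Hq (k, i)).
have equivE (p p' : 'I_3 -> {mpoly R[3]}) : (forall i, p i \is 2.-homog) -> (forall i, p' i \is 2.-homog) ->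
    orth_equiv p p' <-> equivP (fun i => dehom3 (p i)) (fun i => dehom3 (p' i)).
  move=> hp hp'; split=> -[S [HS E]]; exists S; split=> // j.
    by rewrite E dehom3_sum; apply: eq_bigr => i _; rewrite dehom3Z.
  apply: (dehom3_inj (hp' j)).
    by apply: rpred_sum => i _; apply: rpredZ; exact: hp.
  by rewrite E dehom3_sum; apply: eq_bigr => i _; rewrite dehom3Z.
have ext (P P' Q Q' : 'I_3 -> P2) : P =1 P' -> Q =1 Q' -> equivP P Q -> equivP P' Q'.
  move=> EP EQ [S [HS E]]; exists S; split=> // j.
  by rewrite -EQ E; apply: eq_bigr => i _; rewrite EP.
have sosE (p : 'I_3 -> {mpoly R[3]}) : (forall i, p i \is 2.-homog) ->
    f = \sum_(i < 3) p i ^+ 2 <-> \sum_i dehom3 (p i) ^+ 2 = target t p2 p3 p4.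
  move=> hp; have -> : \sum_i dehom3 (p i) ^+ 2 = dehom3 (\sum_i p i ^+ 2).
    by rewrite dehom3_sum; apply: eq_bigr => i _; rewrite dehom3Xn.
  rewrite -Ef; split=> [<- //|E]; apply: (dehom3_inj hf) => //.
  by apply: rpred_sum => i _; exact: (dhomogMn 2 (hp i)).
exists q'; split=> [k|].
  split=> //; apply/sosE => //; rewrite -(rP k).2; apply: eq_bigr => i _.
  by rewrite q'r.
split=> [k l kl /(equivE _ _ (q'h k) (q'h l)) E|p [hp Ep]].
  by apply: (rD k l kl); apply: ext E => i; rewrite q'r.
have [|k Hk] := rA (fun i => dehom3 (p i)).
  by split=> [i|]; [exact: dehom3_form2 | exact/sosE].
by exists k; apply/equivE => //; apply: ext Hk => i; rewrite ?q'r.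
Qed.

End Dehomogenization.

(** * From the discriminant and [Phi] conditions to nondegeneracy *)

Section Genericity.
Variable R : realType.
Local Notation C := R[i].
Local Notation cx := (map_poly (real_complex R)).
Implicit Types (p q : {poly R}) (a : C).

(* The coefficient of degree i + j - 1 is i j (a_i b_j - a_i b_j) = 0. *)
Lemma size_gij i j (p q : {poly R}) : (size p <= i.+2)%N -> (size q <= j.+2)%N ->
  (size (gij i.+1 j.+1 p q) <= (i + j).+1)%N.
Proof.
have top k (r : {poly R}) : (size r <= k.+2)%N -> (size r^`() <= k.+1)%N.
  by move=> sr; apply/leq_sizeP => l kl; rewrite coef_deriv nth_default ?mul0rn // (leq_trans sr).
move=> sp sq; have sp' := top _ _ sp; have sq' := top _ _ sq.
have s1 : (size (p * q^`())%R <= (i + j).+2)%N by rewrite -addSn; exact: size_polyM_le.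
have s2 : (size (q * p^`())%R <= (i + j).+2)%N by rewrite addnC -addSn; exact: size_polyM_le.
apply/leq_sizeP => l; rewrite leq_eqVlt coefB !coefMn => /orP[/eqP <-|lt].
  rewrite -{1}addSn (coefM_top sp sq') addnC -addSn (coefM_top sq sp') !coef_deriv.
  by rewrite !mulrnAr -!mulrnA mulnC mulrC subrr.
by rewrite !(nth_default _ (leq_trans _ lt)) // !mul0rn subrr.
Qed.

Lemma size_cofactor p (q F : {poly C}) m : q \is monic -> size q = 3 -> (size p <= m.+1)%N ->
  cx p = q * F -> (size F <= m.-1)%N.
Proof.
move=> mq sq sp E; have [->|F0] := eqVneq F 0; first by rewrite size_poly0.
have := sp; rewrite -(size_map_poly (real_complex R)) E size_monicM // sq.
by case: m {sp} => [|m] //=; rewrite ?ltnS.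
Qed.

Lemma disc_sep m p : (1 < m)%N -> (size p <= m.+1)%N -> disc m p != 0 ->
  forall a F, cx p <> ('X - a%:P) ^+ 2 * F.
Proof.
move=> m1 sp /eqP D a F E; apply: D; apply: (disc_double m1 sp _ E).
by apply: (size_cofactor _ _ sp E); rewrite ?rpredX ?monicXsubC ?size_exp_XsubC.
Qed.

(** A degree drop of two or more is a double zero at infinity. *)
Lemma disc_size m p : (1 < m)%N -> disc m p != 0 -> (m.-1 < size p)%N.
Proof. by move=> m1; apply: contraR; rewrite -leqNgt => /(disc_infty m1) ->. Qed.

Lemma nneg_disc_gt0 m p : (1 < m)%N -> (size p <= m.+1)%N -> disc m p != 0 ->
  (forall x, 0 <= p.[x]) -> forall x, 0 < p.[x].
Proof.
move=> m1 sp D p0 x; rewrite lt_neqAle p0 andbT eq_sym; apply/eqP => px.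
have [q E] := nneg_double_root p0 px.
apply: (disc_sep m1 sp D (a := x%:C%C) (F := cx q)).
by rewrite E rmorphM rmorphXn rmorphB /= map_polyX map_polyC.
Qed.

(* The reversed polynomial has a double zero at 0 as soon as it vanishes there. *)
Lemma nneg_disc_lead m p : (1 < m)%N -> ~~ odd m -> (size p <= m.+1)%N -> disc m p != 0 ->
  (forall x, 0 <= p.[x]) -> p`_m != 0.
Proof.
move=> m1 om sp D p0; apply/eqP => pm.
pose r := \poly_(j < m.+1) p`_(m - j).
have Er y : y != 0 -> r.[y] = y ^+ m * p.[y^-1].
  move=> y0; rewrite (horner_coef_wide _ (size_poly _ _)) (horner_coef_wide _ sp).
  rewrite mulr_sumr (reindex_inj rev_ord_inj) /=; apply: eq_bigr => i _.
  have im : (i <= m)%N by rewrite -ltnS.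
  rewrite coef_poly subSS ltnS leq_subr subKn // exprB ?unitfE // exprVn.
  ring.
have r0 y : 0 <= r.[y].
  have [->|y0] := eqVneq y 0; first by rewrite horner_coef0 coef_poly subn0 pm.
  by rewrite Er // mulr_ge0 // exprn_even_ge0.
have [|q Eq] := nneg_double_root r0 (x := 0); first by rewrite horner_coef0 coef_poly subn0 pm.
have p1 : p`_(m.-1) = 0.
  have : r`_1 = 0 by rewrite Eq subr0 coefXnM.
  by rewrite coef_poly ltnS (ltnW m1) subn1.
have := disc_size m1 D; apply/negP; rewrite -leqNgt; apply/leq_sizeP => j.
rewrite leq_eqVlt => /orP[/eqP <- //|]; rewrite prednK ?(ltnW m1) // leq_eqVlt => /orP[/eqP <- //|mj].
by rewrite nth_default // (leq_trans sp).
Qed.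

(** [h] is the minimal polynomial of [a] over the reals, [X - x] or [X^2 - 2 u X + u^2 + v^2]. *)
Lemma real_factor a : exists2 h : {poly R}, (1 < size h <= 3)%N & forall p, evC p a = 0 -> h %| p.
Proof.
have [[x ->]|na] := real_or_nonreal a.
  exists ('X - x%:P); first by rewrite size_XsubC.
  by move=> p /evC_root px; rewrite dvdp_XsubCl; apply/rootP.
case: a na => u v na.
pose r : {poly R} := (- (u *+ 2)) *: 'X + (u ^+ 2 + v ^+ 2)%:P.
have sr : (size r < 3)%N.
  rewrite ltnS; apply: size_polyD_le; last exact: leq_trans (size_polyC_leq1 _) _.
  by rewrite (leq_trans (size_scale_leq _ _)) // size_polyX.
have sh : size ('X^2 + r) = 3 by rewrite size_polyDl size_polyXn.
exists ('X^2 + r); first by rewrite sh.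
have h0 : evC ('X^2 + r) (u +i* v)%C = 0.
  rewrite /r evCD evCD evCX evCZ /evC !map_polyX map_polyC /= !hornerX hornerC.
  by apply/eqP; rewrite eq_complex /=; apply/andP; split; apply/eqP; ring.
move=> p p0; apply/modp_eq0P; apply: (evC_nonreal_linear na).
  have : (size (p %% ('X^2 + r))%R < size ('X^2 + r)%R)%N by rewrite ltn_modpN0 // -size_poly_eq0 sh.
  by rewrite sh.
by have := p0; rewrite {1}(divp_eq p ('X^2 + r)) evCD evCM h0 mulr0 add0r.
Qed.

Lemma cone_genericP (p2 p3 p4 : {poly R}) :
  size p2 = 3 -> (size p3 <= 4)%N -> (size p4 <= 5)%N ->
  (forall x z, 0 <= p2.[x] * z ^+ 2 + p3.[x] * z + p4.[x]) ->
  (forall z, 0 <= p2`_2 * z ^+ 2 + p3`_3 * z + p4`_4) ->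
  disc 2 p2 != 0 -> ~~ (p2 %| p3) -> disc 6 (4 *: (p2 * p4) - p3 ^+ 2) != 0 ->
  cone_generic p2 p3 p4.
Proof.
move=> size2 s3 s4 psd psd_inf d2 dv d6; have s2 : (size p2 <= 3)%N by rewrite size2.
have p2_ge0 x : 0 <= p2.[x] by apply: quad_lead_ge0 (psd x).
have p2_gt0 : forall x, 0 < p2.[x] by apply: (nneg_disc_gt0 (m := 2)).
have p22 : p2`_2 != 0.
  have : lead_coef p2 != 0 by rewrite lead_coef_eq0 -size_poly_eq0 size2.
  by rewrite lead_coefE size2.
have sD : (size (4 *: (p2 * p4) - p3 ^+ 2)%R <= 7)%N.
  apply: size_polyD_le; rewrite ?size_polyN ?expr2; last exact: (@size_polyM_le _ _ _ 3 3).
  by rewrite (leq_trans (size_scale_leq _ _)) //; exact: (@size_polyM_le _ _ _ 2 4).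
have D0 x : 0 <= (4 *: (p2 * p4) - p3 ^+ 2).[x].
  rewrite hornerD hornerN hornerZ hornerM horner_exp subr_ge0 mulrA.
  exact: quad_disc (p2_gt0 x) (psd x).
split=> //.
- by rewrite lt_neqAle eq_sym p22; exact: quad_lead_ge0 psd_inf.
- exact: nneg_disc_lead.
- exact: (disc_sep (m := 6)).
move=> a p2a p3a; have [[x E]|na] := real_or_nonreal a.
  by have := p2_gt0 x; rewrite (evC_root (x := x)) ?ltxx // -E.
case/negP: dv; apply/modp_eq0P; apply: (evC_nonreal_linear na).
  have : (size (p3 %% p2)%R < size p2)%N by rewrite ltn_modpN0 // -size_poly_eq0 size2.
  by rewrite size2.
by have := p3a; rewrite {1}(divp_eq p3 p2) evCD evCM p2a mulr0 add0r.
Qed.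

Lemma factor_conj p a : a != a^*%C -> evC p a = 0 ->
  exists F : {poly C}, cx p = ('X - a%:P) * ('X - a^*%C%:P) * F.
Proof.
move=> na pa; have [q Eq] := factorC pa; have := evC_conj0 pa.
rewrite /evC Eq hornerM hornerXsubC => /eqP; rewrite mulf_eq0 subr_eq0 eq_sym (negPf na) /=.
by move=> /factor_theorem [r ->]; exists r; rewrite -mulrA; congr (_ * _); rewrite mulrC.
Qed.

Lemma Phi_conj m n p (G H : {poly R}) a : (1 < m)%N -> (0 < n)%N -> (size p <= m.+1)%N ->
  (size G <= n.+1)%N -> (size H <= n.+1)%N -> a != a^*%C -> Phi m n p G H != 0 -> evC p a = 0 ->
  evC G a * evC H a^*%C <> evC G a^*%C * evC H a.
Proof.
move=> m1 n0 sp sG sH na /eqP D pa E; have [F EF] := factor_conj na pa; apply: D.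
apply: (Phi_common m1 n0 sp sG sH _ EF na E).
apply: (size_cofactor _ _ sp EF); first by rewrite monicMl ?monicXsubC.
by rewrite size_monicM ?monicXsubC ?size_XsubC // -size_poly_eq0 size_XsubC.
Qed.

Lemma coprimep_no_common_root p q a : coprimep p q -> evC p a = 0 -> evC q a = 0 -> False.
Proof.
rewrite -(coprimep_map (real_complex R)) => cop /rootP pa /rootP qa.
by have := coprimep_root cop pa; rewrite -/(root _ _) qa.
Qed.

Lemma pencil_genericP (p2 p3 p4 : {poly R}) : cone_generic p2 p3 p4 ->
  let g23 := gij 2 3 p2 p3 in let g24 := gij 2 4 p2 p4 in let g34 := gij 3 4 p3 p4 in
  let Q := p4 ^+ 2 * g23 * (p4 * g23 *+ 2 - p3 * g24) in
  let Rp := (p2 * p4 *+ 8 - p3 ^+ 2 *+ 3) * g23 + p2 * p3 * g24 *+ 2 in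
  (forall x z, 0 <= p2.[x] * z ^+ 2 + p3.[x] * z + p4.[x]) ->
  (forall z, 0 <= p2`_2 * z ^+ 2 + p3`_3 * z + p4`_4) ->
  (forall x z, 0 < z ^+ 4 + p2.[x] * z ^+ 2 + p3.[x] * z + p4.[x]) ->
  (forall z, 0 < z ^+ 4 + p2`_2 * z ^+ 2 + p3`_3 * z + p4`_4) ->
  disc 3 p3 != 0 -> (forall a, evC p3 a = 0 -> evC p4 a = 0 -> False) -> coprimep g23 g24 ->
  Phi 3 4 p3 (p2 ^+ 2) p4 != 0 -> Phi 8 18 (g23 * g34 - g24 ^+ 2) Q (Rp ^+ 2) != 0 ->
  pencil_generic p2 p3 p4.
Proof.
move=> gen g23 g24 g34 Q Rp psd psd_inf pd pd_inf d3 cop34 cop P34 P818.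
have s2 := size_p2 gen; have s3 := size_p3 gen; have s4 := size_p4 gen.
(* The quartic at [t] is [(1 - t^2)] times the one at 0 plus [t^2] times the one at 1; so positivity
   at 1 and semidefiniteness at 0 give positivity for [0 < t <= 1]. *)
have mix (t b c d z : R) : 0 < t <= 1 -> 0 <= b * z ^+ 2 + c * z + d ->
    0 < z ^+ 4 + b * z ^+ 2 + c * z + d -> 0 < t ^+ 2 * z ^+ 4 + b * z ^+ 2 + c * z + d.
  move=> /andP[t0 t1]; set q := b * z ^+ 2 + c * z + d => q0.
  have Eq u : u + b * z ^+ 2 + c * z + d = u + q by rewrite /q !addrA.
  rewrite !Eq => q1.
  have -> : t ^+ 2 * z ^+ 4 + q = (1 - t ^+ 2) * q + t ^+ 2 * (z ^+ 4 + q) by ring.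
  by apply: ltr_wpDl; rewrite ?mulr_ge0 ?mulr_gt0 ?exprn_gt0 // subr_ge0 expr_le1 // ltW.
have M := size_polyM_le; have A := size_polyD_le.
have Mn (p : {poly R}) n m : (size p <= m)%N -> (size (p *+ n) <= m)%N.
  by move=> sp; rewrite -scaler_nat (leq_trans (size_scale_leq _ _)).
have Nn (p : {poly R}) m : (size p <= m)%N -> (size (- p) <= m)%N by rewrite size_polyN.
have s23 : (size g23 <= 4)%N by apply: (@size_gij 1 2).
have s24 : (size g24 <= 5)%N by apply: (@size_gij 1 3).
have s34 : (size g34 <= 6)%N by apply: (@size_gij 2 3).
have sP : (size (g23 * g34 - g24 ^+ 2)%R <= 9)%N.
  by apply: (A _); [exact: (M _ _ _ 3 5) | apply: (Nn _); exact: (M _ _ _ 4 4)].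
have sQ : (size Q <= 19)%N.
  apply: (M _ _ _ 11 7); first by apply: (M _ _ _ 8 3) => //; exact: (M _ _ _ 4 4).
  by apply: (A _); [apply: (Mn _); exact: (M _ _ _ 4 3) | apply: (Nn _); exact: (M _ _ _ 3 4)].
have sR : (size Rp <= 10)%N.
  apply: (A _); last by apply: (Mn _); apply: (M _ _ _ 5 4) => //; exact: (M _ _ _ 2 3).
  apply: (M _ _ _ 6 3) => //; apply: (A _); first by apply: (Mn _); exact: (M _ _ _ 2 4).
  by apply: (Nn _); apply: (Mn _); exact: (M _ _ _ 3 3).
split=> //.
- by move=> t x z t01; apply: mix.
- by move=> t z t01; apply: mix.
- exact: (disc_sep (m := 3)).
- exact: disc_size d3.
- by move=> a; exact: coprimep_no_common_root.
- by move=> a na p3a; apply: (Phi_conj (m := 3) (n := 4) (p := p3)) => //; exact: (M _ _ _ 2 2).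
- move=> a na Pa; apply: (Phi_conj (m := 8) (n := 18) (p := g23 * g34 - g24 ^+ 2)) => //.
  exact: (M _ _ _ 9 9).
Qed.

(** If [h = 0], then [p3^2 + w^2 = 0], and comparing leading coefficients contradicts [p3] being
    nonzero. *)
Lemma sol1_hpol_neq0 (p2 p3 p4 g w : {poly R}) : (0 < size p3)%N -> solution p2 p3 p4 1 g w ->
  hpol p2 1 g != 0.
Proof.
move=> s3 sol; apply/eqP => h0; have := solE sol; rewrite h0 mul0r scaler0 => E.
have p30 : p3 != 0 by rewrite -size_poly_gt0.
have w2 : w ^+ 2 = - p3 ^+ 2 by apply/eqP; rewrite -addr_eq0 addrC -E.
have : lead_coef (w ^+ 2) = - lead_coef (p3 ^+ 2) by rewrite w2 lead_coefN.
rewrite !lead_coef_exp => L; have : lead_coef p3 != 0 by rewrite lead_coef_eq0.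
have := sqr_ge0 (lead_coef w); rewrite L oppr_ge0.
by rewrite -[_ <= 0]andbT -(sqr_ge0 (lead_coef p3)) -eq_le sqrf_eq0 => ->.
Qed.

End Genericity.

Section FormConditions.
Variable R : realType.
Local Notation C := R[i].

Lemma dehomC (c : R) : dehom c%:MP_[2] = c%:P.
Proof. by rewrite /dehom mmapC. Qed.

Lemma mdvd_dehom m n (F G : {mpoly R[2]}) : F \is m.-homog -> G \is n.-homog -> (m <= n)%N ->
  size (dehom F) = m.+1 -> dehom F %| dehom G -> mdvd F G.
Proof.
move=> hF hG mn sF dv; exists (hom2 (n - m) (dehom G %/ dehom F)).
have hH : F * hom2 (n - m) (dehom G %/ dehom F) \is n.-homog.
  by have := dhomogM hF (hom2_homog (n - m) (dehom G %/ dehom F)); rewrite subnKC.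
apply: (dehom_inj hG hH); rewrite dehomM dehom_hom2 ?(mulrC (dehom F)) ?divpK //.
by rewrite size_divp -?size_poly_eq0 ?sF //= leq_subLR addnS subnKC // size_dehom.
Qed.

(** A common complex zero gives a common real factor of degree 1 or 2, whose homogenization divides
    both forms; the bounds on [m] and [n] leave room for a quadratic factor. *)
Lemma mcoprime_evC m n (F G : {mpoly R[2]}) (a : C) : F \is m.-homog -> G \is n.-homog ->
  (2 <= m)%N -> (2 <= n)%N -> mcoprime F G -> evC (dehom F) a = 0 -> evC (dehom G) a = 0 -> False.
Proof.
move=> hF hG m2 n2 cop Fa Ga; have [h /andP[h1 h3] hd] := real_factor a.
pose e := (size h).-1.
have eh : size h = e.+1 by rewrite prednK // (leq_trans _ h1).
have he : dehom (hom2 e h) = h by rewrite dehom_hom2 // eh.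
have e2 : (e <= 2)%N by rewrite -ltnS -eh.
have [||c [_ Ec]] := cop (hom2 e h).
- by apply: (mdvd_dehom (hom2_homog e h) hF); rewrite ?he ?hd // (leq_trans e2).
- by apply: (mdvd_dehom (hom2_homog e h) hG); rewrite ?he ?hd // (leq_trans e2).
by move: h1; rewrite -he Ec dehomC ltnNge size_polyC_leq1.
Qed.

Lemma dehom_cone_disc (f2 f3 f4 : {mpoly R[2]}) :
  dehom (4%:R * f2 * f4 - f3 ^+ 2) = 4 *: (dehom f2 * dehom f4) - dehom f3 ^+ 2.
Proof.
by rewrite -mulrA mulr_natl -scaler_nat -scaleN1r dehomD !dehomZ !expr2 !dehomM scaleN1r.
Qed.

Lemma meval_quad (f2 f3 f4 : {mpoly R[2]}) x y z :
  (emb2 f2 * zvar R ^+ 2 + emb2 f3 * zvar R + emb2 f4).@[pt3 x y z] =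
  f2.@[pt2 x y] * z ^+ 2 + f3.@[pt2 x y] * z + f4.@[pt2 x y].
Proof. by rewrite !expr2 !mevalD !mevalM !meval_emb2 !meval_zvar. Qed.

Lemma dehom3_quad (f2 f3 f4 : {mpoly R[2]}) :
  dehom3 (emb2 f2 * zvar R ^+ 2 + emb2 f3 * zvar R + emb2 f4) =
  dehom f2 *: 'X^2 + dehom f3 *: 'X + (dehom f4)%:P.
Proof. by rewrite !expr2 !dehom3D !dehom3M !dehom3_emb2 dehom3_zvar !mul_polyC. Qed.

Lemma quad_homog (f2 f3 f4 : {mpoly R[2]}) : f2 \is 2.-homog -> f3 \is 3.-homog -> f4 \is 4.-homog ->
  emb2 f2 * zvar R ^+ 2 + emb2 f3 * zvar R + emb2 f4 \is 4.-homog.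
Proof.
move=> h2 h3 h4; apply: dhomogD; last exact: emb2_homog.
apply: dhomogD; last exact: (dhomogM (emb2_homog h3) (zvar_homog R)).
exact: (dhomogM (emb2_homog h2) (dhomogMn 2 (zvar_homog R))).
Qed.

Lemma psd_cone_generic (f2 f3 f4 : {mpoly R[2]}) : f2 \is 2.-homog -> f3 \is 3.-homog -> f4 \is 4.-homog ->
  let p2 := dehom f2 in let p3 := dehom f3 in let p4 := dehom f4 in
  psd (emb2 f2 * zvar R ^+ 2 + emb2 f3 * zvar R + emb2 f4) ->
  bdisc 2 f2 != 0 -> ~ mdvd f2 f3 -> bdisc 6 (4%:R * f2 * f4 - f3 ^+ 2) != 0 ->
  [/\ forall x z, 0 <= p2.[x] * z ^+ 2 + p3.[x] * z + p4.[x],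
      forall z, 0 <= p2`_2 * z ^+ 2 + p3`_3 * z + p4`_4 & cone_generic p2 p3 p4].
Proof.
move=> h2 h3 h4 p2 p3 p4 pf d2 dv d6.
have pf1 x z : 0 <= p2.[x] * z ^+ 2 + p3.[x] * z + p4.[x].
  by have := pf (pt3 x 1 z); rewrite meval_quad !dehom_horner.
have pf2 z : 0 <= p2`_2 * z ^+ 2 + p3`_3 * z + p4`_4.
  by have := pf (pt3 1 0 z); rewrite meval_quad (dehom_lead h2) (dehom_lead h3) (dehom_lead h4).
have s2 := size_dehom h2; have s3 := size_dehom h3; have s4 := size_dehom h4.
have size2 : size p2 = 3.
  apply/eqP; rewrite eqn_leq s2 /=; have p0 : forall x, 0 <= p2.[x] by move=> x; apply: quad_lead_ge0 (pf1 x).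
  by rewrite ltnNge; apply: contra (nneg_disc_lead (m := 2) isT isT s2 d2 p0) => /leq_sizeP ->.
split=> //; apply: cone_genericP => //; last by rewrite -dehom_cone_disc.
by apply/negP => H; apply: dv; exact: (mdvd_dehom h2 h3 _ size2 H).
Qed.

End FormConditions.

Unset Implicit Arguments.

Theorem theorem9p5 (R : realType) :
  (* (a) *)
  (forall (f : {mpoly R[3]}) (f2 f3 f4 : {mpoly R[2]}),
      f \is 4.-homog -> psd f -> f.@[pt3 0 0 1] = 0 ->
      f2 \is 2.-homog -> f3 \is 3.-homog -> f4 \is 4.-homog ->
      f = emb2 f2 * zvar R ^+ 2 + emb2 f3 * zvar R + emb2 f4 ->
      bdisc 2 f2 != 0 ->
      ~ mdvd f2 f3 ->
      bdisc 6 (4%:R * f2 * f4 - f3 ^+ 2) != 0 ->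
      num_sos3_classes f 4)
  /\
  (* (b) *)
  (forall (f2 f3 f4 : {mpoly R[2]}),
      f2 \is 2.-homog -> f3 \is 3.-homog -> f4 \is 4.-homog ->
      let f := zvar R ^+ 4 + emb2 f2 * zvar R ^+ 2 + emb2 f3 * zvar R + emb2 f4 in
      spd f -> psd (f - zvar R ^+ 4) ->
      let p2 := dehom f2 in let p3 := dehom f3 in let p4 := dehom f4 in
      let g23 := gij 2 3 p2 p3 in
      let g24 := gij 2 4 p2 p4 in
      let g34 := gij 3 4 p3 p4 in
      let P := g23 * g34 - g24 ^+ 2 in
      let Q := p4 ^+ 2 * g23 * (p4 * g23 *+ 2 - p3 * g24) in
      let Rp := (p2 * p4 *+ 8 - p3 ^+ 2 *+ 3) * g23 + p2 * p3 * g24 *+ 2 in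
      (* not (E1) *) bdisc 2 f2 != 0 ->
      (* not (E2) *) ~ mdvd f2 f3 ->
      (* not (E3) *) bdisc 6 (4%:R * f2 * f4 - f3 ^+ 2) != 0 ->
      (* not (E4) *) bdisc 3 f3 != 0 ->
      (* not (E5) *) mcoprime f3 f4 ->
      (* not (E6) *) coprimep g23 g24 ->
      (* not (E7) *) coprimep g24 g34 ->
      (* not (E8) *) Phi 3 4 p3 (p2 ^+ 2) p4 != 0 ->
      (* not (E9) *) disc 8 P != 0 ->
      (* not (E10) *) Phi 8 18 P Q (Rp ^+ 2) != 0 ->
      (* not (E11) *) mcoprime f3 (4%:R * f4 - f2 ^+ 2) ->
      num_sos3_classes f 8).
Proof.
split=> [f f2 f3 f4 hf pf _ h2 h3 h4 Ef d2 dv d6|f2 f3 f4 h2 h3 h4 f sf pf p2 p3 p4 g23 g24 g34 P Q Rp d2 dv d6 d3 cop34 cop _ P34 _ P818 _].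
  have pq : psd (emb2 f2 * zvar R ^+ 2 + emb2 f3 * zvar R + emb2 f4) by rewrite -Ef.
  have [_ _ gen] := psd_cone_generic h2 h3 h4 pq d2 dv d6.
  have [G [W [SG _ DG AG]]] := cone_count gen.
  have hp0 g : hpol (dehom f2) 0 g = dehom f2 by rewrite /hpol mul0rn scale0r subr0.
  apply: (@num_classes R f 4 0 (dehom f2) (dehom f3) (dehom f4) hf).
    by rewrite Ef dehom3_quad /target expr0n polyC0 scale0r add0r.
  apply: (@rep_classes R 0 (dehom f2) (dehom f3) (dehom f4)) SG _ _; try by case: gen.
  - by left.
  - move=> g w _; rewrite hp0; apply: contraTneq (p2_gt0 gen 0) => ->.
    by rewrite horner0 ltxx.
  (* At [t = 0], [h] is [p2] itself, which has no zero in common with [p3]. *)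
  - by move=> g w x _ _; rewrite hp0 => p2x _; exact: (p2_p3_coprime gen).
  - by move=> k l /DG [? ?] [|[_]].
  by move=> g w /AG [k [->|->]]; exists k; [left | right].
have Ef : f = zvar R ^+ 4 + (emb2 f2 * zvar R ^+ 2 + emb2 f3 * zvar R + emb2 f4).
  by rewrite /f -!addrA.
have fq : f - zvar R ^+ 4 = emb2 f2 * zvar R ^+ 2 + emb2 f3 * zvar R + emb2 f4.
  by rewrite Ef addrC addKr.
rewrite fq in pf.
have [q1 q2 cgen] := psd_cone_generic h2 h3 h4 pf d2 dv d6.
have fE x y z : f.@[pt3 x y z] =
    z ^+ 4 + f2.@[pt2 x y] * z ^+ 2 + f3.@[pt2 x y] * z + f4.@[pt2 x y].
  by rewrite Ef mevalD meval_quad rmorphXn /= meval_zvar !addrA.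
have gen : pencil_generic p2 p3 p4.
  apply: pencil_genericP => //.
  - move=> x z; have := sf (pt3 x 1 z); rewrite fE !dehom_horner; apply.
    by exists 1; rewrite /pt3 /= oner_neq0.
  - move=> z; have := sf (pt3 1 0 z); rewrite fE (dehom_lead h2) (dehom_lead h3) (dehom_lead h4); apply.
    by exists 0; rewrite /pt3 /= oner_neq0.
  - by move=> a; exact: (mcoprime_evC h3 h4).
have [G [W [SG DG AG]]] := pencil_count gen.
apply: (@num_classes R f 8 1 p2 p3 p4).
- by rewrite Ef; apply: dhomogD (quad_homog h2 h3 h4); exact: (dhomogMn 4 (zvar_homog R)).
- by rewrite Ef dehom3D dehom3_quad dehom3Xn dehom3_zvar /target expr1n polyC1 scale1r !addrA.
apply: (@rep_classes R 1 p2 p3 p4) SG _ _; try by case: cgen.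
- by right.
- by move=> g w; apply: sol1_hpol_neq0; apply: leq_trans (p3_size gen).
- move=> g w x sol nx hx kx p3x; apply: (pencil_Phi34 gen nx p3x).
  (* At a common zero of [h], [k] and [p3], [p2 = 2 g] and [p4 = g^2], so [p2^2 = 4 p4] at [x] and
     at its conjugate. *)
  have p2x : evC p2 x = evC g x *+ 2.
    by move: hx; rewrite /hpol evCD evCN evCZ rmorphMn /= mulrnAl mul1r => /eqP; rewrite subr_eq0 => /eqP.
  have p4x : evC p4 x = evC g x ^+ 2.
    by move: kx; rewrite /kpol evCD evCN evCX => /eqP; rewrite subr_eq0 => /eqP.
  rewrite !evC_conj !evCX p4x p2x.
  rewrite !rmorphXn /= !rmorphMn /=; ring.
- by move=> k l /DG H [|[/eqP]]; rewrite ?oner_eq0.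
by move=> g w /AG [k ->]; exists k; left.
Qed.
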